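(* Let $d\ge2$, $\{r_n\}\subset(0,1)$ and $\{s_n\}\subset(1,+\infty)$ with $r_n\to0^+$ and $s_n\to1^+$. Let $\{E_n\}\subset\mathfrak{C}$ with $E_n\to E$ in $\mathfrak{C}$ for some $E\in\mathfrak{C}$. Then for every $x\in\partial E\cap\partial E_n$ for all $n$, $$\lim_{n\to\infty}\frac{\mathcal K^{s_n}_{r_n}(x,E_n)}{\beta(r_n,s_n)}=\omega_{d-1}\mathcal K^1(x,E).$$
   Context: $\mathfrak{C}$ is the class of subsets of $\mathbb{R}^d$ which are closures of open sets with compact $C^2$ boundary; $E_n\to E$ in $\mathfrak{C}$ means there are diffeomorphisms $\Phi_n$ converging to the identity in $C^2$ with $\Phi_n(E)=E_n$. $k^s_r(t)=r^{-d-s}$ for $0\le t\le r$ and $k^s_r(t)=t^{-d-s}$ for $t>r$; $\mathcal K^s_r(x,E):=\int_{\mathbb{R}^d}(\chi_{\mathbb{R}^d\setminus E}(y)-\chi_E(y))k^s_r(|x-y|)\,dy$. $\beta(r,s):=\frac{d+s}{d+1}\frac{r^{1-s}-1}{s-1}+\frac1{d+1}$. $\omega_{d-1}$ is the measure of the unit ball of $\mathbb{R}^{d-1}$; $\mathcal K^1$ is the classical scalar mean curvature (sum of principal curvatures, positive on balls). *)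

(* Defs.v *)
From HB Require Import structures.
From mathcomp Require Import all_boot all_order all_algebra.
From mathcomp Require Import all_classical all_reals all_analysis.
Set Implicit Arguments. Unset Strict Implicit. Unset Printing Implicit Defensive.
Import Order.TTheory GRing.Theory Num.Theory.
Import numFieldNormedType.Exports.
Local Open Scope classical_set_scope.
Local Open Scope ring_scope.

Section Defs.
Variable R : realType.

(* Euclidean norm on R^d (the library norm on matrices is the sup norm). *)
Definition fc_enorm d (v : 'rV[R]_d) : R := Num.sqrt (\sum_(i < d) v ord0 i ^+ 2).

(* Integral over R^d w.r.t. Lebesgue measure, written as an iterated
   one-dimensional Lebesgue integral (first coordinate outermost). *)
Fixpoint fc_iint (n : nat) : ('rV[R]_n -> \bar R) -> \bar R :=
  match n with
  | 0 => fun f => f 0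
  | m.+1 => fun f => (\int[@lebesgue_measure R]_(t in [set: R])
              fc_iint (fun v : 'rV[R]_m => f (row_mx (\row_(i < 1) t) v)))%E
  end.

Definition fc_omega (k : nat) : \bar R :=
  fc_iint (fun v : 'rV[R]_k => (\1_[set w | fc_enorm w <= 1] v)%:E).

Definition fc_evec d (i : 'I_d) : 'rV[R]_d := delta_mx ord0 i.
Definition fc_pd d (f : 'rV[R]_d -> R) (i : 'I_d) : 'rV[R]_d -> R :=
  fun x => 'D_(fc_evec i) f x.

Definition fc_C1 d (f : 'rV[R]_d -> R) : Prop :=
  continuous f /\ (forall i x, derivable f x (fc_evec i)) /\
  (forall i, continuous (fc_pd f i)).
Definition fc_C2 d (f : 'rV[R]_d -> R) : Prop :=
  fc_C1 f /\ forall i, fc_C1 (fc_pd f i).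

Definition fc_comp d (F : 'rV[R]_d -> 'rV[R]_d) (j : 'I_d) : 'rV[R]_d -> R :=
  fun x => F x ord0 j.

Definition fc_C2map d (F : 'rV[R]_d -> 'rV[R]_d) : Prop := forall j, fc_C2 (fc_comp F j).

Definition fc_C2diffeo d (F : 'rV[R]_d -> 'rV[R]_d) : Prop :=
  fc_C2map F /\ exists G : 'rV[R]_d -> 'rV[R]_d,
    fc_C2map G /\ cancel F G /\ cancel G F.

Definition fc_C2_to_id d (Phi : nat -> 'rV[R]_d -> 'rV[R]_d) : Prop :=
  forall eps : R, 0 < eps -> \forall n \near \oo,
    forall (j i k : 'I_d) (x : 'rV[R]_d),
      let g := fun y : 'rV[R]_d => Phi n y ord0 j - y ord0 j in
      `|g x| <= eps /\ `|fc_pd g i x| <= eps /\ `|fc_pd (fc_pd g i) k x| <= eps.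

Definition fc_boundary d (E : set 'rV[R]_d) : set 'rV[R]_d :=
  closure E `\` interior E.

Definition fc_grad_ne0 d (phi : 'rV[R]_d -> R) (y : 'rV[R]_d) : Prop :=
  exists i, fc_pd phi i y != 0.

Definition fc_local_defining d (E : set 'rV[R]_d) (x : 'rV[R]_d)
    (phi : 'rV[R]_d -> R) : Prop :=
  fc_C2 phi /\ \forall y \near x, (E y <-> phi y <= 0) /\ fc_grad_ne0 phi y.

Definition fc_classC d (E : set 'rV[R]_d) : Prop :=
  (exists U : set 'rV[R]_d, open U /\ E = closure U) /\
  compact (fc_boundary E) /\
  forall x, fc_boundary E x -> exists phi, fc_local_defining E x phi.

Definition fc_convC d (En : nat -> set 'rV[R]_d) (E : set 'rV[R]_d) : Prop :=
  exists Phi : nat -> 'rV[R]_d -> 'rV[R]_d,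
    (forall n, fc_C2diffeo (Phi n)) /\ fc_C2_to_id Phi /\
    (forall n, Phi n @` E = En n).

(* scalar mean curvature (sum of principal curvatures, outer normal
   fc_grad phi/|fc_grad phi|):  div (fc_grad phi / |fc_grad phi|) at x *)
Definition fc_grad d (phi : 'rV[R]_d -> R) (y : 'rV[R]_d) : 'rV[R]_d :=
  \row_(i < d) fc_pd phi i y.
Definition fc_mean_curv_via d (phi : 'rV[R]_d -> R) (x : 'rV[R]_d) : R :=
  \sum_(i < d) fc_pd (fun y => fc_pd phi i y / fc_enorm (fc_grad phi y)) i x.
Definition fc_is_mean_curvature d (E : set 'rV[R]_d) (x : 'rV[R]_d) (H : R) : Prop :=
  exists phi, fc_local_defining E x phi /\ H = fc_mean_curv_via phi x.

Definition fc_kker (d : nat) (r s t : R) : R :=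
  if t <= r then r `^ (- (d%:R + s)) else t `^ (- (d%:R + s)).

Definition fc_Kfrac d (s r : R) (x : 'rV[R]_d) (E : set 'rV[R]_d) : \bar R :=
  fc_iint (fun y : 'rV[R]_d =>
    ((\1_(~` E) y - \1_E y) * fc_kker d r s (fc_enorm (x - y)))%:E).

Definition fc_beta (d : nat) (r s : R) : R :=
  (d%:R + s) / (d%:R + 1) * ((r `^ (1 - s) - 1) / (s - 1)) + 1 / (d%:R + 1).

End Defs.

(* Main.v *)
(* Fix a defining function phi of E near x and write |B| for the volume of the
   unit ball of R^(d-1). By Taylor's formula, En n is near x a sublevel set
   {psi <= 0} with psi z = nu . z + A z z / 2 + o(|z|^2), where A is the Hessian of
   phi at x, nu tends to the gradient of phi at x, and the o is uniform in n
   because the diffeomorphisms are C2-close to the identity. Cutting such a set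
   with a small ball shows that
     M(u) = |B_u \ En n| - |B_u /\ En n| = H |B| u^(d+1) / (d+1) + o(u^(d+1)),
   H being the mean curvature: after a Householder reflection the boundary is
   squeezed between graphs of quadratic forms on the tangent hyperplane, whose
   integral over a ball is a trace. Finally the truncated kernel is a superposition
   of indicators of balls,
     k(|z|) = \int_r^oo (d + s) t^(-d-s-1) 1_(|z| <= t) dt,
   so the curvature is \int_r^oo (d + s) t^(-d-s-1) M(t) dt. The range
   r <= t <= 1 contributes H |B| (d + s) (r^(1-s) - 1) / ((d + 1) (s - 1)), which is
   beta H |B| up to a bounded term, and beta tends to +oo. *)

Require Import Defs.
From HB Require Import structures.
From mathcomp Require Import all_boot all_order all_algebra fingroup perm.
From mathcomp Require Import all_classical all_reals all_analysis.
From mathcomp Require Import measurable_realfun.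
From mathcomp Require Import ring lra.
Set Implicit Arguments. Unset Strict Implicit. Unset Printing Implicit Defensive.
Import Order.TTheory GRing.Theory Num.Theory.
Import numFieldNormedType.Exports.
Local Open Scope classical_set_scope.
Local Open Scope ring_scope.

(** * Lebesgue measure on row vectors as an iterated product *)

(** The curvature is given by iterated one-dimensional integrals, where a rotation cannot be
    performed directly. The measure [lam] on row vectors is the same iteration as a measure, so that
    Fubini, translations and orthogonal maps become available. The obstacle that shapes the
    estimates is uniformity in n: the radius below which a sublevel set is well described must not
    depend on the set. Each threshold is therefore fixed before the matrix, the gradient and the
    function, from a bound on the Hessian and a lower bound on the gradient. Since C^2 regularity
    leaves only a remainder o(|z|^2), the set is not expanded further but enclosed between two exact
    quadratic graphs with nearly equal traces. The cancellation sits in M: a ball of radius t has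
    volume of order t^d, but M(t) is of order t^(d+1), which turns the density t^(-d-s-1) into
    t^(-s). The shape of beta comes from the identity (d + s) (r^(1-s) - 1) / (s - 1) = (d + 1) beta
    - 1. *)

Definition mx_display : measure_display. Proof. exact. Qed.

Section MxMeasurable.
Variables (R : realType) (m n : nat).

(** Generators of the product sigma-algebra: with them measurability of a matrix-valued map is
    checked entry by entry ([measurable_mxP]). Open sets of row vectors are shown to belong to it in
    [open_measurable_mx]. *)
Definition mx_gen : set (set 'M[R]_(m, n)) :=
  [set A | exists i j, exists2 B : set R, measurable B & A = [set M : 'M[R]_(m, n) | B (M i j)]].

Let mx0 : <<s mx_gen >> set0. Proof. exact: sigma_algebra0. Qed.
Let mxC A : <<s mx_gen >> A -> <<s mx_gen >> (~` A).
Proof. exact: sigma_algebraC. Qed.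
Let mxU (F : _^nat) : (forall i, <<s mx_gen >> (F i)) ->
  <<s mx_gen >> (\bigcup_i (F i)).
Proof. exact: sigma_algebra_bigcup. Qed.

HB.instance Definition _ := @isMeasurable.Build mx_display 'M[R]_(m, n)
  <<s mx_gen >> mx0 mxC mxU.

Lemma measurable_coord i j : measurable_fun setT (fun M : 'M[R]_(m, n) => M i j).
Proof.
move=> _ Y mY; rewrite setTI; apply: sub_sigma_algebra.
by exists i, j, Y.
Qed.

Lemma measurable_mxP d (T : measurableType d) (f : T -> 'M[R]_(m, n)) :
  (forall i j, measurable_fun setT (fun x => f x i j)) -> measurable_fun setT f.
Proof.
move=> mf; apply: (@measurability _ _ _ _ _ _ mx_gen) => //.
move=> _ [_ [i [j [B mB ->]]] <-]; exact: mf.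
Qed.

End MxMeasurable.

Section NegligibleChange.
Local Open Scope ereal_scope.
Context d (T : measurableType d) (R : realType).
Variable mu : {measure set T -> \bar R}.
Import HBNNSimple.

(** The integral of a nonnegative function is a supremum over simple functions below it. Cutting a
    simple function below [f] to the complement of [N] keeps its integral and brings it below
    [g]. *)
Let le_nnintegral_off (N : set T) (f g : T -> \bar R) :
  measurable N -> mu N = 0 -> (forall x, ~ N x -> f x = g x) ->
  (forall x, 0 <= f x) -> (forall x, 0 <= g x) ->
  \int[mu]_x f x <= \int[mu]_x g x.
Proof.
move=> mN N0 fg f0 g0; rewrite !ge0_integralTE//.
apply: ge_ereal_sup => _ [h hf <-].
have mCN := measurableC mN.
rewrite -integralT_nnsfun (ge0_negligible_integral mN)//; last 2 first.
  exact/measurable_EFinP.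
  by move=> x _; rewrite lee_fin.
rewrite setTD integral_mkcond.
rewrite (_ : (fun x => _) = (fun x => (proj_nnsfun h mCN x)%:E)).
  rewrite integralT_nnsfun; apply: ereal_sup_ubound.
  exists (proj_nnsfun h mCN) => //= x; rewrite mindicE.
  have [|] := boolP (x \in ~` N); rewrite ?mulr1 ?mulr0// inE => Nx.
  by rewrite -fg.
apply/funext => x; rewrite patchE /= mindicE.
by case: ifPn; rewrite ?mulr1 ?mulr0.
Qed.

(* Measurability is not assumed: the inner iterated integrals of [fc_iint] agree with
   measurable functions only off a negligible set. *)
Lemma eq_integral_off_negligible (N : set T) (f g : T -> \bar R) :
  measurable N -> mu N = 0 -> (forall x, ~ N x -> f x = g x) ->
  \int[mu]_x f x = \int[mu]_x g x.
Proof.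
move=> mN N0 fg; rewrite [LHS]integralE [RHS]integralE.
congr (_ - _); apply/eqP; rewrite eq_le; apply/andP; split;
  by apply: (le_nnintegral_off mN N0) => //= x /fg fgx;
  rewrite ?funeposE ?funenegE fgx.
Qed.
End NegligibleChange.

Section Cons.
Variables (R : realType) (n : nat).

(** The splitting of a vector used by [fc_iint]: the first coordinate, which is the outermost
    variable, and the rest. *)
Definition rcons_mx (p : measurableTypeR R * 'rV[R]_n) : 'rV[R]_n.+1 :=
  row_mx (\row_(i < 1) p.1) p.2.
Definition runcons_mx (v : 'rV[R]_n.+1) : measurableTypeR R * 'rV[R]_n :=
  (v ord0 ord0, @rsubmx R 1 1 n v).

Lemma rcons_mx0 p : rcons_mx p ord0 ord0 = p.1.
Proof.
transitivity (rcons_mx p ord0 (lshift n (ord0 : 'I_1))).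
  by congr (rcons_mx _ _ _); exact: val_inj.
by rewrite [LHS]row_mxEl mxE.
Qed.

Lemma rcons_mxS p i : rcons_mx p ord0 (lift ord0 i) = p.2 ord0 i.
Proof.
transitivity (rcons_mx p ord0 (rshift 1 i)).
  by congr (rcons_mx _ _ _); exact: val_inj.
by rewrite [LHS]row_mxEr.
Qed.

Lemma rcons_mxK : cancel rcons_mx runcons_mx.
Proof.
move=> [t v]; rewrite /runcons_mx rcons_mx0/=; congr pair.
by rewrite /rcons_mx row_mxKr.
Qed.

Lemma runcons_mxK : cancel runcons_mx rcons_mx.
Proof.
move=> v; apply/rowP => i; have [j ->|j ->] := split_ordP (i : 'I_(1 + n)).
  by rewrite [LHS]row_mxEl !mxE; congr (v _ _); apply: val_inj; rewrite /= ord1.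
by rewrite [LHS]row_mxEr !mxE; congr (v _ _); exact: val_inj.
Qed.

Lemma measurable_rcons_mx : measurable_fun setT rcons_mx.
Proof.
apply: measurable_mxP => i j; rewrite ord1.
have [j' ->|->] := unliftP ord0 j; last first.
  by under eq_fun do rewrite rcons_mx0; exact: measurable_fst.
under eq_fun do rewrite rcons_mxS.
exact: (measurableT_comp (measurable_coord ord0 j') measurable_snd).
Qed.

Lemma measurable_runcons_mx : measurable_fun setT runcons_mx.
Proof.
apply: measurable_fun_pair => /=; first exact: measurable_coord.
apply: measurable_mxP => i j; under eq_fun do rewrite mxE.
exact: measurable_coord.
Qed.

Variable m : {sigma_finite_measure set 'rV[R]_n -> \bar R}.

Definition lebR : {sigma_finite_measure set (measurableTypeR R) -> \bar R} :=
  lebesgue_measure.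

HB.instance Definition _ := isMeasurableFun.Build _ _ _ _ _ measurable_rcons_mx.
Definition lstep_measure : {measure set 'rV[R]_n.+1 -> \bar R} :=
  measure_function_pushforward__canonical__measure_function_Measure
    (lebR \x m)%E measurable_rcons_mx.
Definition lstep : set 'rV[R]_n.+1 -> \bar R := lstep_measure.

HB.instance Definition _ := isMeasure.Build _ _ _ lstep
  (measure0 lstep_measure) (measure_ge0 lstep_measure)
  (@measure_semi_sigma_additive _ _ _ lstep_measure).

Lemma lstep_sigma_finite : sigma_finite setT lstep.
Proof.
have [F TF Foo] : sigma_finite setT (lebR \x m)%E.
  (* Both exhaustions are taken nondecreasing, so that the maximum of two indices serves for both
     factors. *)
  have /sigma_finiteP[F [TF ndF Foo]] := sigma_finiteT lebR.
  have /sigma_finiteP[G [TG ndG Goo]] := sigma_finiteT m.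
  exists (fun k => F k `*` G k) => [|k]; last first.
    have [mF Fk] := Foo k; have [mG Gk] := Goo k; split; first exact: measurableX.
    by rewrite product_measure1E// lte_mul_pinfty// ge0_fin_numE.
  rewrite -setXTT TF TG predeqE => -[t v]; split => [[/= [i _ Fit] [j _ Gjv]]|].
    exists (maxn i j) => //; split.
      by move: t Fit; exact/subsetPset/ndF/leq_maxl.
    by move: v Gjv; exact/subsetPset/ndG/leq_maxr.
  by move=> [k _ [/= ? ?]]; split; exists k.
exists (fun k => runcons_mx @^-1` F k).
  by rewrite -preimage_bigcup -TF preimage_setT.
move=> k; have [mF Fk] := Foo k; split.
  by rewrite -[X in measurable X]setTI; exact: measurable_runcons_mx.
rewrite /lstep /= /pushforward -comp_preimage (_ : _ \o _ = id)//.
by apply/funext => p; exact: rcons_mxK.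
Qed.

HB.instance Definition _ := Measure_isSigmaFinite.Build _ _ _ lstep
  lstep_sigma_finite.
End Cons.

Section Lam.
Variable R : realType.

(** In dimension 0 this is the point mass, in agreement with the base case [f 0] of [fc_iint]. *)
Fixpoint lam (n : nat) : {sigma_finite_measure set 'rV[R]_n -> \bar R} :=
  match n with
  | 0 => @dirac mx_display 'rV[R]_0 0 R
  | n.+1 => lstep (lam n)
  end.

Lemma ge0_integral_lamS n (f : 'rV[R]_n.+1 -> \bar R) :
  measurable_fun setT f -> (forall v, 0 <= f v)%E ->
  (\int[lam n.+1]_v f v = \int[lebR R]_t \int[lam n]_w f (rcons_mx (t, w)))%E.
Proof.
move=> mf f0; have mc := @measurable_rcons_mx R n.
rewrite (ge0_integral_pushforward mc)//= ?preimage_setT.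
rewrite fubini_tonelli1//=.
exact: (measurableT_comp mf mc).
Qed.

Lemma fc_iintE n (f : 'rV[R]_n -> \bar R) :
  (lam n).-integrable setT f -> fc_iint f = (\int[lam n]_v f v)%E.
Proof.
elim: n f => [|n IH] f fi /=.
  rewrite integral_dirac//; first by rewrite diracT mul1e.
  exact: measurable_int fi.
have mf := measurable_int _ fi.
have mc := @measurable_rcons_mx R n.
have mg : measurable_fun setT (f \o @rcons_mx R n) by exact: measurableT_comp.
have gi : (lebR R \x lam n)%E.-integrable setT (f \o @rcons_mx R n).
  apply/integrableP; split => //.
  have /integrableP[_] := fi; rewrite ge0_integral_pushforward//.
  exact: measurableT_comp.
rewrite [RHS](@integral_pushforward _ _ _ _ _ _ mc)//=.
rewrite preimage_setT -(integral12_prod_meas1 gi).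
(* The sections of an integrable function are integrable only for almost every t, so the induction
   hypothesis applies off a null set. *)
have [N [mN N0 sN]] := ae_integrable1 gi.
apply: (eq_integral_off_negligible mN N0) => t Nt.
rewrite IH//; apply: contrapT => nint; apply: Nt; apply: sN => /= it; exact: nint.
Qed.
End Lam.

(** * Invariance of Lebesgue measure *)

Section OpenMeasurable.
Variables (R : realType) (n : nat).

(** An open set is the union of the sup-norm balls with rational centre and radius 1/(k+1) that it
    contains, and there are countably many of these. The radius is below e/2 so that such a ball
    through x stays within e of x. *)
Lemma open_measurable_mx (A : set 'rV[R]_n) : open A -> measurable A.
Proof.
move=> oA.
pose B (p : 'rV[rat]_n * nat) : set 'rV[R]_n :=
  [set v | forall j, `|v ord0 j - ratr (p.1 ord0 j)| < p.2.+1%:R^-1].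
have -> : A = \bigcup_(p in [set p | B p `<=` A]) B p.
  apply/seteqP; split => [x Ax|x [p pA Bp]]; last exact: pA.
  have /nbhs_ballP[e /= e0 eA] : nbhs x A by apply: open_nbhs_nbhs.
  have [k] : exists k : nat, 0 + k.+1%:R^-1 < e / 2 by apply: ltr_add_invr; exact: divr_gt0.
  rewrite add0r => k1.
  have h j : {q : rat | x ord0 j - k.+1%:R^-1 < ratr q < x ord0 j + k.+1%:R^-1}.
    have : x ord0 j - k.+1%:R^-1 < x ord0 j + k.+1%:R^-1.
      by rewrite ltrD2l gt0_cp// invr_gt0.
    by move/rat_in_itvoo/cid => [q]; rewrite in_itv/=; exists q.
  pose q : 'rV[rat]_n := \row_j sval (h j).
  have xq j : `|x ord0 j - ratr (q ord0 j)| < k.+1%:R^-1.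
    by rewrite mxE distrC ltr_distl; case: (h j).
  exists (q, k) => // v vB; apply: eA; split => // i j; rewrite ord1.
  rewrite /ball/=; apply: le_lt_trans (ler_distD (ratr (q ord0 j)) _ _) _.
  have vj : `|v ord0 j - ratr (q ord0 j)| < k.+1%:R^-1 := vB j.
  by rewrite (splitr e) ltrD ?(lt_trans (xq j))// distrC (lt_trans vj).
have -> : \bigcup_(p in [set p | B p `<=` A]) B p =
    \bigcup_p (if `[< B p `<=` A >] then B p else set0).
  apply/seteqP; split => [x [p pA Bp]|x [p _]].
    by exists p => //; rewrite ifT//; exact/asboolP.
  by case: ifPn => // /asboolP pA; exists p.
apply: countable_bigcupT_measurable; first exact: countableP.
move=> p; case: ifPn => // _.
have -> : B p = \bigcap_(j in [set: 'I_n])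
    ((fun v : 'rV[R]_n => v ord0 j) @^-1` ball (ratr (p.1 ord0 j) : R) p.2.+1%:R^-1).
  apply/seteqP; split => [v /= Bv j _|v /= Bv j]; first by rewrite /ball/= distrC.
  by have := Bv j I; rewrite /= /ball/= distrC.
apply: fin_bigcap_measurable => [|j _]; first exact: finite_finset.
rewrite -[X in measurable X]setTI.
by apply: measurable_coord => //; exact: measurable_ball.
Qed.

Lemma closed_measurable_mx (A : set 'rV[R]_n) : closed A -> measurable A.
Proof.
by move=> cA; rewrite -(setCK A); apply: measurableC; apply: open_measurable_mx; exact: closed_openC.
Qed.
End OpenMeasurable.

Section Affine.
Variable R : realType.
Local Open Scope ereal_scope.

Lemma measurable_affine (a b : R) :
  measurable_fun setT (fun t : measurableTypeR R => (a * t + b)%R : measurableTypeR R).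
Proof. by apply: measurable_funD => //; exact: measurable_funM. Qed.

(** Uniqueness of Lebesgue measure: its image under t -> (a t + b), scaled by a, gives every
    half-open interval its length. *)
Lemma ge0_integral_affine (a b : R) (f : R -> \bar R) : (0 < a)%R ->
  measurable_fun setT f -> (forall t, 0 <= f t) ->
  \int[lebR R]_t f t = a%:E * \int[lebR R]_t f (a * t + b)%R.
Proof.
move=> a0 mf f0.
pose mu : {measure set (measurableTypeR R) -> \bar R} :=
  measure_function_pushforward__canonical__measure_function_Measure
    (lebR R) (measurable_affine a b).
pose nu : {measure set (measurableTypeR R) -> \bar R} :=
  mscale (NngNum (ltW a0)) mu.
transitivity (\int[nu]_t f t).
  apply: eq_measure_integral => A mA _.
  apply: lebesgue_measure_unique => // _ [[c d] _ <-].
  transitivity (a%:E * lebR R [set` `]((c - b) / a)%R, ((d - b) / a)%R]%R]).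
    rewrite /lebR/= !lebesgue_measure_itv/= !lte_fin ltr_pM2r ?invr_gt0// ltrD2r.
    case: ifPn => _; last by rewrite mule0.
    by rewrite -!EFinD -EFinM; congr EFin; field; rewrite gt_eqF.
  congr (_ * lebR R _).
  apply/seteqP; split => t; rewrite /= !in_itv/= ltr_pdivrMr// ler_pdivlMr//.
    by rewrite [(t * a)%R]mulrC ltrBlDr lerBrDr.
  by rewrite [(t * a)%R]mulrC ltrBlDr lerBrDr.
rewrite ge0_integral_mscale//=.
congr (_ * _).
exact: (ge0_integral_pushforward (measurable_affine a b)).
Qed.

End Affine.

Section LamInvariance.
Variable R : realType.
Implicit Types (n : nat).

Lemma measurable_addr_mx n (b : 'rV[R]_n) : measurable_fun setT (fun v : 'rV[R]_n => v + b).
Proof.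
apply: measurable_mxP => i j; under eq_fun do rewrite mxE.
by apply: measurable_funD => //; exact: measurable_coord.
Qed.

Lemma measurable_scaler_mx n (a : R) : measurable_fun setT (fun v : 'rV[R]_n => a *: v).
Proof.
apply: measurable_mxP => i j; under eq_fun do rewrite mxE.
by apply: measurable_funM => //; exact: measurable_coord.
Qed.

Lemma measurable_mulmx n m (S : 'M[R]_(n, m)) :
  measurable_fun setT (fun v : 'rV[R]_n => v *m S).
Proof.
apply: measurable_mxP => i j; under eq_fun do rewrite mxE.
apply: measurable_sum => k; apply: measurable_funM => //; exact: measurable_coord.
Qed.

Lemma measurable_add_mx n : measurable_fun setT
  (fun p : 'rV[R]_n * 'rV[R]_n => p.1 + p.2).
Proof.
apply: measurable_mxP => i j; under eq_fun do rewrite mxE.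
apply: measurable_funD.
  exact: (measurableT_comp (measurable_coord i j) measurable_fst).
exact: (measurableT_comp (measurable_coord i j) measurable_snd).
Qed.

Lemma measurable_enorm n : measurable_fun setT (@fc_enorm R n).
Proof.
apply: (measurableT_comp (f := @Num.sqrt R)).
  exact: continuous_measurable_fun (@sqrt_continuous R).
apply: measurable_sum => k; apply: measurable_funX; exact: measurable_coord.
Qed.

Lemma rcons_mx_affine n (a : R) (b : 'rV[R]_n.+1) p :
  a *: rcons_mx p + b =
  rcons_mx (a * p.1 + (runcons_mx b).1, a *: p.2 + (runcons_mx b).2).
Proof.
rewrite -[in LHS](runcons_mxK b); apply/rowP => i; rewrite [LHS]mxE [X in X + _]mxE.
have [j ->|->] := unliftP ord0 i; first by rewrite !rcons_mxS [RHS]mxE [X in _ = X + _]mxE.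
by rewrite !rcons_mx0.
Qed.

(** Dilation and translation are treated in one induction: each coordinate contributes one factor a
    through the one-dimensional formula, and the fibre over t is the same statement one dimension
    lower. *)
Lemma ge0_integral_lam_affine n (a : R) (b : 'rV[R]_n) (f : 'rV[R]_n -> \bar R) :
  0 < a -> measurable_fun setT f -> (forall v, 0 <= f v)%E ->
  (\int[lam R n]_v f v = (a ^+ n)%:E * \int[lam R n]_v f (a *: v + b)%R)%E.
Proof.
move=> a0; elim: n b f => [|n IH] b f mf f0.
  rewrite expr0 mul1e; apply: eq_integral => v _; congr (f _).
  by apply/rowP => -[].
have mab : measurable_fun setT (fun v : 'rV[R]_n.+1 => (a *: v + b)).
  exact: (measurableT_comp (measurable_addr_mx b) (measurable_scaler_mx a)).
have mfab : measurable_fun setT (fun v : 'rV[R]_n.+1 => f (a *: v + b)).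
  exact: (measurableT_comp mf mab).
have mc := @measurable_rcons_mx R n.
have mfc : measurable_fun setT (f \o @rcons_mx R n) by exact: measurableT_comp.
rewrite !ge0_integral_lamS//=.
set b0 := (runcons_mx b).1; set b' := (runcons_mx b).2.
pose g t := (\int[lam R n]_w f (rcons_mx (t, w)))%E.
have mg : measurable_fun setT g.
  by apply: measurable_fun_fubini_tonelli_F mfc _ => //= p; exact: f0.
have g0 t : (0 <= g t)%E by apply: integral_ge0.
have IHt t : (g t = (a ^+ n)%:E * \int[lam R n]_w f (rcons_mx (t, a *: w + b')%R))%E.
  apply: IH => //.
  have mt : measurable_fun setT (fun w : 'rV[R]_n => ((t, w) : measurableTypeR R * 'rV[R]_n)).
    exact: measurable_pair1.
  exact: (measurableT_comp mfc mt).
rewrite [LHS](ge0_integral_affine b0 a0 mg g0).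
under eq_integral do rewrite IHt.
under [in RHS]eq_integral => t _ do
  under eq_integral => w _ do rewrite rcons_mx_affine.
rewrite /= ge0_integralZl_EFin//; last 3 first.
- by move=> t _; apply: integral_ge0.
- rewrite (_ : (fun t : R => _) = fun t : measurableTypeR R => 
    (\int[lam R n]_w (f \o (fun v : 'rV[R]_n.+1 => a *: v + b)%R \o @rcons_mx R n) (t, w))%E).
    apply: measurable_fun_fubini_tonelli_F => [|p]; last exact: f0.
    exact: (measurableT_comp mfab mc).
  by apply/funext => t; apply: eq_integral => w _; rewrite /= rcons_mx_affine.
- exact: exprn_ge0 (ltW a0).
by rewrite muleA exprS EFinM.
Qed.

Lemma ge0_integral_lam_translate n (b : 'rV[R]_n) (f : 'rV[R]_n -> \bar R) :
  measurable_fun setT f -> (forall v, 0 <= f v)%E ->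
  (\int[lam R n]_v f v = \int[lam R n]_v f (v + b)%R)%E.
Proof.
move=> mf f0; rewrite (ge0_integral_lam_affine b ltr01)// expr1n mul1e.
by under eq_integral do rewrite scale1r.
Qed.

Lemma ge0_integral_lam_scale n (a : R) (f : 'rV[R]_n -> \bar R) : 0 < a ->
  measurable_fun setT f -> (forall v, 0 <= f v)%E ->
  (\int[lam R n]_v f v = (a ^+ n)%:E * \int[lam R n]_v f (a *: v)%R)%E.
Proof.
move=> a0 mf f0; rewrite (ge0_integral_lam_affine 0 a0)//.
by under eq_integral do rewrite addr0.
Qed.

(** Cubes serve as a gauge: enclosing a ball in one and inscribing one in a ball show that the
    volume of a ball is finite and positive. *)
Definition mx_box n (a b : R) := [set v : 'rV[R]_n | forall i, a <= v ord0 i <= b].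

Lemma measurable_mx_box n a b : measurable (@mx_box n a b).
Proof.
rewrite [X in measurable X](_ : _ = \bigcap_(j in [set: 'I_n])
    ((fun v : 'rV[R]_n => v ord0 j) @^-1` [set` `[a, b]])).
  apply: fin_bigcap_measurable => [|j _]; first exact: finite_finset.
  by rewrite -[X in measurable X]setTI; exact: measurable_coord.
apply/seteqP; split => [v /= bv j _|v bv j]; first by rewrite /= in_itv/=.
by have := bv j I; rewrite /= in_itv.
Qed.

Lemma integral_lam_mx_box n a b : a < b ->
  (\int[lam R n]_v (\1_(mx_box a b) v)%:E = ((b - a) ^+ n)%:E)%E.
Proof.
move=> ab; elim: n => [|n IH].
  rewrite expr0 /= integral_dirac//; last first.
    by apply/measurable_EFinP; apply: measurable_indic; exact: measurable_mx_box.
  by rewrite diracT mul1e indicE mem_set// => -[].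
have mi : measurable_fun setT (fun v => (\1_(@mx_box n.+1 a b) v)%:E : \bar R).
  apply/measurable_EFinP; apply: measurable_indic; exact: measurable_mx_box.
rewrite ge0_integral_lamS//.
transitivity (\int[lebR R]_t ((\1_([set` `[a, b]] : set R) t)%:E * ((b - a) ^+ n)%:E))%E.
  apply: eq_integral => t _; rewrite -IH.
  rewrite -ge0_integralZl_EFin//; last first.
    apply/measurable_EFinP; apply: measurable_indic; exact: measurable_mx_box.
  apply: eq_integral => w _; rewrite -EFinM; congr EFin.
  rewrite !indicE -natrM; congr (_%:R); rewrite mulnb.
  congr nat_of_bool; apply/idP/andP; rewrite !inE/= in_itv/=.
    move=> h; split; first by have := h ord0; rewrite rcons_mx0.
    by move=> i; have := h (lift ord0 i); rewrite rcons_mxS.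
  move=> [h1 h2] i; have [j ->|->] := unliftP ord0 i.
    by rewrite rcons_mxS.
  by rewrite rcons_mx0.
rewrite ge0_integralZr//; last 2 first.
- by apply/measurable_EFinP; exact: measurable_indic.
- by rewrite lee_fin exprn_ge0// subr_ge0 ltW.
rewrite integral_indic// setIT /lebR /= lebesgue_measure_itv/= lte_fin ab.
by rewrite -EFinD -EFinM exprS.
Qed.
End LamInvariance.

(** * Euclidean balls *)

Section Enorm.
Variable R : realType.

Lemma enorm_ge0 n (v : 'rV[R]_n) : 0 <= fc_enorm v.
Proof. exact: sqrtr_ge0. Qed.

Lemma sqr_enorm n (v : 'rV[R]_n) : fc_enorm v ^+ 2 = \sum_i v ord0 i ^+ 2.
Proof. by rewrite sqr_sqrtr// sumr_ge0// => i _; exact: sqr_ge0. Qed.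

Lemma sqr_enorm_mul n (v : 'rV[R]_n) : fc_enorm v ^+ 2 = (v *m v^T) ord0 ord0.
Proof. by rewrite sqr_enorm mxE; apply: eq_bigr => i _; rewrite mxE. Qed.

Lemma enorm_orth n (S : 'M[R]_n) (v : 'rV[R]_n) : S *m S^T = 1%:M ->
  fc_enorm (v *m S) = fc_enorm v.
Proof.
move=> SS; apply/eqP; rewrite -(@eqrXn2 _ 2)// ?enorm_ge0// !sqr_enorm_mul.
by rewrite trmx_mul mulmxA -(mulmxA v) SS mulmx1.
Qed.

Lemma enormZ n (a : R) (v : 'rV[R]_n) : fc_enorm (a *: v) = `|a| * fc_enorm v.
Proof.
apply/eqP; rewrite -(@eqrXn2 _ 2)// ?mulr_ge0 ?enorm_ge0//.
rewrite exprMn !sqr_enorm real_normK ?num_real// mulr_sumr; apply/eqP.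
by apply: eq_bigr => i _; rewrite mxE exprMn.
Qed.

Lemma enormN n (v : 'rV[R]_n) : fc_enorm (- v) = fc_enorm v.
Proof. by rewrite -scaleN1r enormZ normrN1 mul1r. Qed.

Lemma enorm_coord n (v : 'rV[R]_n) i : `|v ord0 i| <= fc_enorm v.
Proof.
rewrite -(@ler_pXn2r _ 2)// ?nnegrE ?enorm_ge0// sqr_enorm real_normK ?num_real//.
by rewrite (bigD1 i)//= lerDl sumr_ge0// => j _; exact: sqr_ge0.
Qed.

Lemma enorm0 n : fc_enorm (0 : 'rV[R]_n) = 0.
Proof. by rewrite -(scale0r 0) enormZ normr0 mul0r. Qed.

Definition eball n (r : R) := [set v : 'rV[R]_n | fc_enorm v <= r].

Lemma mem_eball n r (v : 'rV[R]_n) : (v \in eball r) = (fc_enorm v <= r).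
Proof. by apply/idP/idP; rewrite inE. Qed.

Lemma measurable_eball n r : measurable (@eball n r).
Proof.
rewrite -[X in measurable X]setTI (_ : eball r = @fc_enorm R n @^-1` `]-oo, r]).
  exact: measurable_enorm.
by apply/seteqP; split => v; rewrite /= in_itv.
Qed.

Lemma measurable_indic_eball n r :
  measurable_fun setT (fun v => (\1_(@eball n r) v)%:E : \bar R).
Proof. by apply/measurable_EFinP; apply: measurable_indic; exact: measurable_eball. Qed.

Lemma integral_eball_ltoo n r :
  (\int[lam R n]_v (\1_(eball r) v)%:E < +oo)%E.
Proof.
(* Adding 1 keeps the cube nondegenerate for every real r. *)
pose r' := `|r| + 1.
have r'0 : - r' < r' by rewrite gt0_cp// ltr_wpDl.
have e := integral_lam_mx_box n r'0.
apply: (@le_lt_trans _ _ (\int[lam R n]_v (\1_(mx_box (- r') r') v)%:E)%E).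
  apply: ge0_le_integral => //; [exact: measurable_indic_eball| |].
    by apply/measurable_EFinP; apply: measurable_indic; exact: measurable_mx_box.
  move=> v _; rewrite lee_fin !indicE ler_nat; case: (boolP (v \in eball r)) => //.
  rewrite inE => vr; rewrite mem_set// => i /=.
  rewrite -ler_norml (le_trans (enorm_coord _ _))// (le_trans vr)//.
  by rewrite (le_trans (ler_norm _))// lerDl.
by rewrite e ltry.
Qed.

Lemma integral_eball_gt0 n r : 0 < r ->
  (0 < \int[lam R n]_v (\1_(eball r) v)%:E)%E.
Proof.
move=> r0.
(* The vectors of the cube [0, a]^n have squared norm at most n a^2, which is at most r^2; dividing
   by n + 1 instead of n covers dimension 0. *)
pose a := r / n.+1%:R.
have a0 : 0 < a by rewrite divr_gt0.
have e := integral_lam_mx_box n a0.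
apply: (@lt_le_trans _ _ (\int[lam R n]_v (\1_(mx_box 0 a) v)%:E)%E).
  by rewrite e lte_fin subr0 exprn_gt0.
apply: ge0_le_integral => //; [|exact: measurable_indic_eball|].
  by apply/measurable_EFinP; apply: measurable_indic; exact: measurable_mx_box.
move=> v _; rewrite lee_fin !indicE ler_nat; case: (boolP (v \in _)) => //.
rewrite inE => va; rewrite mem_set//= /eball/=.
rewrite -(@ler_pXn2r _ 2) ?nnegrE ?enorm_ge0 ?(ltW r0)// sqr_enorm.
apply: (@le_trans _ _ (\sum_(i < n) a ^+ 2)).
  apply: ler_sum => i _; have /andP[v0 v1] := va i.
  by rewrite ler_pXn2r// ?nnegrE// ltW.
rewrite sumr_const card_ord -mulr_natl /a expr_div_n mulrA ler_pdivrMr ?exprn_gt0//.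
rewrite mulrC ler_pM2l ?exprn_gt0// expr2 -natrM ler_nat.
by rewrite (leq_trans (leqnSn n))// leq_pmulr.
Qed.
End Enorm.

(** * Invariance under orthogonal matrices *)

Section Orthogonal.
Variable R : realType.
Local Open Scope ereal_scope.

Lemma measurable_lin2 n (A B : 'M[R]_n) : measurable_fun setT
  (fun p : 'rV[R]_n * 'rV[R]_n => (p.1 *m A + p.2 *m B)%R).
Proof.
have m2 : measurable_fun setT (fun p : 'rV[R]_n * 'rV[R]_n => (p.1 *m A, p.2 *m B)%R).
  apply: measurable_fun_pair.
    exact: (measurableT_comp (measurable_mulmx A) measurable_fst).
  exact: (measurableT_comp (measurable_mulmx B) measurable_snd).
exact: (measurableT_comp (@measurable_add_mx R n) m2).
Qed.

(* With [g] the indicator of the unit ball, the double integral of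
   [f x * g (y *m S - x)] equals [(\int g) * (\int f)] integrating in y first, and
   [(\int g) * (\int f (y *m S))] integrating in x first; only translation invariance is used. *)
Lemma ge0_integral_orth n (S : 'M[R]_n) (f : 'rV[R]_n -> \bar R) :
  (S *m S^T = 1%:M)%R -> measurable_fun setT f -> (forall v, 0 <= f v) ->
  \int[lam R n]_v f (v *m S) = \int[lam R n]_v f v.
Proof.
move=> SS mf f0.
have SS' := mulmx1C SS.
pose g (v : 'rV[R]_n) : \bar R := (\1_(eball 1) v)%:E.
have mg : measurable_fun setT g by exact: measurable_indic_eball.
have g0 v : 0 <= g v by rewrite lee_fin.
have gS v : g (v *m S) = g v.
  by rewrite /g !indicE !mem_eball enorm_orth.
have gN v : g (- v)%R = g v.
  by rewrite /g !indicE !mem_eball enormN.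
have G0 := integral_eball_gt0 n (@ltr01 R); have Goo := integral_eball_ltoo n (1 : R).
rewrite -/g in G0 Goo; clearbody g.
have fS0 v : 0 <= f (v *m S) by [].
have mfS : measurable_fun setT (fun v => f (v *m S)).
  exact: (measurableT_comp mf (measurable_mulmx S)).
have mk (h k : 'rV[R]_n -> \bar R) (A B C D : 'M[R]_n) :
    measurable_fun setT h -> measurable_fun setT k ->
    measurable_fun setT (fun p : 'rV[R]_n * 'rV[R]_n =>
      h (p.1 *m A + p.2 *m B)%R * k (p.1 *m C + p.2 *m D)%R).
  move=> mh mk; apply: emeasurable_funM.
    exact: (measurableT_comp mh (measurable_lin2 A B)).
  exact: (measurableT_comp mk (measurable_lin2 C D)).
have ms (h k : 'rV[R]_n -> \bar R) (B D : 'M[R]_n) a b :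
    measurable_fun setT h -> measurable_fun setT k ->
    measurable_fun setT (fun v : 'rV[R]_n => h (a + v *m B)%R * k (b + v *m D)%R).
  move=> mh mk'; have ma (c : 'rV[R]_n) (M : 'M[R]_n) : measurable_fun setT (fun v : 'rV[R]_n => (c + v *m M)%R).
    under eq_fun do rewrite addrC.
    exact: (measurableT_comp (measurable_addr_mx c) (measurable_mulmx M)).
  by apply: emeasurable_funM; [exact: (measurableT_comp mh (ma _ _))|exact: (measurableT_comp mk' (ma _ _))].
(* The integral of [g] is finite and positive, hence can be cancelled. *)
suff : (\int[lam R n]_x g x) * (\int[lam R n]_v f v) =
       (\int[lam R n]_x g x) * \int[lam R n]_v f (v *m S).
  move=> h; apply/esym/eqP.
  have Gfin : \int[lam R n]_x g x \is a fin_num by rewrite gt0_fin_numE.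
  by rewrite eq_le; apply/andP; split; rewrite -(lee_pmul2l Gfin G0) h.
transitivity (\int[lam R n]_x \int[lam R n]_y (f x * g (y *m S - x)%R)).
  rewrite -ge0_integralZl//; last exact: integral_ge0.
  apply: eq_integral => x _.
  rewrite muleC -ge0_integralZl//.
  under [LHS]eq_integral do rewrite -gS.
  rewrite [LHS](ge0_integral_lam_translate (- (x *m S^T)))//; last 2 first.
  - apply: eq_measurable_fun (ms f g 0%R S x 0%R mf mg) => ? _ /=; by rewrite mulmx0 addr0 add0r.
  - by move=> v; exact: mule_ge0.
  by under eq_integral do rewrite mulmxDl mulNmx -mulmxA SS' mulmx1.
rewrite [LHS](sfinite_Fubini (lam R n) (lam R n)
  (fun p => f p.1 * g (p.2 *m S - p.1)%R))/=; last 2 first.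
- by move=> p; exact: mule_ge0.
- apply: eq_measurable_fun (mk f g 1%:M%R 0%R (- 1%:M)%R S mf mg) => ? _ /=; by rewrite mulmx1 mulmx0 addr0 mulmxN mulmx1 addrC.
transitivity (\int[lam R n]_y \int[lam R n]_x (f (x + y *m S)%R * g x)).
  apply: eq_integral => y _.
  rewrite [LHS](ge0_integral_lam_translate (y *m S))//; last 2 first.
  - apply: eq_measurable_fun (ms f g 1%:M%R (- 1%:M)%R 0%R (y *m S) mf mg) => ? _ /=; by rewrite mulmx1 mulmxN mulmx1 add0r.
  - by move=> v; exact: mule_ge0.
  by under eq_integral do rewrite opprD addrCA subrr addr0 gN.
rewrite [LHS](sfinite_Fubini (lam R n) (lam R n)
  (fun p => f (p.2 + p.1 *m S)%R * g p.2))/=; last 2 first.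
- by move=> p; exact: mule_ge0.
- apply: eq_measurable_fun (mk f g S 1%:M%R 0%R 1%:M%R mf mg) => ? _ /=; by rewrite mulmx0 !mulmx1 add0r addrC.
rewrite -ge0_integralZr//; last exact: integral_ge0.
apply: eq_integral => x _.
rewrite -ge0_integralZl//.
rewrite [LHS](ge0_integral_lam_translate (- (x *m S^T)))//; last 2 first.
- apply: eq_measurable_fun (ms f g S 0%R x x mf mg) => ? _ /=; by rewrite mulmx0 addr0.
- by move=> v; exact: mule_ge0.
apply: eq_integral => y _; rewrite mulmxDl mulNmx -mulmxA SS' mulmx1 addrCA subrr addr0.
exact: muleC.
Qed.
End Orthogonal.

(** * Volume of balls and the layer-cake formula *)

Section Ball.
Variables (R : realType) (n : nat).
Local Notation mu := (lam R n).

Definition vball : R := \int[mu]_v \1_(eball 1) v.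

Lemma eball_integrable r : mu.-integrable setT (EFin \o \1_(@eball R n r)).
Proof.
apply/integrableP; split; first exact: measurable_indic_eball.
rewrite (_ : (fun _ => _) = (fun v => (\1_(@eball R n r) v)%:E)) ?integral_eball_ltoo//.
by apply/funext => v /=; rewrite ger0_norm.
Qed.

Lemma integral_eball (r : R) : 0 < r ->
  (\int[mu]_v (\1_(eball r) v)%:E = (r ^+ n * vball)%:E)%E.
Proof.
move=> r0; rewrite (ge0_integral_lam_scale r0) ?EFinM//.
  congr (_ * _)%E; rewrite /vball /Rintegral fineK ?integrable_fin_num//.
    apply: eq_integral => v _; rewrite !indicE !mem_eball enormZ gtr0_norm//.
    by rewrite -{2}(mulr1 r) ler_pM2l.
  exact: eball_integrable.
exact: measurable_indic_eball.
Qed.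

Lemma vball_gt0 : 0 < vball.
Proof.
rewrite -lte_fin -[vball]mul1r -(expr1n _ n) -integral_eball//.
exact: integral_eball_gt0.
Qed.

Lemma Rintegral_eball (r : R) : 0 < r -> \int[mu]_v \1_(eball r) v = r ^+ n * vball.
Proof. by move=> r0; rewrite /Rintegral integral_eball. Qed.

Lemma integrable_on_eball (r C : R) (f : 'rV[R]_n -> R) : measurable_fun setT f ->
  (forall v, fc_enorm v <= r -> `|f v| <= C) ->
  mu.-integrable setT (EFin \o (fun v => f v * \1_(eball r) v)).
Proof.
move=> mf fC.
have mfb : measurable_fun setT (fun v => f v * \1_(eball r) v).
  by apply: measurable_funM => //; apply: measurable_indic; exact: measurable_eball.
apply: (le_integrable _ _ _ (integrableZl _ `|C| (eball_integrable r))) => //.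
  exact/measurable_EFinP.
move=> v _ /=; rewrite lee_fin !normrM; rewrite !indicE mem_eball.
case: (boolP (_ <= r)) => vr; last by rewrite normr0 !mulr0.
by rewrite normr1 !mulr1 normr_id (le_trans (fC _ vr))// ler_norm.
Qed.

Lemma fc_omegaE : fc_omega R n = vball%:E.
Proof.
rewrite /fc_omega fc_iintE; last exact: eball_integrable.
rewrite /vball /Rintegral fineK ?integrable_fin_num//.
exact: eball_integrable.
Qed.

Lemma measurable_bnat d (T : measurableType d) (b : T -> bool) :
  measurable_fun setT b -> measurable_fun setT (fun x => (b x)%:R : R).
Proof.
move=> mb; rewrite (_ : (fun _ => _) = fun x => if b x then 1 else 0).
  exact: measurable_fun_ifT.
by apply/funext => x; case: (b x).
Qed.

(** Fubini for the function h(v) w(t) 1_(|v| <= t): integrating in t first produces h K, integrating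
    in v first produces w M. Since |h| <= 1 and the ball of radius t has volume t^n |B|, the moment
    condition on [w] is absolute integrability. It is applied to the truncated kernel and to u^2 -
    |v|^2 on the ball of radius u. *)
Lemma layer_cake (h K : 'rV[R]_n -> R) (w : R -> R)
    (M := fun t : R => \int[mu]_v (h v * \1_(eball t) v)) :
  measurable_fun setT h -> (forall v, `|h v| <= 1) ->
  measurable_fun setT w -> (forall t, 0 <= w t) -> (forall t, t <= 0 -> w t = 0) ->
  (\int[lebR R]_t (w t * t ^+ n)%:E < +oo)%E ->
  (forall v, \int[lebR R]_t (w t * (fc_enorm v <= t)%R%:R)%:E = (K v)%:E)%E ->
  [/\ mu.-integrable setT (EFin \o (fun v => h v * K v)),
      (lebR R).-integrable setT (EFin \o (fun t => w t * M t)) &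
      \int[mu]_v (h v * K v) = \int[lebR R]_t (w t * M t) ].
Proof.
move=> mh h1 mw w0 wz wfin WK.
pose F (p : 'rV[R]_n * measurableTypeR R) : \bar R :=
  (h p.1 * (w p.2 * (fc_enorm p.1 <= p.2)%R%:R))%:E.
have mle : measurable_fun setT (fun p : 'rV[R]_n * measurableTypeR R =>
    (fc_enorm p.1 <= p.2)%R%:R : R).
  apply: measurable_bnat; apply: measurable_fun_ler => //.
  exact: (measurableT_comp (@measurable_enorm R n) measurable_fst).
have mF : measurable_fun setT F.
  apply/measurable_EFinP; apply: measurable_funM.
    exact: (measurableT_comp mh measurable_fst).
  apply: measurable_funM => //.
  exact: (measurableT_comp mw measurable_snd).
have wI t : (\int[mu]_v (w t * (fc_enorm v <= t)%R%:R)%:E =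
             (w t * t ^+ n)%:E * vball%:E)%E.
  have [t0|t0] := leP t 0.
    by rewrite wz// mul0r mul0e; under eq_integral do rewrite mul0r; rewrite integral0.
  rewrite EFinM -muleA -(EFinM (t ^+ n)) -integral_eball// -ge0_integralZl_EFin//; last first.
    exact: measurable_indic_eball.
  by apply: eq_integral => v _; rewrite indicE mem_eball EFinM.
have iF : (mu \x lebR R)%E.-integrable setT F.
  apply/integrable21ltyP => //.
  apply: (@le_lt_trans _ _ (\int[lebR R]_t ((w t * t ^+ n)%:E * vball%:E))%E).
    apply: ge0_le_integral => //.
    - by move=> t _; exact: integral_ge0.
    - apply: (@measurable_fun_fubini_tonelli_G _ _ _ _ _ _ (abse \o F)) => [|p].
        exact: measurableT_comp.
      exact: abse_ge0.
    - apply: emeasurable_funM => //; apply/measurable_EFinP.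
      by apply: measurable_funM => //; exact: measurable_funX.
    - move=> t _; rewrite -wI; apply: ge0_le_integral => //=.
      + by apply: (measurable_fun_pair1 (f := abse \o F)); exact: measurableT_comp.
      + apply/measurable_EFinP; apply: measurable_funM => //; apply: measurable_bnat.
        by apply: measurable_fun_ler => //; exact: measurable_enorm.
      move=> v _.
      rewrite lee_fin normrM normrM (ger0_norm (w0 _)).
      by rewrite normr_nat ler_piMl// mulr_ge0.
  have wt0 t : (0 <= (w t * t ^+ n)%:E)%E.
    rewrite lee_fin; have [t0|t0] := leP t 0; first by rewrite wz// mul0r.
    by rewrite mulr_ge0// exprn_ge0// ltW.
  rewrite ge0_integralZr//.
  - rewrite lte_mul_pinfty ?ltry//; first exact: integral_ge0.
    rewrite ge0_fin_numE//; exact: integral_ge0.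
  - by apply/measurable_EFinP; apply: measurable_funM => //; exact: measurable_funX.
  - by rewrite lee_fin ltW// vball_gt0.
have IF v : (\int[lebR R]_t F (v, t) = (h v * K v)%:E)%E.
  rewrite /F/= EFinM -WK -integralZl//.
  apply/integrableP; split.
    apply/measurable_EFinP; apply: measurable_funM => //.
    apply: measurable_bnat; exact: measurable_fun_ler.
  rewrite (_ : (fun _ => _) = fun t => (w t * (fc_enorm v <= t)%R%:R)%:E) ?WK ?ltry//.
  by apply/funext => t/=; rewrite ger0_norm// mulr_ge0.
have IG t : (\int[mu]_v F (v, t) = (w t * M t)%:E)%E.
  have hi : mu.-integrable setT (EFin \o (fun v => h v * \1_(eball t) v)).
    by apply: (@integrable_on_eball _ 1).
  rewrite EFinM /M /Rintegral fineK; last exact: integrable_fin_num.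
  rewrite -integralZl//; apply: eq_integral => v _.
  by rewrite /F/= indicE mem_eball -EFinM mulrCA mulrA.
have h1' : mu.-integrable setT (EFin \o (fun v => h v * K v)).
  rewrite (_ : EFin \o _ = fubini_F (lebR R) F); first exact: integrable_fubini_F.
  by apply/funext => v; rewrite /fubini_F IF.
have h2 : (lebR R).-integrable setT (EFin \o (fun t => w t * M t)).
  rewrite (_ : EFin \o _ = fubini_G mu F); last first.
    by apply/funext => t; rewrite /fubini_G IG.
  apply/integrableP; split; first exact: (measurable_fubini_G iF).
  apply: le_lt_trans ((integrable21ltyP _ _ mF).1 iF); apply: ge0_le_integral => //.
  - by apply: measurableT_comp => //; exact: (measurable_fubini_G iF).
  - apply: (@measurable_fun_fubini_tonelli_G _ _ _ _ _ _ (abse \o F)) => [|p].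
      exact: measurableT_comp.
    exact: abse_ge0.
  - move=> t _; apply: le_abse_integral => //; exact: measurable_fun_pair1.
split => //; rewrite /Rintegral; congr fine.
transitivity (\int[mu]_v \int[lebR R]_t F (v, t))%E.
  by apply: eq_integral => v _; rewrite IF.
by rewrite (Fubini iF); apply: eq_integral => t _; rewrite IG.
Qed.
End Ball.

(** * Moments of the ball *)

Section Integrals1D.
Variable R : realType.
Local Notation leb := (@lebesgue_measure R).

Lemma powRN_cvgy (p : R) : 0 < p -> t `^ (- p) @[t --> +oo] --> 0.
Proof.
move=> p0; apply/cvgrPdist_le => /= e e0; near=> t.
rewrite sub0r normrN ger0_norm ?powR_ge0//.
have t0 : 0 < t by near: t; exact: nbhs_pinfty_gt.
have te : (e^-1) `^ p^-1 <= t by near: t; apply: nbhs_pinfty_ge; exact: num_real.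
rewrite powRN -[leRHS]invrK lef_pV2 ?posrE ?powR_gt0 ?invr_gt0//.
have -> : e^-1 = ((e^-1) `^ p^-1) `^ p.
  by rewrite -powRrM mulVf ?gt_eqF// powRr1// invr_ge0 ltW.
by apply: ge0_ler_powR; rewrite ?nnegrE ?powR_ge0// ltW.
Unshelve. all: by end_near. Qed.

Lemma integral_powRN (p a : R) : 0 < p -> 0 < a ->
  (\int[leb]_(t in `[a, +oo[) (p * t `^ (- p - 1))%:E = (a `^ (- p))%:E)%E.
Proof.
move=> p0 a0.
have D (t : R) : 0 < t -> is_derive t 1 (fun t : R => - t `^ (- p)) (p * t `^ (- p - 1)).
  move=> t0; have dp := is_derive1_powR (- p) t0.
  by apply: is_derive_eq; rewrite mulNr opprK.
rewrite (@ge0_continuous_FTC2y _ _ (fun t : R => - t `^ (- p)) _ 0).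
- by rewrite -EFinB opprK add0r.
- move=> t ta; rewrite mulr_ge0 ?powR_ge0// ltW//.
- apply/continuous_in_subspaceT => t; rewrite inE/= in_itv/= andbT => ta.
  have t0 := lt_le_trans a0 ta.
  apply: cvgM; first exact: cvg_cst.
  have dp := is_derive1_powR (- p - 1) t0.
  have : {for t, continuous (fun t : R => t `^ (- p - 1))}.
    by apply: differentiable_continuous; apply/derivable1_diffP; exact: ex_derive.
  exact.
- by rewrite -[X in _ --> X]oppr0; apply: cvgN; exact: powRN_cvgy.
- by move=> t ta; have := D _ (lt_trans a0 ta) => dt; exact: ex_derive.
- apply: cvg_at_right_filter.
  have := D _ a0 => dt.
  have : {for a, continuous (fun t : R => - t `^ (- p))}.
    by apply: differentiable_continuous; apply/derivable1_diffP; exact: ex_derive.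
  exact.
- move=> t; rewrite in_itv/= andbT => ta.
  have := D _ (lt_trans a0 ta) => dt.
  by rewrite derive1E; exact: derive_val.
Qed.

Lemma integral_exprn n (a b : R) : a <= b ->
  (\int[leb]_(t in `[a, b]) (n.+1%:R * t ^+ n)%:E = (b ^+ n.+1 - a ^+ n.+1)%:E)%E.
Proof.
rewrite le_eqVlt => /predU1P[->|ab].
  by rewrite set_itv1 integral_set1 subrr.
have D (t : R) : is_derive t 1 (fun t : R => t ^+ n.+1) (n.+1%:R * t ^+ n).
  apply: DeriveDef; first exact: exprn_derivable.
  by rewrite exp_derive [LHS]mulr1.
have C t : {for t, continuous (fun t : R => t ^+ n.+1)} by exact: exprn_continuous.
rewrite (@continuous_FTC2 _ _ (fun t : R => t ^+ n.+1)) ?EFinB//.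
- apply: continuous_subspaceT => t; apply: cvgM; first exact: cvg_cst.
  exact: exprn_continuous.
- split.
  + by move=> t _; exact: ex_derive.
  + exact/cvg_at_right_filter/C.
  + exact/cvg_at_left_filter/C.
- by move=> t _; rewrite derive1E; exact: derive_val.
Qed.
End Integrals1D.

Section Moments.
Variables (R : realType) (n : nat).
Local Notation mu := (lam R n).

Lemma Rintegral_sum d (T : measurableType d) (nu : {measure set T -> \bar R})
    (I : Type) (s : seq I) (f : I -> T -> R) :
  (forall i, nu.-integrable setT (EFin \o f i)) ->
  nu.-integrable setT (EFin \o (fun x => \sum_(i <- s) f i x)) /\
  \int[nu]_x (\sum_(i <- s) f i x) = \sum_(i <- s) \int[nu]_x f i x.
Proof.
move=> fi; elim: s => [|i s [IHi IH]].
  rewrite big_nil; split.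
    under eq_fun do rewrite big_nil.
    exact: integrable0.
  under eq_Rintegral do rewrite big_nil.
  by rewrite Rintegral_cst// mul0r.
have E : EFin \o (fun x => \sum_(i <- (i :: s)) f i x) =
    ((EFin \o f i) \+ (EFin \o (fun x => (\sum_(i <- s) f i x)%R)))%E.
  by apply/funext => x /=; rewrite big_cons EFinD.
split; first by rewrite E; exact: integrableD.
rewrite big_cons -IH -RintegralD//.
by under eq_Rintegral do rewrite big_cons.
Qed.

Lemma Rintegral_orth (S : 'M[R]_n) (f : 'rV[R]_n -> R) :
  S *m S^T = 1%:M -> measurable_fun setT f ->
  \int[mu]_v f (v *m S) = \int[mu]_v f v.
Proof.
move=> SS mf; rewrite /Rintegral; congr fine.
have mE : measurable_fun setT (EFin \o f) by exact/measurable_EFinP.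
rewrite [LHS]integralE [RHS]integralE.
rewrite -(ge0_integral_orth SS (measurable_funepos mE))//.
rewrite -(ge0_integral_orth SS (measurable_funeneg mE))//.
by congr (_ - _)%E; apply: eq_integral => v _; rewrite ?funeposE ?funenegE.
Qed.

Let w (u t : R) : R := if 0 <= t <= u then 2 * t else 0.

(* Layer-cake form of the second moment: [u^2 - |v|^2] is the integral of [2 t] over
   [|v| <= t <= u]. *)
Lemma integral_sqr_deficit (u : R) : 0 < u ->
  mu.-integrable setT (EFin \o (fun v => (u ^+ 2 - fc_enorm v ^+ 2) * \1_(eball u) v)) /\
  \int[mu]_v ((u ^+ 2 - fc_enorm v ^+ 2) * \1_(eball u) v) =
    2 * vball R n * u ^+ n.+2 / n.+2%:R.
Proof.
move=> u0.
have mw : measurable_fun setT (w u).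
  apply: measurable_fun_ifT => //.
  by apply: measurable_and; exact: measurable_fun_ler.
have w0 t : 0 <= w u t by rewrite /w; case: ifPn => // /andP[? _]; rewrite mulr_ge0.
have wz t : t <= 0 -> w u t = 0.
  move=> t0; rewrite /w; case: ifPn => // /andP[t1 _].
  by rewrite (_ : t = 0) ?mulr0//; apply/eqP; rewrite eq_le t0.
have wE m : (\int[lebR R]_t (w u t * t ^+ m)%:E = (2 * u ^+ m.+2 / m.+2%:R)%:E)%E.
  rewrite (_ : 2 * _ / _ = 2 / m.+2%:R * (u ^+ m.+2 - 0 ^+ m.+2)); last first.
    by rewrite expr0n subr0 mulrAC.
  rewrite EFinM -integral_exprn ?ltW// -ge0_integralZl_EFin//=; last 2 first.
  - by move=> t; rewrite in_itv/= => /andP[t0 _]; rewrite lee_fin mulr_ge0// exprn_ge0.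
  - apply/measurable_EFinP; apply: measurable_funM => //; exact: measurable_funX.
  rewrite [RHS]integral_mkcond; apply: eq_integral => t _.
  rewrite patchE mem_setE in_itv/= /w; case: ifPn => _; last by rewrite mul0r.
  by rewrite -EFinM !exprS; congr EFin; field; rewrite gt_eqF.
pose K (v : 'rV[R]_n) := (u ^+ 2 - fc_enorm v ^+ 2) * \1_(eball u) v.
have WK v : (\int[lebR R]_t (w u t * (fc_enorm v <= t)%R%:R)%:E = (K v)%:E)%E.
  rewrite /K indicE mem_eball.
  have [vu|vu] := leP (fc_enorm v) u; last first.
    rewrite mulr0; apply: integral0_eq => t _.
    rewrite /w; case: ifPn => [/andP[_ tu]|_]; last by rewrite mul0r.
    by rewrite leNgt (le_lt_trans tu vu) mulr0.
  rewrite mulr1 -integral_exprn// [RHS]integral_mkcond; apply: eq_integral => t _.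
  rewrite patchE mem_setE in_itv/= /w.
  have [vt|vt] := leP (fc_enorm v) t; last by rewrite mulr0.
  by rewrite (le_trans (enorm_ge0 v) vt) mulr1 /=; case: ifPn.
have fin : (\int[lebR R]_t (w u t * t ^+ n)%:E < +oo)%E by rewrite wE ltry.
have [i1 _ e] := @layer_cake R n (cst 1) K (w u) (measurable_cst _)
  (fun=> ltac:(by rewrite normr1)) mw w0 wz fin WK.
have E1 : (fun v => (u ^+ 2 - fc_enorm v ^+ 2) * \1_(eball u) v) = (fun v => cst 1 v * K v).
  by apply/funext => v; rewrite /= mul1r.
rewrite E1; split => //; rewrite e.
transitivity (\int[lebR R]_t (w u t * (t ^+ n * vball R n))).
  apply: eq_Rintegral => t _.
  have [t0|t0] := leP t 0; first by rewrite wz// !mul0r.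
  congr (_ * _); rewrite -Rintegral_eball//; apply: eq_Rintegral => v _.
  by rewrite /= mul1r.
rewrite /Rintegral; under eq_integral do rewrite mulrA EFinM.
rewrite ge0_integralZr//; last 3 first.
- apply/measurable_EFinP; apply: measurable_funM => //; exact: measurable_funX.
- move=> t _; rewrite lee_fin; have [t0|t0] := leP t 0; first by rewrite wz// mul0r.
  by rewrite mulr_ge0// exprn_ge0// ltW.
- by rewrite lee_fin ltW// vball_gt0.
by rewrite wE/=; ring.
Qed.

(** Symmetry determines the second moments. Changing the sign of coordinate i makes the mixed moment
    its own opposite, exchanging two coordinates makes the pure moments equal, and their sum is the
    moment of |v|^2 given by [integral_sqr_deficit]. *)
Lemma integral_coord_mul (u : R) (i j : 'I_n) : 0 < u ->
  \int[mu]_v (v ord0 i * v ord0 j * \1_(eball u) v) =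
    (i == j)%:R * (vball R n * u ^+ n.+2 / n.+2%:R).
Proof.
move=> u0.
pose f i j (v : 'rV[R]_n) := v ord0 i * v ord0 j * \1_(eball u) v.
have mf i' j' : measurable_fun setT (f i' j').
  apply: measurable_funM; first by apply: measurable_funM; exact: measurable_coord.
  by apply: measurable_indic; exact: measurable_eball.
have fi i' j' : mu.-integrable setT (EFin \o f i' j').
  apply: (@integrable_on_eball _ _ u (u * u)) => [|v vu].
    by apply: measurable_funM; exact: measurable_coord.
  by rewrite normrM ler_pM// (le_trans (enorm_coord _ _)).
have [->|ij] := eqVneq i j; last first.
  rewrite mul0r.
  pose S : 'M[R]_n := diag_mx (\row_k (if k == i then -1 else 1)).
  have SS : S *m S^T = 1%:M.
    rewrite tr_diag_mx mulmx_diag; apply/matrixP => a b; rewrite !mxE.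
    by case: ifPn => _; rewrite ?mulrNN ?mulr1.
  have vS v k : (v *m S) ord0 k = v ord0 k * (if k == i then -1 else 1).
    by rewrite mul_mx_diag !mxE.
  have := Rintegral_orth SS (mf i j).
  under eq_Rintegral => v _.
    rewrite /f !vS eqxx eq_sym (negbTE ij) !indicE !mem_eball enorm_orth//.
    rewrite (_ : _ * _ = -1 * f i j v); last first.
      by rewrite /f indicE mem_eball; ring.
    over.
  rewrite RintegralZl//; last exact: fi.
  rewrite -[\int[mu]_v (_ * _ * _)]/(\int[mu]_v f i j v).
  by move: (\int[mu]_v f i j v) => x; lra.
have sym k l : \int[mu]_v f k k v = \int[mu]_v f l l v.
  pose S : 'M[R]_n := perm_mx (tperm k l).
  have SS : S *m S^T = 1%:M by rewrite tr_perm_mx -perm_mxM mulgV perm_mx1.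
  rewrite -(Rintegral_orth SS (mf k k)); apply: eq_Rintegral => v _.
  have vS : (v *m S) ord0 k = v ord0 l.
    by rewrite /S -[tperm k l]tpermV -col_permE mxE tpermL.
  by rewrite /f vS !indicE !mem_eball enorm_orth.
rewrite mul1r -/(f j j).
have [_ S1] := @Rintegral_sum _ _ mu _ (index_enum 'I_n) (fun k => f k k) (fun k => fi k k).
have [D1 D2] := integral_sqr_deficit u0.
have e : \int[mu]_v (\sum_k f k k v) =
    u ^+ 2 * (u ^+ n * vball R n) - 2 * vball R n * u ^+ n.+2 / n.+2%:R.
  rewrite -D2 -Rintegral_eball// -RintegralZl//; last exact: eball_integrable.
  rewrite -RintegralB//; last first.
    exact: (integrableZl _ (u ^+ 2) (eball_integrable n u)).
  apply: eq_Rintegral => v _; rewrite /f -mulr_suml sqr_enorm.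
  by under eq_bigr do rewrite -expr2; ring.
have e2 : \sum_k \int[mu]_v f k k v = n%:R * \int[mu]_v f j j v.
  under eq_bigr do rewrite (sym _ j).
  by rewrite sumr_const card_ord mulr_natl.
(* The index j excludes n = 0, so the number of equal moments can be divided out. *)
have n0 : n%:R != 0 :> R by rewrite pnatr_eq0 -lt0n (leq_ltn_trans _ (ltn_ord j)).
apply: (mulfI n0); rewrite -e2 -S1 e.
rewrite !exprS; field.
by rewrite -natr1 -natr1; have : 0 <= n%:R :> R by []; lra.
Qed.

Definition qform (A : 'M[R]_n) (v : 'rV[R]_n) := \sum_i \sum_j A i j * (v ord0 i * v ord0 j).

Lemma Rintegral_qform (A : 'M[R]_n) (u : R) : 0 < u ->
  mu.-integrable setT (EFin \o (fun v => qform A v * \1_(eball u) v)) /\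
  \int[mu]_v (qform A v * \1_(eball u) v) = \tr A * (vball R n * u ^+ n.+2 / n.+2%:R).
Proof.
move=> u0.
pose f i j (v : 'rV[R]_n) := A i j * (v ord0 i * v ord0 j * \1_(eball u) v).
have fi i j : mu.-integrable setT (EFin \o (fun v : 'rV[R]_n => v ord0 i * v ord0 j * \1_(eball u) v)).
  apply: (@integrable_on_eball _ _ u (u * u)) => [|v vu].
    by apply: measurable_funM; exact: measurable_coord.
  by rewrite normrM ler_pM// (le_trans (enorm_coord _ _)).
have fAi i j : mu.-integrable setT (EFin \o f i j).
  exact: (integrableZl _ (A i j) (fi i j)).
have S2 i := @Rintegral_sum _ _ mu _ (index_enum 'I_n) (f i) (fAi i).
have [S1i S1] := @Rintegral_sum _ _ mu _ (index_enum 'I_n) _ (fun i => (S2 i).1).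
have E : (fun v => qform A v * \1_(eball u) v) = (fun v => \sum_i \sum_j f i j v).
  apply/funext => v; rewrite /qform mulr_suml; apply: eq_bigr => i _.
  by rewrite mulr_suml; apply: eq_bigr => j _; rewrite /f !mulrA.
rewrite E; split => //; rewrite S1 /mxtrace mulr_suml; apply: eq_bigr => i _.
rewrite (S2 i).2 (bigD1 i)//= big1 ?addr0.
  by rewrite /f RintegralZl// integral_coord_mul// eqxx mul1r.
move=> j ji; rewrite /f RintegralZl// integral_coord_mul// eq_sym (negbTE ji).
by rewrite mul0r mulr0.
Qed.
End Moments.

(** * Sublevel sets cut by small balls *)

Section Sgn1.
Variable R : realType.

(* The value at [0] is [-1] because the sets are of the form [psi <= 0]. *)
Definition sgn1 (x : R) : R := if x <= 0 then -1 else 1.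

Lemma sgn1_mono x y : x <= y -> sgn1 x <= sgn1 y.
Proof.
move=> xy; rewrite /sgn1; case: (leP y 0) => y0.
  by rewrite (le_trans xy y0).
by case: ifP => // _; rewrite lerN10 || (apply: le_trans (ler01); rewrite oppr_le0).
Qed.

Lemma normr_sgn1 x : `|sgn1 x| = 1.
Proof. by rewrite /sgn1; case: ifP => _; rewrite ?normrN1 ?normr1. Qed.

Lemma measurable_sgn1 d (T : measurableType d) (f : T -> R) :
  measurable_fun setT f -> measurable_fun setT (fun x => sgn1 (f x)).
Proof.
by move=> mf; apply: measurable_fun_ifT => //; exact: measurable_fun_ler.
Qed.

Lemma sqr_enorm_rcons n (p : measurableTypeR R * 'rV[R]_n) :
  fc_enorm (rcons_mx p) ^+ 2 = p.1 ^+ 2 + fc_enorm p.2 ^+ 2.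
Proof.
rewrite !sqr_enorm big_ord_recl rcons_mx0; congr (_ + _).
by apply: eq_bigr => i _; rewrite rcons_mxS.
Qed.

(** Fubini with the first coordinate innermost, the reverse of the order in [fc_iint]: the boundary
    is a graph over the remaining coordinates, so a vertical chord is integrated for each fixed
    [w]. *)
Lemma Rintegral_lamS n (f : 'rV[R]_n.+1 -> R) :
  (lam R n.+1).-integrable setT (EFin \o f) ->
  (forall w, (lebR R).-integrable setT (EFin \o (fun t => f (rcons_mx (t, w))))) ->
  let g w := \int[lebR R]_t f (rcons_mx (t, w)) in
  (lam R n).-integrable setT (EFin \o g) /\
  \int[lam R n.+1]_v f v = \int[lam R n]_w g w.
Proof.
move=> fi fti g.
have mc := @measurable_rcons_mx R n.
have mf := measurable_int _ fi.
pose F : measurableTypeR R * 'rV[R]_n -> \bar R := (EFin \o f) \o @rcons_mx R n.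
have mF : measurable_fun setT F by exact: measurableT_comp.
have Fi : (lebR R \x lam R n)%E.-integrable setT F.
  apply/integrableP; split => //.
  have /integrableP[_] := fi; rewrite (ge0_integral_pushforward mc)//.
  exact: measurableT_comp.
have Fg w : (\int[lebR R]_t F (t, w) = (g w)%:E)%E.
  by rewrite /g /Rintegral fineK//; exact: (integrable_fin_num measurableT (fti w)).
split.
  apply/integrableP; split.
    have := measurable_fubini_G Fi; congr (measurable_fun _ _).
    by apply/funext => w; rewrite /fubini_G Fg.
  apply: le_lt_trans ((integrable21ltyP _ _ mF).1 Fi); apply: ge0_le_integral => //.
  - apply: measurableT_comp => //.
    have := measurable_fubini_G Fi; congr (measurable_fun _ _).
    by apply/funext => w; rewrite /fubini_G Fg.
  - apply: (@measurable_fun_fubini_tonelli_G _ _ _ _ _ _ (abse \o F)) => [|p].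
      exact: measurableT_comp.
    exact: abse_ge0.
  - move=> w _; rewrite -[(EFin \o g) w](Fg w); apply: le_abse_integral => //; exact: measurable_fun_pair1.
rewrite /Rintegral; congr fine.
transitivity (\int[(lebR R \x lam R n)%E]_p F p)%E.
  exact: (@integral_pushforward _ _ _ _ _ _ mc).
by rewrite -(integral21_prod_meas1 Fi); apply: eq_integral => w _; exact: Fg.
Qed.

(** The sign is -1 up to t = -q and 1 beyond. If -q lies in the interval, the two lengths differ by
    2 q; otherwise J is 2 tau with the sign of q, and tau < |q| bounds the error. *)
Lemma integral_sgn1_itv (q tau : R) : 0 <= tau ->
  let J := \int[lebR R]_t (sgn1 (t + q) * \1_([set` `[- tau, tau]] : set R) t) in
  [/\ (lebR R).-integrable setT
        (EFin \o (fun t => sgn1 (t + q) * \1_([set` `[- tau, tau]] : set R) t)),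
      `|q| <= tau -> J = 2 * q & `|J - 2 * q| <= 2 * `|q| ].
Proof.
move=> tau0 J.
pose I : set R := [set` `[- tau, tau]].
pose I' : set R := [set` `[- tau, Num.min tau (- q)]].
have iI (a b : R) : (lebR R).-integrable setT (EFin \o \1_([set` `[a, b]] : set R)).
  apply/integrableP; split; first exact/measurable_EFinP/measurable_indic.
  under eq_integral do rewrite /= ger0_norm//.
  rewrite integral_indic// setIT /lebR /= lebesgue_measure_itv/=.
  by case: ifPn => // _; rewrite ltry.
have E : (fun t => sgn1 (t + q) * \1_I t) = (fun t => \1_I t - 2 * \1_I' t).
  apply/funext => t; rewrite /sgn1 !indicE !mem_setE !in_itv/= le_min.
  rewrite -lerBrDr sub0r; case: (leP (- tau) t) => /= _; last by lra.
  by case: (leP t tau) => /= _; [case: (leP t (- q)) => /= _; lra|lra].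
have iI2 : (lebR R).-integrable setT (EFin \o (fun t => 2 * \1_I' t)).
  exact: (integrableZl _ 2 (iI _ _)).
have JE : J = \int[lebR R]_t \1_I t - 2 * \int[lebR R]_t \1_I' t.
  rewrite /J -/I E RintegralB//; last exact: iI.
  by rewrite RintegralZl//; exact: iI.
have len (a b : R) : \int[lebR R]_t \1_([set` `[a, b]] : set R) t = if a < b then b - a else 0.
  rewrite /Rintegral integral_indic// setIT /lebR /= lebesgue_measure_itv/= lte_fin.
  by case: ifP.
split.
- rewrite -/I E; rewrite (_ : EFin \o _ = ((EFin \o \1_I) \- (EFin \o (fun t => 2 * \1_I' t)%R))%E)//.
  by apply: integrableB => //; exact: iI.
- rewrite ler_norml => /andP[q1 q2]; rewrite JE !len.
  have -> : Num.min tau (- q) = - q by apply/min_idPr; lra.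
  case: (ltP (- tau) tau) => h1; case: (ltP (- tau) (- q)) => h2; lra.
- rewrite JE !len.
  have [h|h] := leP tau (- q).
    rewrite (ler0_norm (x := q)); last by lra.
    by case: (ltP (- tau) tau) => h1; rewrite ler_norml; apply/andP; split; lra.
  case: (ltP (- tau) tau) => h1; case: (ltP (- tau) (- q)) => h2;
   case: (ler0P q) => q0; rewrite ler_norml; apply/andP; split; lra.
Qed.

End Sgn1.

(** * Chords of a ball cut by a graph *)

Section Slab.
Variable R : realType.

(** Bernoulli's inequality, in the form that bounds the volume of the thin annulus in
    [slab_integral]. *)
Lemma subr_exprn_le (x : R) n : 0 <= x <= 1 -> 1 - x ^+ n <= n%:R * (1 - x).
Proof.
move=> /andP[x0 x1]; elim: n => [|n IH]; first by rewrite expr0 subrr mul0r.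
have xn : x ^+ n <= 1 by rewrite exprn_ile1.
rewrite exprS -natr1.
have -> : 1 - x * x ^+ n = (1 - x ^+ n) + x ^+ n * (1 - x) by ring.
by rewrite mulrDl lerD// mul1r ler_piMl// subr_ge0.
Qed.

Lemma abs_le_sq (a b : R) : 0 <= b -> a ^+ 2 <= b ^+ 2 -> `|a| <= b.
Proof. by move=> b0 ab; rewrite -(@ler_pXn2r _ 2) ?nnegrE// real_normK ?num_real. Qed.

(* On the line above [w] the integral of the sign over the chord of the ball is [2 Q w]
   as soon as the graph meets the chord; this fails only for [w] in the thin annulus
   [u * (1 - (K u)^2) <= |w| <= u], where the error is at most [2 |Q w|]. *)
Lemma slab_integral n (Q : 'rV[R]_n -> R) (K u : R) :
  measurable_fun setT Q -> 0 <= K ->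
  (forall w, fc_enorm w <= u -> `|Q w| <= K * fc_enorm w ^+ 2) -> 0 < u -> K * u < 1 ->
  let f (z : 'rV[R]_n.+1) := sgn1 (z ord0 ord0 + Q (runcons_mx z).2) * \1_(eball u) z in
  (lam R n.+1).-integrable setT (EFin \o f) /\
  `|\int[lam R n.+1]_z f z - \int[lam R n]_w (2 * Q w * \1_(eball u) w)| <=
    2 * K ^+ 3 * n%:R * vball R n * u ^+ n.+4.
Proof.
move=> mQ K0 QK u0 Ku f.
have ms : measurable_fun setT (fun z : 'rV[R]_n.+1 => sgn1 (z ord0 ord0 + Q (runcons_mx z).2)).
  apply: measurable_sgn1; apply: measurable_funD; first exact: measurable_coord.
  apply: (measurableT_comp mQ).
  exact: (measurableT_comp measurable_snd (@measurable_runcons_mx R n)).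
have fi : (lam R n.+1).-integrable setT (EFin \o f).
  by apply: (@integrable_on_eball _ _ u 1) => // v _; rewrite normr_sgn1.
split=> //.
pose tau (w : 'rV[R]_n) := Num.sqrt (u ^+ 2 - fc_enorm w ^+ 2).
have tau0 w : 0 <= tau w by exact: sqrtr_ge0.
have tau2 w : fc_enorm w <= u -> tau w ^+ 2 = u ^+ 2 - fc_enorm w ^+ 2.
  move=> wu; rewrite [LHS]sqr_sqrtr// subr_ge0.
  by rewrite lerXn2r ?nnegrE ?enorm_ge0// ltW.
pose J w := \int[lebR R]_t (sgn1 (t + Q w) * \1_([set` `[- tau w, tau w]] : set R) t).
have fE w t : f (rcons_mx (t, w)) =
    if fc_enorm w <= u then sgn1 (t + Q w) * \1_([set` `[- tau w, tau w]] : set R) t else 0.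
  rewrite /f rcons_mx0 rcons_mxK/= !indicE mem_eball mem_setE in_itv/= -ler_norml.
  have e : (fc_enorm (rcons_mx (t, w)) <= u) = (t ^+ 2 + fc_enorm w ^+ 2 <= u ^+ 2).
    by rewrite -(@ler_pXn2r _ 2) ?nnegrE ?enorm_ge0 ?(ltW u0)// sqr_enorm_rcons.
  rewrite e.
  have [wu|wu] := leP (fc_enorm w) u.
    congr (_ * _%:R); rewrite -[`|t| <= _](@ler_pXn2r _ 2) ?nnegrE// real_normK ?num_real//.
    by rewrite tau2// lerBrDr.
  rewrite leNgt (_ : _ < _)/= ?mulr0//.
  by rewrite ltr_wpDl ?sqr_ge0// ltrXn2r ?nnegrE ?enorm_ge0 ?ltW.
have fti w : (lebR R).-integrable setT (EFin \o (fun t => f (rcons_mx (t, w)))).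
  rewrite (_ : (fun t => _) = fun t => if fc_enorm w <= u then
    sgn1 (t + Q w) * \1_([set` `[- tau w, tau w]] : set R) t else 0); last first.
    by apply/funext => t; exact: fE.
  case: (boolP (fc_enorm w <= u)) => _; last exact: integrable0.
  by have [] := integral_sgn1_itv (Q w) (tau0 w).
have [gi ->] := Rintegral_lamS fi fti.
set g := fun w => _ in gi *.
have gE w : g w = if fc_enorm w <= u then J w else 0.
  rewrite /g; case: ifPn => wu.
    by apply: eq_Rintegral => t _; rewrite fE wu.
  rewrite -[RHS](mul0r (fine (lebR R setT))) -Rintegral_cst//.
  by apply: eq_Rintegral => t _; rewrite fE (negbTE wu).
have Qi : (lam R n).-integrable setT (EFin \o (fun w => 2 * Q w * \1_(eball u) w)).
  apply: (@integrable_on_eball _ _ u (2 * (K * u ^+ 2))) => [|w wu].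
    exact: measurable_funM.
  rewrite normrM normr_nat ler_pM2l// (le_trans (QK _ wu))// ler_wpM2l//.
  by rewrite lerXn2r ?nnegrE ?enorm_ge0// ltW.
(* With a = (K u)^2, the inequality a + (1 - a)^2 <= 1 gives (K u^2)^2 + (theta u)^2 <= u^2. Hence
   over |w| <= theta u the half-chord is at least K u^2, which bounds |Q w|. *)
pose theta := 1 - (K * u) ^+ 2.
have Ku0 : 0 <= K * u by rewrite mulr_ge0// ltW.
have Ku2 : (K * u) ^+ 2 < 1 by rewrite expr_lt1.
have th0 : 0 < theta by rewrite subr_gt0.
have th1 : theta <= 1 by rewrite gerBl sqr_ge0.
pose u' := u * theta.
have u'0 : 0 < u' by rewrite mulr_gt0.
have u'u : u' <= u by rewrite ler_piMr// ltW.
have pw w : `|g w - 2 * Q w * \1_(eball u) w| <=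
    2 * (K * u ^+ 2) * (\1_(eball u) w - \1_(eball u') w).
  rewrite gE !indicE !mem_eball; have [wu|wu] := leP (fc_enorm w) u; last first.
    by rewrite (lt_geF (le_lt_trans u'u wu)) /= !mulr0 subrr normr0 mulr0.
  have [_ J1 J2] := integral_sgn1_itv (Q w) (tau0 w).
  have Qw : `|Q w| <= K * u ^+ 2.
    rewrite (le_trans (QK _ wu))// ler_wpM2l//.
    by rewrite lerXn2r ?nnegrE ?enorm_ge0// ltW.
  rewrite mulr1; have [wu'|wu'] := leP (fc_enorm w) u'; last first.
    by rewrite subr0 mulr1 (le_trans J2)// ler_pM2l.
  rewrite subrr mulr0 (_ : J w = 2 * Q w) ?subrr ?normr0//; apply: J1.
  rewrite (le_trans Qw)//; apply: (le_trans (ler_norm _)).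
  apply: abs_le_sq => //; rewrite tau2//.
  rewrite lerBrDr; apply: (@le_trans _ _ ((K * u ^+ 2) ^+ 2 + u' ^+ 2)).
    by rewrite lerD2l lerXn2r ?nnegrE ?enorm_ge0// ltW.
  rewrite /u' /theta; set a := (K * u) ^+ 2.
  have -> : (K * u ^+ 2) ^+ 2 + (u * (1 - a)) ^+ 2 = u ^+ 2 * (a + (1 - a) ^+ 2).
    by rewrite /a; ring.
  have a0 : 0 <= a by exact: sqr_ge0.
  rewrite -[leRHS]mulr1 ler_wpM2l ?sqr_ge0//.
  have -> : a + (1 - a) ^+ 2 = 1 - a * (1 - a) by ring.
  by rewrite gerBl mulr_ge0// subr_ge0 ltW.
rewrite -RintegralB//.
apply: (le_trans (le_normr_Rintegral _ _)) => //.
  exact: (integrableB _ gi Qi).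
have Bi : (lam R n).-integrable setT (EFin \o (fun w => \1_(eball u) w - \1_(eball u') w)).
  exact: (integrableB _ (eball_integrable n u) (eball_integrable n u')).
apply: (@le_trans _ _ (\int[lam R n]_w (2 * (K * u ^+ 2) * (\1_(eball u) w - \1_(eball u') w)))).
  apply: le_Rintegral => //.
  - exact: (integrable_norm (integrableB measurableT gi Qi)).
  - exact: (integrableZl _ _ Bi).
  - by move=> w _; exact: pw.
rewrite RintegralZl// RintegralB//; try exact: eball_integrable.
rewrite !Rintegral_eball// /u' exprMn.
(* The annulus has volume at most n (K u)^2 u^n |B| and the error on it is at most 2 K u^2, which
   makes a total of order u^(n+4), two orders below the main term. *)
have := @subr_exprn_le theta n; rewrite (ltW th0) th1 => /(_ isT) th.
have v0 := ltW (vball_gt0 R n).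
have -> : 2 * (K * u ^+ 2) * (u ^+ n * vball R n - u ^+ n * theta ^+ n * vball R n) =
  2 * K * vball R n * u ^+ n.+2 * (1 - theta ^+ n) by rewrite !exprS; ring.
apply: (@le_trans _ _ (2 * K * vball R n * u ^+ n.+2 * (n%:R * (1 - theta)))).
  apply: ler_wpM2l => //.
  by rewrite mulr_ge0 ?exprn_ge0 ?(ltW u0)// mulr_ge0// mulr_ge0.
by rewrite /theta le_eqVlt; apply/orP; left; apply/eqP; rewrite !exprS; ring.
Qed.
End Slab.

(** * Sublevel sets whose normal is the first axis *)

Section Graph.
Variable R : realType.

(** The form restricted to the tangent hyperplane when the normal is the first axis. *)
Definition lowmx n (A : 'M[R]_n.+1) : 'M[R]_n :=
  \matrix_(i, j) A (lift ord0 i) (lift ord0 j).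

Lemma mxtrace_lowmx n (A : 'M[R]_n.+1) : \tr (lowmx A) = \tr A - A ord0 ord0.
Proof.
rewrite [\tr A]big_ord_recl addrAC subrr add0r; apply: eq_bigr => i _; by rewrite mxE.
Qed.

Lemma qform_lowmx n (A : 'M[R]_n.+1) (z : 'rV[R]_n.+1) (w := (runcons_mx z).2) :
  qform A z = A ord0 ord0 * z ord0 ord0 ^+ 2 +
    z ord0 ord0 * (\sum_j (A ord0 (lift ord0 j) + A (lift ord0 j) ord0) * w ord0 j) +
    qform (lowmx A) w.
Proof.
have zw j : z ord0 (lift ord0 j) = w ord0 j by rewrite -[in LHS](runcons_mxK z) rcons_mxS.
rewrite /qform big_ord_recl big_ord_recl -expr2 -!addrA; congr (_ + _).
transitivity (z ord0 ord0 * (\sum_j A ord0 (lift ord0 j) * w ord0 j) +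
  \sum_i (A (lift ord0 i) ord0 * (z ord0 ord0 * w ord0 i) +
   \sum_j lowmx A i j * (w ord0 i * w ord0 j))).
  congr (_ + _).
    by rewrite mulr_sumr; apply: eq_bigr => j _; rewrite zw; ring.
  apply: eq_bigr => i _; rewrite big_ord_recl zw; congr (_ + _); first by ring.
  by apply: eq_bigr => j _; rewrite [lowmx A i j]mxE !zw.
rewrite big_split/= addrA; congr (_ + _).
rewrite mulr_sumr -big_split/= mulr_sumr; apply: eq_bigr => j _; ring.
Qed.

Lemma qform_bound n (A : 'M[R]_n) (K : R) (v : 'rV[R]_n) :
  (forall i j, `|A i j| <= K) -> `|qform A v| <= K * n%:R ^+ 2 * fc_enorm v ^+ 2.
Proof.
move=> AK; apply: (le_trans (ler_norm_sum _ _ _)).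
apply: (@le_trans _ _ (\sum_(i < n) \sum_(j < n) K * fc_enorm v ^+ 2)).
  apply: ler_sum => i _; apply: (le_trans (ler_norm_sum _ _ _)); apply: ler_sum => j _.
  by rewrite !normrM ler_pM// ler_pM// enorm_coord.
rewrite !sumr_const !card_ord -[K * _ *+ n]mulr_natr -[K * _ * _ *+ n]mulr_natr.
by rewrite (_ : _ * n%:R = K * n%:R ^+ 2 * fc_enorm v ^+ 2)//; ring.
Qed.

(* The terms of [psi] divisible by the first coordinate are absorbed in a positive
   factor [1 + h], which does not change the sign. *)
Lemma graph_sandwich n (A : 'M[R]_n.+1) (K e u psi : R) (z : 'rV[R]_n.+1)
    (w := (runcons_mx z).2) (gam := (K * (1 + 2 * n%:R) / 2 + e) * u)
    (C := K * n%:R ^+ 2 * gam + 2 * e) :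
  0 <= K -> 0 <= e -> 0 <= u -> (forall i j, `|A i j| <= K) ->
  gam <= 2^-1 -> fc_enorm z <= u ->
  `|psi - (z ord0 ord0 + qform A z / 2)| <= e * fc_enorm z ^+ 2 ->
  sgn1 (z ord0 ord0 + (qform (lowmx A) w / 2 - C * fc_enorm w ^+ 2)) <= sgn1 psi /\
  sgn1 psi <= sgn1 (z ord0 ord0 + (qform (lowmx A) w / 2 + C * fc_enorm w ^+ 2)).
Proof.
move=> K0 e0 u0 AK gam2 zu hpsi.
set z0 := z ord0 ord0; set q' := qform (lowmx A) w.
have z0u : `|z0| <= u by rewrite (le_trans (enorm_coord _ _)).
have znorm : fc_enorm z ^+ 2 = z0 ^+ 2 + fc_enorm w ^+ 2.
  by rewrite -[in LHS](runcons_mxK z) sqr_enorm_rcons.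
have wu j : `|w ord0 j| <= u.
  rewrite (_ : w ord0 j = z ord0 (lift ord0 j)); first by rewrite (le_trans (enorm_coord _ _)).
  by rewrite -[in RHS](runcons_mxK z) rcons_mxS.
(* The remainder is written as th |z|^2 with |th| <= e, so that its part th z0^2 can join the factor
   of z0 and its part th |w|^2 the graph. *)
have [th the hth] : exists2 th : R, `|th| <= e &
    psi = z0 + qform A z / 2 + th * fc_enorm z ^+ 2.
  have [zz|zz] := eqVneq (fc_enorm z ^+ 2) 0.
    exists 0; rewrite ?normr0// mul0r addr0; apply/eqP; rewrite -subr_eq0 -normr_le0.
    by rewrite (le_trans hpsi)// zz mulr0.
  have zz0 : 0 < fc_enorm z ^+ 2 by rewrite lt0r zz sqr_ge0.
  exists ((psi - (z0 + qform A z / 2)) / fc_enorm z ^+ 2).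
    by rewrite normrM normfV (gtr0_norm zz0) ler_pdivrMr.
  by rewrite mulfVK// addrC subrK.
set a := \sum_j (A ord0 (lift ord0 j) + A (lift ord0 j) ord0) * w ord0 j.
have au : `|a| <= 2 * n%:R * K * u.
  apply: (le_trans (ler_norm_sum _ _ _)).
  apply: (@le_trans _ _ (\sum_(j < n) (K + K) * u)).
    by apply: ler_sum => j _; rewrite normrM ler_pM// (le_trans (ler_normD _ _))// lerD.
  by rewrite sumr_const card_ord -mulr_natr le_eqVlt; apply/orP; left; apply/eqP; ring.
pose h := (A ord0 ord0 * z0 + a) / 2 + th * z0.
have hgam : `|h| <= gam.
  rewrite /h; apply: (@le_trans _ _ ((K * u + 2 * n%:R * K * u) / 2 + e * u)).
    apply: (le_trans (ler_normD _ _)); apply: lerD; last by rewrite normrM ler_pM.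
    rewrite normrM (ger0_norm (x := 2^-1))// ler_pM2r// (le_trans (ler_normD _ _))// lerD//.
    by rewrite normrM ler_pM.
  by rewrite /gam le_eqVlt; apply/orP; left; apply/eqP; field.
have psiE : psi = z0 * (1 + h) + q' / 2 + th * fc_enorm w ^+ 2.
  by rewrite hth qform_lowmx -/z0 -/w -/a -/q' znorm /h; field.
have q'b : `|q'| <= K * n%:R ^+ 2 * fc_enorm w ^+ 2.
  by apply: qform_bound => i j; rewrite mxE.
have w20 : 0 <= fc_enorm w ^+ 2 by exact: sqr_ge0.
(* It remains to divide by 1 + h, which is at least 1/2: the graph function X then differs from q'/2
   by at most 2 (e W + K n^2 W gam / 2), and this is C W. *)
set W := fc_enorm w ^+ 2 in psiE q'b w20 *.
have g0 : 2^-1 <= 1 + h.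
  by move: hgam; rewrite ler_norml => /andP[h1 _]; lra.
have gpos : 0 < 1 + h by lra.
set X := (q' / 2 + th * W) / (1 + h).
have XC : `|X - q' / 2| <= C * W.
  have -> : X - q' / 2 = (th * W - q' / 2 * h) / (1 + h).
    by rewrite /X; field; rewrite gt_eqF.
  rewrite normrM normfV (gtr0_norm gpos) ler_pdivrMr//.
  have CW0 : 0 <= C * W.
    have gam0 : 0 <= gam by exact: le_trans (normr_ge0 _) hgam.
    by rewrite mulr_ge0// /C addr_ge0// mulr_ge0// mulr_ge0// exprn_ge0.
  apply: (@le_trans _ _ (C * W / 2)); last by rewrite ler_wpM2l.
  apply: (le_trans (ler_normB _ _)); rewrite (normrM th) (normrM _ h) (normrM q').
  rewrite (ger0_norm w20) (ger0_norm (x := 2^-1))//.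
  have -> : C * W / 2 = e * W + K * n%:R ^+ 2 * W / 2 * gam by rewrite /C; field.
  apply: lerD; first by rewrite ler_wpM2r.
  by rewrite ler_pM// ?mulr_ge0// ler_wpM2r.
have -> : sgn1 psi = sgn1 (z0 + X).
  have -> : psi = (z0 + X) * (1 + h) by rewrite psiE /X; field; rewrite gt_eqF.
  by rewrite /sgn1 pmulr_lle0.
move: XC; rewrite ler_norml => /andP[X1 X2].
by split; apply: sgn1_mono; rewrite lerD2l; lra.
Qed.

(** The terms C |w|^2 of the sandwich are absorbed in the matrix: both enclosing graphs are again
    quadratic forms, at the price of moving the trace by c n. *)
Lemma qformDs n (A : 'M[R]_n) (c : R) v :
  qform (A + c%:M) v = qform A v + c * fc_enorm v ^+ 2.
Proof.
rewrite sqr_enorm mulr_sumr /qform -big_split/=; apply: eq_bigr => i _.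
transitivity (\sum_j (A i j * (v ord0 i * v ord0 j) + (i == j)%:R * c * (v ord0 i * v ord0 j))).
  by apply: eq_bigr => j _; rewrite !mxE mulrDl mulr_natl.
rewrite big_split/=; congr (_ + _).
rewrite (bigD1 i)//= eqxx big1 ?addr0 ?mul1r ?expr2// => j ji.
by rewrite eq_sym (negbTE ji) !mul0r.
Qed.

Lemma measurable_qform n (A : 'M[R]_n) : measurable_fun setT (qform A).
Proof.
apply: measurable_sum => i; apply: measurable_sum => j; apply: measurable_funM => //.
by apply: measurable_funM; exact: measurable_coord.
Qed.

Lemma squeeze_center (a b s t c Y E X : R) : a <= s -> s <= b ->
  `|b - (t + c) * Y| <= E -> `|a - (t - c) * Y| <= E -> c * Y + E <= X ->
  `|s - t * Y| <= X.
Proof. by rewrite !ler_norml => *; lra. Qed.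

(** The order of the quantifiers is the point: [eta] depends on the dimension, [K] and [eps] alone,
    so one [eta] serves for all sets of a sequence. Measurability is carried by [sigma], the phase
    of a closed set, while [psi] enters only pointwise on the ball. *)
Lemma graph_integral n (K eps : R) : 0 <= K -> 0 < eps ->
  exists2 eta : R, 0 < eta & forall (u e : R) (A : 'M[R]_n.+1) (psi sigma : 'rV[R]_n.+1 -> R),
    0 < u < eta -> 0 <= e < eta -> (forall i j, `|A i j| <= K) ->
    measurable_fun setT sigma ->
    (forall z, fc_enorm z <= u ->
      `|psi z - (z ord0 ord0 + qform A z / 2)| <= e * fc_enorm z ^+ 2) ->
    (forall z, fc_enorm z <= u -> sigma z = sgn1 (psi z)) ->
    `|\int[lam R n.+1]_z (sigma z * \1_(eball u) z) -
      (\tr A - A ord0 ord0) * (vball R n * u ^+ n.+2 / n.+2%:R)| <= eps * u ^+ n.+2.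
Proof.
move=> K0 eps0.
have om0 := vball_gt0 R n.
set om := vball R n in om0 *.
(* G bounds gam / u, L bounds C by a multiple of 1 / M, KQ is the quadratic bound for both enclosing
   graphs, and D collects the coefficients of the two final errors. *)
pose G := K * (1 + 2 * n%:R) / 2 + 1.
pose L := K * n%:R ^+ 2 * G + 2.
pose KQ := K * n%:R ^+ 2 + 1.
pose D := 2 * n%:R * om * L + 2 * KQ ^+ 3 * n%:R * om.
have G0 : 0 <= G by rewrite addr_ge0// divr_ge0// mulr_ge0// addr_ge0// mulr_ge0.
have L0 : 0 <= L by rewrite addr_ge0// !mulr_ge0// exprn_ge0.
have KQ0 : 0 <= KQ by rewrite addr_ge0// mulr_ge0// exprn_ge0.
have D0 : 0 <= D.
  by rewrite addr_ge0// mulr_ge0// ?mulr_ge0// ?exprn_ge0// ltW.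
(* Each smallness condition below is drawn from c x <= 1 with c <= M and 0 <= x < 1 / M; M adds up
   the constants c that occur. *)
pose M := 1 + 2 * G + L + 2 * KQ + D / eps.
have De0 : 0 <= D / eps by rewrite divr_ge0// ltW.
have M1 : 1 <= M by rewrite /M; lra.
have M0 : 0 < M by exact: lt_le_trans M1.
have MG : 2 * G <= M by rewrite /M; lra.
have ML : L <= M by rewrite /M; lra.
have MK : 2 * KQ <= M by rewrite /M; lra.
have MD : D / eps <= M by rewrite /M; lra.
exists M^-1; rewrite ?invr_gt0// => u e A psi sigma /andP[u0 uM] /andP[e0 eM] AK ms hpsi hs.
have small c : 0 <= c -> c <= M -> forall x, 0 <= x -> x < M^-1 -> c * x <= 1.
  move=> c0 cM x x0 xM; apply: (@le_trans _ _ (M * M^-1)); last by rewrite mulfV ?gt_eqF.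
  by rewrite ler_pM// ltW.
have u1 : u <= 1 by rewrite -[u]mul1r; apply: small => //; exact: ltW.
have e1 : e <= 1 by rewrite -[e]mul1r; apply: small.
pose gam := (K * (1 + 2 * n%:R) / 2 + e) * u.
pose C := K * n%:R ^+ 2 * gam + 2 * e.
have gamG : gam <= G * u by apply: ler_wpM2r; [exact: ltW|rewrite lerD2l].
have gam2 : gam <= 2^-1.
  rewrite (le_trans gamG)//.
  have : 2 * G * u <= 1 by apply: small => //; [exact: mulr_ge0|exact: ltW].
  lra.
have gam0 : 0 <= gam.
  by rewrite mulr_ge0 ?(ltW u0)// addr_ge0// divr_ge0// mulr_ge0// addr_ge0// mulr_ge0.
have Kn0 : 0 <= K * n%:R ^+ 2 by rewrite mulr_ge0// exprn_ge0.
have C0 : 0 <= C by apply: addr_ge0; apply: mulr_ge0.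
have CL : C <= L * M^-1.
  rewrite /C /L [leRHS]mulrDl lerD//; last by rewrite ler_wpM2l// ltW.
  rewrite -[leRHS]mulrA; apply: ler_wpM2l => //.
  by rewrite (le_trans gamG)// ler_wpM2l// ltW.
have MM : M * M^-1 = 1 by rewrite mulfV ?gt_eqF.
have CL1 : C <= 1.
  by rewrite (le_trans CL)// -MM ler_wpM2r// invr_ge0 ltW.
(* The enclosing graphs are the halves of the forms [B c] with c = 2 C and c = - 2 C; the factor 2
   compensates the halving. *)
pose B c := lowmx A + c%:M.
have QB c v : qform (B c) v / 2 = qform (lowmx A) v / 2 + c / 2 * fc_enorm v ^+ 2.
  by rewrite qformDs mulrDl mulrAC.
have Qb c v : `|c| = 2 * C -> `|qform (B c) v / 2| <= KQ * fc_enorm v ^+ 2.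
  move=> cC; rewrite QB; apply: (le_trans (ler_normD _ _)).
  have q1 : `|qform (lowmx A) v| <= K * n%:R ^+ 2 * fc_enorm v ^+ 2.
    by apply: qform_bound => i j; rewrite mxE.
  have v2 : 0 <= fc_enorm v ^+ 2 by exact: sqr_ge0.
  rewrite (normrM (qform _ _)) (normrM (c / 2)) (normrM c) cC (ger0_norm v2) (ger0_norm (x := 2^-1))// /KQ.
  have : C * fc_enorm v ^+ 2 <= 1 * fc_enorm v ^+ 2 by rewrite ler_wpM2r.
  have k0 : 0 <= K * n%:R ^+ 2 * fc_enorm v ^+ 2 by exact: mulr_ge0.
  lra.
have KQu : KQ * u < 1.
  have : 2 * KQ * u <= 1 by apply: small => //; [exact: mulr_ge0|exact: ltW].
  have : 0 <= KQ * u by rewrite mulr_ge0// ltW.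
  lra.
have mQ c : measurable_fun setT (fun v => qform (B c) v / 2).
  by apply: measurable_funM => //; exact: measurable_qform.
pose F c (z : 'rV[R]_n.+1) :=
  sgn1 (z ord0 ord0 + qform (B c) (runcons_mx z).2 / 2) * \1_(eball u) z.
have si : (lam R n.+1).-integrable setT (EFin \o (fun z => sigma z * \1_(eball u) z)).
  by apply: (@integrable_on_eball _ _ u 1) => // z zu; rewrite hs// normr_sgn1.
have Fint c : `|c| = 2 * C ->
    (lam R n.+1).-integrable setT (EFin \o F c) /\
    `|\int[lam R n.+1]_z F c z - (\tr (lowmx A) + c * n%:R) * (om * u ^+ n.+2 / n.+2%:R)|
      <= 2 * KQ ^+ 3 * n%:R * om * u ^+ n.+4.
  move=> cC; have [Fi Fe] := slab_integral (mQ c) KQ0 (fun w _ => Qb c w cC) u0 KQu.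
  split=> //; move: Fe; congr (`|_ - _| <= _).
  transitivity (\int[lam R n]_w (qform (B c) w * \1_(eball u) w)).
    by apply: eq_Rintegral => w _; rewrite mulrCA divff ?mulr1//.
  rewrite (Rintegral_qform (B c) u0).2; congr (_ * _).
  by rewrite raddfD/= mxtrace_scalar mulr_natr.
have C2 : `|2 * C| = 2 * C by rewrite ger0_norm// mulr_ge0.
have C2' : `|- (2 * C)| = 2 * C by rewrite normrN.
have [F1i F1] := Fint _ C2; have [F2i F2] := Fint _ C2'.
have sand z : F (- (2 * C)) z <= sigma z * \1_(eball u) z <= F (2 * C) z.
  rewrite /F !indicE !mem_eball; have [zu|zu] := leP (fc_enorm z) u; last by rewrite !mulr0 lexx.
  rewrite !mulr1 hs// !QB.
  have [s1 s2] := graph_sandwich K0 e0 (ltW u0) AK gam2 zu (hpsi z zu).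
  apply/andP; split.
    by rewrite (_ : - (2 * C) / 2 = - C) ?mulNr//; field.
  by rewrite (_ : 2 * C / 2 = C)//; field.
have I1 : \int[lam R n.+1]_z F (- (2 * C)) z <= \int[lam R n.+1]_z (sigma z * \1_(eball u) z).
  by apply: le_Rintegral => // z _; have /andP[] := sand z.
have I2 : \int[lam R n.+1]_z (sigma z * \1_(eball u) z) <= \int[lam R n.+1]_z F (2 * C) z.
  by apply: le_Rintegral => // z _; have /andP[] := sand z.
have un0 : 0 <= u ^+ n.+2 by rewrite exprn_ge0// ltW.
(* The first error is the shift of the trace by 2 C n, the second is the annulus error of
   [slab_integral]. *)
have err : 2 * C * n%:R * (om * u ^+ n.+2 / n.+2%:R) + 2 * KQ ^+ 3 * n%:R * om * u ^+ n.+4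
    <= eps * u ^+ n.+2.
  apply: (@le_trans _ _ (D * M^-1 * u ^+ n.+2)); last first.
    apply: ler_wpM2r => //; by rewrite ler_pdivrMr// mulrC -ler_pdivrMr.
  rewrite (_ : D * M^-1 * u ^+ n.+2 = 2 * n%:R * om * (L * M^-1) * u ^+ n.+2 +
    2 * KQ ^+ 3 * n%:R * om * M^-1 * u ^+ n.+2); last by rewrite /D; ring.
  apply: lerD.
    have -> : 2 * C * n%:R * (om * u ^+ n.+2 / n.+2%:R) =
      2 * n%:R * om * (C * n.+2%:R^-1) * u ^+ n.+2 by ring.
    apply: ler_wpM2r => //; apply: ler_wpM2l.
      by rewrite !mulr_ge0// ltW.
    rewrite (le_trans _ CL)// ler_piMr// invf_le1// ler1n//.
  have -> : 2 * KQ ^+ 3 * n%:R * om * u ^+ n.+4 =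
     2 * KQ ^+ 3 * n%:R * om * (u * u) * u ^+ n.+2 by rewrite !exprS; ring.
  apply: ler_wpM2r => //; apply: ler_wpM2l.
    by rewrite !mulr_ge0// ?exprn_ge0// ltW.
  rewrite (le_trans _ (ltW uM))// ler_piMr// ltW//.
rewrite -mxtrace_lowmx.
set T := om * u ^+ n.+2 / n.+2%:R in F1 F2 err *.
rewrite mulNr in F2.
exact: (squeeze_center I1 I2 F1 F2 err).
Qed.
End Graph.

(** * Sublevel sets with an arbitrary normal *)

Section Tilted.
Variable R : realType.

(** With h the unit vector of nu and e the first axis, the reflection in the hyperplane orthogonal
    to x = h - e exchanges h and e. It degenerates when h = e, where the identity is taken. *)
Lemma householder n (nu : 'rV[R]_n.+1) : nu != 0 ->
  exists2 S : 'M[R]_n.+1, S *m S^T = 1%:M &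
    S *m nu^T = fc_enorm nu *: (delta_mx ord0 ord0 : 'cV[R]_n.+1).
Proof.
move=> nu0.
have N0 : fc_enorm nu != 0.
  apply: contra nu0 => /eqP N0; apply/eqP/rowP => i; rewrite mxE.
  by apply/eqP; rewrite -normr_le0 -N0 enorm_coord.
pose h := (fc_enorm nu)^-1 *: nu.
pose e : 'rV[R]_n.+1 := delta_mx ord0 ord0.
have nuh : nu = fc_enorm nu *: h by rewrite /h scalerA divff// scale1r.
have hh : h *m h^T = 1%:M.
  rewrite [LHS]mx11_scalar -sqr_enorm_mul /h enormZ exprMn real_normK ?num_real//.
  by rewrite -exprMn mulVf// expr1n.
have et : (delta_mx ord0 ord0 : 'cV[R]_n.+1) = e^T by rewrite trmx_delta.
have ee : e *m e^T = 1%:M.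
  rewrite trmx_delta mul_delta_mx [LHS]mx11_scalar mxE !eqxx.
  by [].
suff [S S1 S2] : exists2 S : 'M[R]_n.+1, S *m S^T = 1%:M & S *m h^T = e^T.
  by exists S => //; rewrite nuh linearZ/= -scalemxAr S2 et -nuh.
have [->|he] := eqVneq h e.
  by exists 1%:M; rewrite ?trmx1 ?mulmx1 ?mul1mx.
pose x := h - e.
pose h0 := h ord0 ord0.
have he0 : h *m e^T = h0%:M.
  rewrite [LHS]mx11_scalar; congr (_%:M); rewrite trmx_delta -colE; exact: mxE.
have eh0 : e *m h^T = h0%:M by rewrite -[LHS]trmxK trmx_mul trmxK he0 tr_scalar_mx.
(* This is |h - e|^2, both vectors having norm 1. *)
pose c := 2 - 2 * h0.
have xx : x *m x^T = c%:M.
  rewrite /x linearB/= mulmxBl !mulmxBr hh ee he0 eh0 -!raddfB/=; congr (_%:M).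
  by rewrite /c; ring.
have xh : x *m h^T = (1 - h0)%:M by rewrite /x mulmxBl hh eh0 -raddfB.
have c0 : c != 0.
  apply: contra he => /eqP c0; rewrite -subr_eq0 -/x; apply/eqP/rowP => i; rewrite [RHS]mxE.
  apply/eqP; rewrite -normr_le0 (le_trans (enorm_coord _ _))//.
  have : fc_enorm x ^+ 2 = 0 by rewrite sqr_enorm_mul xx c0 mxE mul0rn.
  by move/eqP; rewrite expf_eq0 => /eqP->.
have [P [Pt PP Ph]] : exists P : 'M[R]_n.+1,
    [/\ P^T = P, P *m P = c *: P & P *m h^T = (1 - h0) *: x^T].
  exists (x^T *m x); split; first by rewrite trmx_mul trmxK.
    by rewrite mulmxA -(mulmxA x^T) xx mul_mx_scalar -scalemxAl.
  by rewrite -mulmxA xh mul_mx_scalar.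
exists (1%:M - (2 / c) *: P).
  have -> : (1%:M - (2 / c) *: P)^T = 1%:M - (2 / c) *: P.
    by rewrite linearB/= trmx1 linearZ/= Pt.
  rewrite mulmxBl mul1mx mulmxBr mulmx1.
  rewrite -scalemxAl -scalemxAr PP !scalerA (_ : 2 / c * (2 / c) * c = 2 / c + 2 / c); last by field.
  by rewrite scalerDl opprB addrK subrK.
rewrite mulmxBl mul1mx -scalemxAl Ph scalerA.
rewrite (_ : 2 / c * (1 - h0) = 1); last by rewrite /c; field; rewrite -/c.
by rewrite scale1r /x linearB/= opprB addrC subrK.
Qed.

Lemma qform_mul n (A : 'M[R]_n) v : qform A v = (v *m A *m v^T) ord0 ord0.
Proof.
rewrite mxE /qform exchange_big/=; apply: eq_bigr => j _; rewrite mxE mxE mulr_suml.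
by apply: eq_bigr => i _; ring.
Qed.

Lemma qformZ n (a c : R) (A : 'M[R]_n) v : qform (a *: A) (c *: v) = a * c ^+ 2 * qform A v.
Proof.
rewrite /qform mulr_sumr; apply: eq_bigr => i _; rewrite mulr_sumr.
by apply: eq_bigr => j _; rewrite !mxE; ring.
Qed.

Lemma orth_entry n (S : 'M[R]_n) i j : S *m S^T = 1%:M -> `|S i j| <= 1.
Proof.
move=> /matrixP/(_ i i); rewrite !mxE eqxx => h; apply: abs_le_sq => //.
rewrite expr1n -[leRHS]h (bigD1 j)//= mxE expr2 lerDl sumr_ge0// => k _.
by rewrite mxE -expr2 sqr_ge0.
Qed.

(** The trace of A on the hyperplane orthogonal to nu, divided by |nu|: the mean curvature of a
    level set with gradient nu and Hessian A, as [mean_curvE] shows. *)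
Definition tilted_trace n (nu : 'rV[R]_n) (A : 'M[R]_n) : R :=
  (\tr A - qform A nu / fc_enorm nu ^+ 2) / fc_enorm nu.

(** An orthogonal matrix takes nu to a multiple of the first axis, and dividing [psi] by |nu| keeps
    its sign and normalises its gradient. The lower bound [c] on |nu| keeps the rescaled Hessian and
    remainder under control, uniformly in nu. *)
Lemma tilted_integral n (K c eps : R) : 0 <= K -> 0 < c -> 0 < eps ->
  exists2 eta : R, 0 < eta & forall (u e : R) (nu : 'rV[R]_n.+1) (A : 'M[R]_n.+1)
      (psi sigma : 'rV[R]_n.+1 -> R),
    0 < u < eta -> 0 <= e < eta -> (forall i j, `|A i j| <= K) -> c <= fc_enorm nu ->
    measurable_fun setT sigma ->
    (forall z, fc_enorm z <= u ->
      `|psi z - (\sum_i nu ord0 i * z ord0 i + qform A z / 2)| <= e * fc_enorm z ^+ 2) ->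
    (forall z, fc_enorm z <= u -> sigma z = sgn1 (psi z)) ->
    `|\int[lam R n.+1]_z (sigma z * \1_(eball u) z) -
      tilted_trace nu A * (vball R n * u ^+ n.+2 / n.+2%:R)| <= eps * u ^+ n.+2.
Proof.
move=> K0 c0 eps0.
(* An entry of S A S^T is a sum of (n+1)^2 terms of size at most K, the entries of S being at most
   1; then comes the division by |nu| >= c. *)
pose K' := K * n.+1%:R ^+ 2 / c.
have K'0 : 0 <= K' by rewrite divr_ge0 ?(ltW c0)// mulr_ge0// exprn_ge0.
have [eta eta0 hG] := graph_integral n K'0 eps0.
exists (Num.min eta (c * eta)); first by rewrite lt_min eta0 mulr_gt0.
move=> u e nu A psi sigma; rewrite !lt_min => /andP[u0 /andP[ueta _]].
move=> /andP[e0 /andP[_ eceta]] AK nuc ms hpsi hs.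
set N := fc_enorm nu in nuc *.
have N0 : 0 < N by exact: lt_le_trans nuc.
have nu0 : nu != 0 by apply: contraTN N0 => /eqP nu0; rewrite /N nu0 enorm0 ltxx.
have [S SS Snu] := householder nu0.
have SS' := mulmx1C SS.
pose B := S *m A *m S^T.
have qB v : qform A (v *m S) = qform B v.
  by rewrite !qform_mul trmx_mul /B !mulmxA.
have hB i j : `|B i j| <= K * n.+1%:R ^+ 2.
  rewrite mxE; apply: (le_trans (ler_norm_sum _ _ _)).
  apply: (@le_trans _ _ (\sum_(l < n.+1) K * n.+1%:R)).
    apply: ler_sum => l _; rewrite normrM -[leRHS]mulr1; apply: ler_pM => //; last first.
      by rewrite mxE orth_entry.
    rewrite mxE; apply: (le_trans (ler_norm_sum _ _ _)).
    apply: (@le_trans _ _ (\sum_(k < n.+1) K)).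
      apply: ler_sum => k _; rewrite normrM -[leRHS]mul1r; apply: ler_pM => //.
      exact: orth_entry.
    by rewrite sumr_const card_ord mulr_natr.
  by rewrite sumr_const card_ord -[_ *+ n.+1]mulr_natr expr2 mulrA.
have linS v : \sum_i nu ord0 i * (v *m S) ord0 i = N * v ord0 ord0.
  transitivity ((v *m (S *m nu^T)) ord0 ord0).
    rewrite mulmxA mxE; apply: eq_bigr => i _; rewrite [nu^T _ _]mxE; exact: mulrC.
  rewrite Snu -scalemxAr mxE; congr (_ * _).
  by rewrite -colE mxE.
have <- : \int[lam R n.+1]_z (sigma (z *m S) * \1_(eball u) z) =
          \int[lam R n.+1]_z (sigma z * \1_(eball u) z).
  rewrite -(@Rintegral_orth R n.+1 S (fun z => sigma z * \1_(eball u) z) SS).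
    by apply: eq_Rintegral => z _; rewrite !indicE !mem_eball enorm_orth.
  by apply: measurable_funM => //; apply: measurable_indic; exact: measurable_eball.
(* Conjugation preserves the trace, and the corner entry of B is the form A at the unit normal nu /
   |nu|. *)
have -> : tilted_trace nu A = \tr (N^-1 *: B) - (N^-1 *: B) ord0 ord0.
  have rowS : (delta_mx ord0 ord0 : 'rV[R]_n.+1) *m S = N^-1 *: nu.
    have : nu *m S^T = N *: delta_mx ord0 ord0.
      by rewrite -[LHS]trmxK trmx_mul !trmxK Snu linearZ/= trmx_delta.
    move/(congr1 (fun M => N^-1 *: (M *m S))).
    rewrite -mulmxA SS' mulmx1 -scalemxAl scalerA mulVf ?gt_eqF// scale1r => <-.
    by [].
  have B00 : B ord0 ord0 = qform A nu / N ^+ 2.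
    transitivity (qform B (delta_mx ord0 ord0)).
      rewrite qform_mul trmx_delta -rowE -colE !mxE.
      by [].
    rewrite -qB rowS -[A in LHS]scale1r qformZ mul1r exprVn mulrC.
    by [].
  rewrite mxtraceZ [in RHS]mxE B00 /tilted_trace -/N.
  have -> : \tr B = \tr A by rewrite /B mxtrace_mulC mulmxA SS' mul1mx.
  by rewrite mulrBl ![_ / N]mulrC.
apply: (hG u (e / N) _ (fun z => psi (z *m S) / N) (fun z => sigma (z *m S))).
- by rewrite u0.
- rewrite divr_ge0 ?(ltW N0)//= ltr_pdivrMr// (lt_le_trans eceta)// mulrC.
  by rewrite ler_wpM2l// ltW.
- move=> i j; rewrite mxE normrM normfV (gtr0_norm N0) mulrC /K'.
  by rewrite ler_pM ?lef_pV2 ?posrE ?invr_ge0 ?(ltW N0).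
- exact: (measurableT_comp ms (measurable_mulmx S)).
- move=> z zu.
  have := hpsi (z *m S); rewrite enorm_orth// => /(_ zu).
  rewrite linS qB => h.
  have -> : psi (z *m S) / N - (z ord0 ord0 + qform (N^-1 *: B) z / 2) =
    (psi (z *m S) - (N * z ord0 ord0 + qform B z / 2)) / N.
    rewrite -[z in qform (N^-1 *: B) z]scale1r qformZ; field; by rewrite gt_eqF.
  by rewrite normrM normfV (gtr0_norm N0) mulrAC ler_pM2r ?invr_gt0.
- move=> z zu; rewrite hs ?enorm_orth// /sgn1.
  by rewrite pmulr_lle0 ?invr_gt0.
Qed.
End Tilted.

(** * Superposition of balls *)

Section Kernel.
Variable R : realType.

(* For [p = n + s], the density of the superposition of balls [eball t] that makes up
   the kernel truncated at [a]. *)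
Definition tailw (p a t : R) : R := if a <= t then p * t `^ (- p - 1) else 0.

Lemma measurable_tailw p a : measurable_fun setT (tailw p a).
Proof.
apply: measurable_fun_ifT => //; first exact: measurable_fun_ler.
by apply: measurable_funM => //; exact: measurable_powR.
Qed.

Lemma tailw_ge0 p a t : 0 < p -> 0 <= tailw p a t.
Proof.
by move=> p0; rewrite /tailw; case: ifP => // _; rewrite mulr_ge0 ?powR_ge0// ltW.
Qed.

Lemma integral_tailw p a : 0 < p -> 0 < a ->
  (\int[lebR R]_t (tailw p a t)%:E = (a `^ (- p))%:E)%E.
Proof.
move=> p0 a0; rewrite -integral_powRN// [RHS]integral_mkcond.
apply: eq_integral => t _; rewrite patchE mem_setE in_itv/= andbT /tailw.
by case: ifP.
Qed.

Lemma integrable_tailw p a : 0 < p -> 0 < a ->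
  (lebR R).-integrable setT (EFin \o tailw p a).
Proof.
move=> p0 a0; apply/integrableP; split.
  by apply/measurable_EFinP; exact: measurable_tailw.
rewrite (_ : (fun _ => _) = fun t => (tailw p a t)%:E) ?integral_tailw ?ltry//.
by apply/funext => t /=; rewrite ger0_norm// tailw_ge0.
Qed.

Lemma Rintegral_tailw p a : 0 < p -> 0 < a -> \int[lebR R]_t tailw p a t = a `^ (- p).
Proof. by move=> p0 a0; rewrite /Rintegral integral_tailw. Qed.

Lemma fc_kkerE d (r s t : R) : fc_kker d r s t = (Num.max r t) `^ (- (d%:R + s)).
Proof.
rewrite /fc_kker; case: ifPn => tr; first by rewrite max_l.
by rewrite max_r// ltW// ltNge.
Qed.

(** The integral of t^(-s) over [r, 1], the part of [fc_beta] that tends to infinity. *)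
Definition fc_A (r s : R) := (r `^ (1 - s) - 1) / (s - 1).

Lemma powR_exprn (t p : R) k : 0 < t -> t `^ p * t ^+ k = t `^ (p + k%:R).
Proof.
move=> t0; rewrite -powR_mulrn ?(ltW t0)// -powRD//.
by apply/implyP => _; rewrite gt_eqF.
Qed.

(** After [layer_cake], the function to compare with is c0 (n + s) t^(-s) on [r, 1], whatever delta
    is. For t < delta the hypothesis on M yields the eps term. For t >= delta both M, bounded by |B|
    t^n, and the comparison term lie under a multiple of t^(-s-1), whose integral from delta on is a
    multiple of delta^(-s). *)
Lemma kernel_estimate n (sigma : 'rV[R]_n -> R) (r s c0 eps delta : R)
    (M := fun u => \int[lam R n]_z (sigma z * \1_(eball u) z)) :
  measurable_fun setT sigma -> (forall z, `|sigma z| <= 1) ->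
  0 < r < 1 -> 1 < s -> 0 <= eps -> 0 < delta <= 1 ->
  (forall u, 0 < u < delta -> `|M u - c0 * u ^+ n.+1| <= eps * u ^+ n.+1) ->
  (lam R n).-integrable setT (EFin \o (fun z => sigma z * fc_kker n r s (fc_enorm z))) /\
  `|\int[lam R n]_z (sigma z * fc_kker n r s (fc_enorm z)) -
    c0 * ((n%:R + s) * fc_A r s)| <=
  eps * ((n%:R + s) * fc_A r s) + (`|c0| + vball R n) * ((n%:R + s) / s) * delta `^ (- s).
Proof.
move=> ms s1' /andP[r0 r1] s1 eps0 /andP[d0 d1] hM.
have s0 : 0 < s by exact: lt_trans s1.
pose p := n%:R + s.
have p0 : 0 < p by rewrite ltr_wpDl.
have w0 t : 0 <= tailw p r t by exact: tailw_ge0.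
have wz t : t <= 0 -> tailw p r t = 0.
  by move=> t0; rewrite /tailw lt_geF// (le_lt_trans t0).
have wn t : tailw p r t * t ^+ n = p / s * tailw s r t.
  rewrite /tailw; case: ifP => rt; last by rewrite mulr0 mul0r.
  rewrite -mulrA powR_exprn ?(lt_le_trans r0)//.
  rewrite (_ : - p - 1 + n%:R = - s - 1); last by rewrite /p; ring.
  by rewrite mulrA divfK// gt_eqF.
have ps0 : 0 <= p / s by rewrite divr_ge0// ltW.
have wfin : (\int[lebR R]_t (tailw p r t * t ^+ n)%:E < +oo)%E.
  under eq_integral do rewrite wn EFinM.
  rewrite ge0_integralZl_EFin//.
  - by rewrite integral_tailw// -EFinM ltry.
  - by move=> t _; rewrite lee_fin tailw_ge0.
  - by apply/measurable_EFinP; exact: measurable_tailw.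
have WK (v : 'rV[R]_n) : (\int[lebR R]_t (tailw p r t * (fc_enorm v <= t)%R%:R)%:E =
    (fc_kker n r s (fc_enorm v))%:E)%E.
  rewrite fc_kkerE -/p -integral_tailw//; last by rewrite lt_max r0.
  apply: eq_integral => t _; rewrite /tailw ge_max.
  by case: (r <= t) => /=; case: (_ <= t); rewrite /= ?mulr1 ?mulr0 ?mul0r.
have [i1 i2 ->] := @layer_cake R n sigma (fun v => fc_kker n r s (fc_enorm v))
  _ ms s1' (measurable_tailw p r) w0 wz wfin WK.
split => //.
(* This is t^(-s) on [r, 1) and 0 elsewhere, written as a difference of two tails so that its
   integral follows from [Rintegral_tailw]. *)
pose g t := (tailw (s - 1) r t - tailw (s - 1) 1 t) / (s - 1).
have s10 : 0 < s - 1 by rewrite subr_gt0.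
have gE t : g t = if r <= t < 1 then t `^ (- s) else 0.
  rewrite /g /tailw; have [rt|rt] /= := leP r t; last first.
    by rewrite (lt_geF (lt_trans rt r1)) subrr mul0r.
  have [t1|t1] := ltP t 1; last by rewrite subrr mul0r.
  rewrite subr0 (_ : - (s - 1) - 1 = - s); last by ring.
  by rewrite mulrAC divff ?mul1r// gt_eqF.
have gi : (lebR R).-integrable setT (EFin \o g).
  have := integrableB measurableT (integrable_tailw s10 r0) (integrable_tailw s10 ltr01).
  move=> /(integrableZl measurableT (s - 1)^-1).
  by congr (integrable _ _ _); apply/funext => t /=; rewrite /g -EFinB -EFinM mulrC.
have gI : \int[lebR R]_t g t = fc_A r s.
  rewrite /g /fc_A.
  under eq_Rintegral do rewrite mulrC.
  rewrite RintegralZl//; last first.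
    exact: (integrableB measurableT (integrable_tailw s10 r0) (integrable_tailw s10 ltr01)).
  rewrite RintegralB//; [|exact: integrable_tailw..].
  by rewrite !Rintegral_tailw// powR1 opprB mulrC.
set C := `|c0| + vball R n.
have C0 : 0 <= C by rewrite addr_ge0// ltW// vball_gt0.
have Mb t : 0 < t -> `|M t| <= vball R n * t ^+ n.
  move=> t0; rewrite mulrC -Rintegral_eball//.
  apply: (le_trans (le_normr_Rintegral _ _)) => //.
    by apply: (@integrable_on_eball _ _ _ 1).
  apply: le_Rintegral => //; last 2 first.
  - exact: eball_integrable.
  - by move=> z _; rewrite normrM (ger0_norm (x := \1_ _ _))// ler_piMl.
  have := @integrable_on_eball R n t 1 sigma ms (fun v _ => s1' v).
  exact: integrable_norm.
have pw t : `|tailw p r t * M t - c0 * p * g t| <=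
    eps * p * g t + C * (p / s) * tailw s delta t.
  rewrite gE.
  have tw0 : 0 <= C * (p / s) * tailw s delta t by rewrite mulr_ge0 ?tailw_ge0// mulr_ge0.
  have [rt|rt] /= := leP r t; last first.
    by rewrite /tailw (lt_geF rt) mul0r !mulr0 subrr normr0 add0r.
  have t0 := lt_le_trans r0 rt.
  have wt : tailw p r t = p * t `^ (- p - 1) by rewrite /tailw rt.
  have wtn1 : tailw p r t * t ^+ n.+1 = p * t `^ (- s).
    rewrite wt -mulrA powR_exprn// -natr1; congr (_ * _ `^ _); by rewrite /p; ring.
  have wM : tailw p r t * `|M t| <= p / s * tailw s r t * vball R n.
    by rewrite -wn -mulrA ler_wpM2l// mulrC Mb.
  have sd : delta <= t -> tailw s r t = tailw s delta t by move=> dt; rewrite /tailw rt dt.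
  have [t1|t1] := ltP t 1; last first.
    have dt : delta <= t := le_trans d1 t1.
    rewrite !mulr0 subr0 add0r normrM (ger0_norm (w0 _)) (le_trans wM)//.
    rewrite sd// mulrC mulrA ler_wpM2r ?tailw_ge0// ler_wpM2r//.
    by rewrite lerDr.
  have ts0 := powR_ge0 t (- s).
  have [td|td] := ltP t delta.
    rewrite (_ : _ - _ = tailw p r t * (M t - c0 * t ^+ n.+1)); last first.
      by rewrite mulrBr -[c0 * p * _]mulrA -wtn1; ring.
    rewrite normrM (ger0_norm (w0 _)).
    apply: (@le_trans _ _ (tailw p r t * (eps * t ^+ n.+1))).
      by rewrite ler_wpM2l// hM// t0.
    by rewrite mulrCA wtn1 mulrA lerDl.
  apply: (le_trans (ler_normB _ _)).
  rewrite normrM (ger0_norm (w0 _)) -[leLHS]add0r; apply: lerD.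
    by rewrite mulr_ge0// mulr_ge0// ltW.
  rewrite (_ : C * _ * _ = `|c0| * (p / s) * tailw s delta t +
    p / s * tailw s delta t * vball R n); last by rewrite /C; ring.
  rewrite addrC; apply: lerD; last by rewrite (le_trans wM)// sd.
  rewrite !normrM (gtr0_norm p0) (ger0_norm ts0) -!mulrA ler_wpM2l// ler_wpM2l ?(ltW p0)//.
  rewrite -sd// /tailw rt mulrA mulVf ?gt_eqF// mul1r.
  (* As t < 1, t^(-s) is at most t^(-s-1), which puts the comparison term under the tail. *)
  have -> : t `^ (- s) = t * t `^ (- s - 1).
    rewrite mulrC -[t in X in _ = _ * X]expr1 powR_exprn//; congr (_ `^ _); ring.
  by rewrite ler_piMl ?powR_ge0// ltW.
have gi' c : (lebR R).-integrable setT (EFin \o (fun t => c * g t)).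
  exact: (integrableZl measurableT c gi).
have ti : (lebR R).-integrable setT (EFin \o (fun t => C * (p / s) * tailw s delta t)).
  exact: (integrableZl measurableT _ (integrable_tailw s0 d0)).
have -> : c0 * ((n%:R + s) * fc_A r s) = \int[lebR R]_t (c0 * p * g t).
  by rewrite RintegralZl// gI mulrA.
rewrite -RintegralB//.
apply: (le_trans (le_normr_Rintegral _ _)) => //.
  exact: (integrableB measurableT i2 (gi' _)).
apply: (@le_trans _ _ (\int[lebR R]_t (eps * p * g t + C * (p / s) * tailw s delta t))).
  apply: le_Rintegral => //.
  - exact: (integrable_norm (integrableB measurableT i2 (gi' _))).
  - exact: (integrableD measurableT (gi' _) ti).
rewrite RintegralD// !RintegralZl//; last exact: integrable_tailw.
by rewrite gI Rintegral_tailw// mulrA.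
Qed.

End Kernel.

(** * Taylor expansions of perturbed defining functions *)

Section Taylor.
Variable R : realType.

Lemma mean_value_le (g dg : R -> R) (a h eta : R) :
  (forall t : R, is_derive t (1 : R) g (dg t)) ->
  (forall t, `|t| <= `|h| -> `|dg t - a| <= eta) ->
  `|g h - g 0 - a * h| <= eta * `|h|.
Proof.
move=> dg1 bd.
have cg : continuous g.
  by move=> t; apply: differentiable_continuous; apply/derivable1_diffP; exact: ex_derive.
have key x y : x <= y -> `|x| <= `|h| -> `|y| <= `|h| ->
    `|g y - g x - a * (y - x)| <= eta * (y - x).
  move=> xy xh yh.
  have [c cxy e] := @MVT_segment R g dg x y xy (fun t _ => dg1 t) (continuous_subspaceT cg).
  rewrite e -mulrBl normrM (ger0_norm (x := y - x)) ?subr_ge0//.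
  rewrite ler_wpM2r ?subr_ge0// bd//.
  move: cxy xh yh; rewrite in_itv/= !ler_norml => /andP[c1 c2] /andP[x1 x2] /andP[y1 y2].
  by rewrite (le_trans x1 c1) (le_trans c2 y2).
have [h0|h0] := leP 0 h.
  have := key _ _ h0; rewrite !subr0 normr0 => /(_ (normr_ge0 _) (lexx _)).
  by rewrite (ger0_norm h0).
have := key _ _ (ltW h0); rewrite normr0 => /(_ (lexx _) (normr_ge0 _)).
rewrite sub0r (ltr0_norm h0) => k.
by rewrite (_ : g h - g 0 - a * h = - (g 0 - g h - a * - h)) ?normrN//; ring.
Qed.

Lemma is_derive_line d (f : 'rV[R]_d -> R) (x v : 'rV[R]_d) (t : R) :
  derivable f (x + t *: v) v ->
  is_derive t (1 : R) (fun t : R => f (x + t *: v)) ('D_v f (x + t *: v)).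
Proof.
move=> df.
have E : (fun h : R => h^-1 *: (((fun t : R => f (x + t *: v)) \o shift t) (h *: (1 : R))
              - f (x + t *: v))) =
  (fun h : R => h^-1 *: ((f \o shift (x + t *: v)) (h *: v) - f (x + t *: v))).
  apply/funext => h /=; congr (_ *: (f _ - _)).
  by rewrite scalerDl [h *: (1 : R)]mulr1 addrCA.
by split; [rewrite /derivable E|rewrite /derive E].
Qed.

(** [fc_C1] gives derivatives along the axes only, so p is moved to p + h one coordinate at a time
    and the mean value theorem is applied on each edge. All edges stay in the box spanned by h,
    where the bound is assumed. *)
Lemma coord_mean_value d (f : 'rV[R]_d -> R) (p h a : 'rV[R]_d) (eta : R) :
  (forall i x, derivable f x (fc_evec R i)) ->
  (forall i (y : 'rV[R]_d), (forall j, `|y ord0 j - p ord0 j| <= `|h ord0 j|) ->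
     `|fc_pd f i y - a ord0 i| <= eta) ->
  `|f (p + h) - f p - \sum_i a ord0 i * h ord0 i| <= eta * \sum_i `|h ord0 i|.
Proof.
move=> df bd.
pose x k : 'rV[R]_d := \row_j (p ord0 j + (if (j < k)%N then h ord0 j else 0)).
have step (k : nat) (i : 'I_d) : i = k :> nat -> x k.+1 = x k + h ord0 i *: fc_evec R i.
  move=> ik; apply/rowP => j; rewrite !mxE eqxx/=.
  rewrite ltnS leq_eqVlt -ik val_eqE eq_sym.
  have [->|ij] := eqVneq i j; first by rewrite ltnn mulr1 addr0.
  by rewrite mulr0 addr0.
have key k : (k <= d)%N ->
    `|f (x k) - f p - \sum_(i < d | (i < k)%N) a ord0 i * h ord0 i| <=
    eta * \sum_(i < d | (i < k)%N) `|h ord0 i|.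
  elim: k => [_|k IH kd].
    rewrite !big_pred0 // (_ : x 0 = p) ?subrr ?subr0 ?mulr0 ?normr0//.
    by apply/rowP => j; rewrite mxE addr0.
  pose i := Ordinal kd.
  have big (F : 'I_d -> R) : \sum_(j < d | (j < k.+1)%N) F j =
      \sum_(j < d | (j < k)%N) F j + F i.
    rewrite (bigD1 i)//= addrC; congr (_ + _); apply: eq_bigl => j.
    by rewrite ltnS -val_eqE/= ltn_neqAle andbC.
  rewrite !big (step k i)// mulrDr.
  pose g t := f (x k + t *: fc_evec R i).
  have gk : `|g (h ord0 i) - g 0 - a ord0 i * h ord0 i| <= eta * `|h ord0 i|.
    apply: (@mean_value_le g (fun t => fc_pd f i (x k + t *: fc_evec R i))).
      by move=> t; apply: is_derive_line.
    move=> t th; apply: bd => j; rewrite !mxE eqxx/=.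
    rewrite (_ : _ + _ + _ - _ = (if (j < k)%N then h ord0 j else 0) + t * (j == i)%:R);
      last by ring.
    have [ji|ji] := eqVneq j i; first by rewrite ji ltnn add0r mulr1.
    by rewrite mulr0 addr0; case: ifP => // _; rewrite normr0.
  rewrite -[f (x k + _)]/(g _) opprD.
  have g0 : g 0 = f (x k) by rewrite /g scale0r addr0.
  rewrite (_ : _ + _ = (f (x k) - f p - \sum_(j < d | (j < k)%N) a ord0 j * h ord0 j) +
     (g (h ord0 i) - g 0 - a ord0 i * h ord0 i)); last by rewrite g0; ring.
  by rewrite (le_trans (ler_normD _ _))// lerD// IH// ltnW.
have := key d (leqnn d).
have big (F : 'I_d -> R) : \sum_(j < d | (j < d)%N) F j = \sum_j F j.
  by apply: eq_bigl => j; rewrite ltn_ord.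
rewrite !big (_ : x d = p + h)//; apply/rowP => j.
by rewrite !mxE ltn_ord.
Qed.

Lemma near_box d (x : 'rV[R]_d) (P : set 'rV[R]_d) : (\forall y \near x, P y) ->
  exists2 r : R, 0 < r & forall y : 'rV[R]_d, (forall j, `|y ord0 j - x ord0 j| < r) -> P y.
Proof.
move=> /nbhs_ballP[r /= r0 rP]; exists r => // y yx; apply: rP; split => // i j.
by rewrite ord1 /ball/= distrC.
Qed.

(** The classical passage from continuous partial derivatives to a derivative in every direction. *)
Lemma C1_is_derive_line d (f : 'rV[R]_d -> R) (p h : 'rV[R]_d) (t : R) : fc_C1 f ->
  is_derive t (1 : R) (fun t : R => f (p + t *: h))
    (\sum_i fc_pd f i (p + t *: h) * h ord0 i).
Proof.
move=> [_ [df cf]].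
set y := p + t *: h; set L := \sum_i _.
pose H := \sum_i `|h ord0 i|.
have H0 : 0 <= H by exact: sumr_ge0.
suff cv : (fun s : R => s^-1 *: (((fun t : R => f (p + t *: h)) \o shift t) (s *: (1 : R)) -
      f (p + t *: h))) @ 0^' --> L.
  by split; [apply/cvg_ex; exists L|exact: cvg_lim cv].
apply/cvgrPdist_le => /= e e0.
(* The 1 added to H covers the direction h = 0. *)
have e10 : 0 < e / (H + 1) by rewrite divr_gt0// ltr_wpDl.
have nb i : \forall z \near y, `|fc_pd f i z - fc_pd f i y| <= e / (H + 1).
  by have /cvgrPdist_le/(_ _ e10) := cf i y; apply: filterS => z; rewrite distrC.
have [r r0 rP] := near_box (filter_forall _ nb).
have rH : 0 < r / (H + 1) by rewrite divr_gt0// ltr_wpDl.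
near=> s.
have s0 : s != 0 by near: s; exact: nbhs_dnbhs_neq.
have sH : `|s| * (H + 1) < r.
  rewrite -ltr_pdivlMr ?ltr_wpDl//.
  by near: s; apply: dnbhs0_lt.
have hH j : `|h ord0 j| <= H by rewrite /H (bigD1 j)//= lerDl sumr_ge0.
have := @coord_mean_value d f y (s *: h) (\row_i fc_pd f i y) (e / (H + 1)) df.
have bx i (z : 'rV[R]_d) : (forall j, `|z ord0 j - y ord0 j| <= `|(s *: h) ord0 j|) ->
    `|fc_pd f i z - (\row_i0 fc_pd f i0 y) ord0 i| <= e / (H + 1).
  move=> zy; rewrite mxE; apply: rP => j; apply: le_lt_trans sH.
  by rewrite (le_trans (zy j))// mxE normrM ler_wpM2l// (le_trans (hH j))// lerDl.
move=> /(_ bx).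
have -> : \sum_i (\row_i0 fc_pd f i0 y) ord0 i * (s *: h) ord0 i = s * L.
  by rewrite mulr_sumr; apply: eq_bigr => i _; rewrite !mxE; ring.
have -> : \sum_i `|(s *: h) ord0 i| = `|s| * H.
  by rewrite mulr_sumr; apply: eq_bigr => i _; rewrite mxE normrM.
move=> k.
rewrite -normrN opprB /= [s *: (1 : R)]mulr1 scalerDl addrCA -/y.
rewrite [X in f X](_ : _ = y + s *: h); last by rewrite addrC.
rewrite (_ : _ - L = s^-1 * (f (y + s *: h) - f y - s * L)); last first.
  by rewrite /GRing.scale/=; field.
rewrite normrM normfV ler_pdivrMl ?normr_gt0//.
apply: (le_trans k); rewrite mulrCA ler_wpM2l// mulrAC ler_pdivrMr ?ltr_wpDl//.
by rewrite ler_pM2l// lerDl.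
Unshelve. all: by end_near. Qed.

(** [A] is any matrix close to the second derivatives on the box, not the Hessian at p. In
    [diffeo_expansion] it is the Hessian at x while p varies with n, and the zero matrix for the
    components of Phi_n - id. The mean value theorem on [0, 1] is applied to f minus its quadratic
    model along the segment, whose derivative is estimated by applying [coord_mean_value] to each
    partial derivative. *)
Lemma taylor2 d (f : 'rV[R]_d -> R) (p h : 'rV[R]_d) (A : 'I_d -> 'I_d -> R) (eta : R) :
  0 <= eta -> fc_C1 f -> (forall i j x, derivable (fc_pd f i) x (fc_evec R j)) ->
  (forall i j (y : 'rV[R]_d), (forall k, `|y ord0 k - p ord0 k| <= `|h ord0 k|) ->
     `|fc_pd (fc_pd f i) j y - A i j| <= eta) ->
  `|f (p + h) - f p - \sum_i fc_pd f i p * h ord0 i -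
      (\sum_i \sum_j A i j * (h ord0 i * h ord0 j)) / 2| <= eta * (\sum_i `|h ord0 i|) ^+ 2.
Proof.
move=> eta0 C1f ddf bd.
set L := \sum_i fc_pd f i p * _; set q := \sum_i \sum_j _; set H := \sum_i `|_|.
have H0 : 0 <= H by exact: sumr_ge0.
pose G t := f (p + t *: h) - t * L - t ^+ 2 * (q / 2).
pose dG t := (\sum_i fc_pd f i (p + t *: h) * h ord0 i) - L - t * q.
have GD t : is_derive t (1 : R) G (dG t).
  have D1 := C1_is_derive_line p h t C1f.
  have -> : G = ((fun t : R => f (p + t *: h)) - (fun t : R => t * L)) - (fun t : R => t ^+ 2 * (q / 2)).
    by apply/funext.
  apply: is_derive_eq.
  by rewrite /dG /GRing.scale/=; field.
have := @mean_value_le G dG 0 1 (eta * H ^+ 2) GD.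
rewrite /G !normr1 scale1r scale0r !mul1r !mul0r !expr1n expr0n/= !mul0r !mul1r addr0 !subr0 mulr1.
rewrite (_ : f (p + h) - L - q / 2 - f p = f (p + h) - f p - L - q / 2); last by ring.
apply => t t1; rewrite subr0.
have -> : dG t = \sum_i (fc_pd f i (p + t *: h) - fc_pd f i p -
    \sum_j A i j * (t * h ord0 j)) * h ord0 i.
  rewrite /dG /L /q mulr_sumr -!sumrB; apply: eq_bigr => i _.
  rewrite !mulrBl mulr_suml mulr_sumr; congr (_ - _).
  by apply: eq_bigr => j _; ring.
apply: (le_trans (ler_norm_sum _ _ _)); rewrite expr2 mulrA [leRHS]mulr_sumr.
apply: ler_sum => i _; rewrite normrM ler_wpM2r//.
have := @coord_mean_value d (fc_pd f i) p (t *: h) (\row_j A i j) eta (ddf i).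
have bx j (y : 'rV[R]_d) : (forall k, `|y ord0 k - p ord0 k| <= `|(t *: h) ord0 k|) ->
    `|fc_pd (fc_pd f i) j y - (\row_j0 A i j0) ord0 j| <= eta.
  move=> yp; rewrite mxE; apply: bd => k; rewrite (le_trans (yp k))//.
  by rewrite mxE normrM ler_piMl.
move=> /(_ bx).
have -> : \sum_i0 (\row_j A i j) ord0 i0 * (t *: h) ord0 i0 = \sum_j A i j * (t * h ord0 j).
  by apply: eq_bigr => j _; rewrite !mxE.
move=> /le_trans; apply; rewrite ler_wpM2l//.
by apply: ler_sum => j _; rewrite mxE normrM ler_piMl.
Qed.
End Taylor.

(** * Small perturbations of the identity *)

Section L1.
Variables (R : realType) (d : nat).

Definition l1norm (v : 'rV[R]_d) := \sum_i `|v ord0 i|.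

Lemma l1norm_ge0 v : 0 <= l1norm v. Proof. exact: sumr_ge0. Qed.

Lemma l1norm_coord (v : 'rV[R]_d) i : `|v ord0 i| <= l1norm v.
Proof. by rewrite /l1norm (bigD1 i)//= lerDl sumr_ge0. Qed.

Lemma l1norm_le_enorm (v : 'rV[R]_d) : l1norm v <= d%:R * fc_enorm v.
Proof.
apply: (@le_trans _ _ (\sum_(i < d) fc_enorm v)).
  by apply: ler_sum => i _; exact: enorm_coord.
by rewrite sumr_const card_ord mulr_natl.
Qed.

Lemma mulmx_coord_le (v : 'rV[R]_d) (G : 'M[R]_d) eta j : (forall i j, `|G i j| <= eta) ->
  `|(v *m G) ord0 j| <= eta * l1norm v.
Proof.
move=> Ge; rewrite mxE; apply: (le_trans (ler_norm_sum _ _ _)).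
rewrite mulr_sumr; apply: ler_sum => i _.
by rewrite normrM mulrC ler_wpM2r.
Qed.

(** Multiplication by G halves the l1 norm at least, since d eta <= 1/2; hence 1 + G has trivial
    kernel, and nu is controlled by b. *)
Lemma perturbation_solve (G : 'M[R]_d) (b : 'rV[R]_d) (eta : R) :
  (forall i j, `|G i j| <= eta) -> d%:R * eta <= 2^-1 ->
  exists nu : 'rV[R]_d, [/\ nu + nu *m G = b, l1norm nu <= 2 * l1norm b &
    forall j, `|nu ord0 j - b ord0 j| <= 2 * eta * l1norm b].
Proof.
move=> Ge de.
have G1 v : l1norm (v *m G) <= 2^-1 * l1norm v.
  apply: (@le_trans _ _ (d%:R * eta * l1norm v)); last first.
    by rewrite ler_wpM2r// l1norm_ge0.
  apply: (@le_trans _ _ (\sum_(i < d) eta * l1norm v)).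
    by apply: ler_sum => i _; exact: mulmx_coord_le.
  by rewrite sumr_const card_ord -mulrA mulr_natl.
have uG : 1%:M + G \in unitmx.
  rewrite -row_free_unit -kermx_eq0; apply/rowV0P => v /sub_kermxP.
  rewrite mulmxDr mulmx1 => /eqP; rewrite addr_eq0 => /eqP vG.
  have : l1norm v <= 2^-1 * l1norm v.
    rewrite {1}vG (le_trans _ (G1 v))// /l1norm le_eqVlt; apply/orP; left; apply/eqP.
    by apply: eq_bigr => i _; rewrite mxE normrN.
  have := l1norm_ge0 v => v0 v1.
  have {v0 v1} v0 : l1norm v = 0 by lra.
  by apply/rowP => i; apply/eqP; rewrite mxE -normr_le0 -v0 l1norm_coord.
pose nu := b *m invmx (1%:M + G).
have nuE : nu + nu *m G = b.
  by rewrite -[X in X + _]mulmx1 -mulmxDr /nu mulmxKV.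
clearbody nu.
have nub : l1norm nu <= 2 * l1norm b.
  have : l1norm nu <= l1norm b + l1norm (nu *m G).
    rewrite -big_split/=; apply: ler_sum => i _.
    rewrite -nuE; apply: (le_trans _ (ler_normB _ _)).
    by rewrite [X in _ <= `|X - _|]mxE addrK.
  have := G1 nu; lra.
exists nu; split=> // j.
rewrite (_ : _ - _ = - (nu *m G) ord0 j); last by rewrite -nuE mxE; ring.
rewrite normrN (le_trans (mulmx_coord_le _ _ Ge))//.
rewrite (_ : 2 * eta * _ = eta * (2 * l1norm b)); last by ring.
have [e0|e0] := leP 0 eta; first by rewrite ler_wpM2l.
have l0 v : l1norm v = 0.
  rewrite /l1norm big1// => i _; apply/eqP; rewrite -normr_le0 normr_id.
  by have := le_trans (normr_ge0 _) (Ge i j); rewrite leNgt e0.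
by rewrite !l0 !mulr0.
Qed.

Lemma qform_diff_le (A : 'M[R]_d) (h z : 'rV[R]_d) (KA e : R) :
  0 <= e -> (\sum_i \sum_j `|A i j| <= KA) -> (forall i, `|h ord0 i - z ord0 i| <= e) ->
  `|qform A h - qform A z| <= KA * (e * (l1norm h + l1norm z)).
Proof.
move=> e0 AK hz.
have l0 : 0 <= e * (l1norm h + l1norm z) by rewrite mulr_ge0// addr_ge0// l1norm_ge0.
apply: (@le_trans _ _ ((\sum_i \sum_j `|A i j|) * (e * (l1norm h + l1norm z)))); last first.
  by rewrite ler_wpM2r.
rewrite /qform -sumrB mulr_suml; apply: (le_trans (ler_norm_sum _ _ _)).
apply: ler_sum => i _; rewrite -sumrB mulr_suml; apply: (le_trans (ler_norm_sum _ _ _)).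
apply: ler_sum => j _; rewrite -mulrBr normrM ler_wpM2l//.
rewrite (_ : _ - _ = h ord0 i * (h ord0 j - z ord0 j) + (h ord0 i - z ord0 i) * z ord0 j);
  last by ring.
rewrite (le_trans (ler_normD _ _))// !normrM mulrDr; apply: lerD.
  by rewrite mulrC ler_pM// l1norm_coord.
by rewrite ler_pM// l1norm_coord.
Qed.

Lemma is_derive_coord (x v : 'rV[R]_d) j :
  is_derive x v (fun y : 'rV[R]_d => y ord0 j) (v ord0 j).
Proof.
suff cv : (fun h : R => h^-1 *: (((fun y : 'rV[R]_d => y ord0 j) \o shift x) (h *: v)
    - x ord0 j)) @ 0^' --> v ord0 j.
  by split; [apply/cvg_ex; exists (v ord0 j)|exact: cvg_lim cv].
apply: cvg_near_cst; near=> h.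
have h0 : h != 0 by near: h; exact: nbhs_dnbhs_neq.
by rewrite /= !mxE addrK /GRing.scale/= mulrA mulVf// mul1r.
Unshelve. all: by end_near. Qed.

Lemma coord_continuous_rV j : continuous (fun y : 'rV[R]_d => y ord0 j).
Proof. exact: coord_continuous. Qed.

Lemma pd_sub_coord (f : 'rV[R]_d -> R) j i : (forall i x, derivable f x (fc_evec R i)) ->
  fc_pd (fun y => f y - y ord0 j) i = fun x => fc_pd f i x - (i == j)%:R.
Proof.
move=> df; apply/funext => x; rewrite /fc_pd.
have dj := is_derive_coord x (fc_evec R i) j.
have dj' : derivable (fun y : 'rV[R]_d => y ord0 j) x (fc_evec R i) by exact: ex_derive.
rewrite [LHS](deriveB (df i x) dj').
by rewrite (@derive_val _ _ _ _ _ _ _ dj) mxE eqxx/= eq_sym.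
Qed.

Lemma C2_sub_coord (f : 'rV[R]_d -> R) j : fc_C2 f ->
  fc_C1 (fun y => f y - y ord0 j) /\
  (forall i k x, derivable (fc_pd (fun y => f y - y ord0 j) i) x (fc_evec R k)).
Proof.
move=> [[cf [df cpf]] C1pf].
have pE i := @pd_sub_coord f j i df.
split; [split; [|split]|] => [x|i x|i|i k x].
- exact: (continuousB (cf x) (@coord_continuous_rV j x)).
- have dj := is_derive_coord x (fc_evec R i) j.
  by apply: derivableB => //; exact: ex_derive.
- by rewrite pE => x; have cc := @cst_continuous 'rV[R]_d R (i == j)%:R x; exact: (continuousB (cpf i x) cc).
- by rewrite pE; apply: derivableB => //; have [_ [+ _]] := C1pf i; exact.
Qed.
End L1.

(** * Second-order expansion, uniform along the sequence *)

Section Expansion.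
Variables (R : realType) (d : nat).
Implicit Types (E : set 'rV[R]_d) (x : 'rV[R]_d).

Lemma closed_classC E : fc_classC E -> closed E.
Proof. by move=> [[U [_ ->]] _]; exact: closed_closure. Qed.

Lemma C2map_continuous (F : 'rV[R]_d -> 'rV[R]_d) : fc_C2map F -> continuous F.
Proof.
move=> F2 x.
apply/(@cvg_ballP _ _ _ _ (nbhs_filter x)) => e e0.
have nb j : \forall y \near x, `|F x ord0 j - F y ord0 j| < e.
  have [[cF _] _] := F2 j.
  by have /cvgrPdist_lt/(_ _ e0) := cF x.
have := filter_forall (nbhs_filter x) nb; apply: filterS => y yF.
by split=> // i j; rewrite ord1; exact: yF.
Qed.

(** A boundary point lies in the closed set E, so phi is at most 0 there; a negative value would
    persist nearby and make the point interior. *)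
Lemma defining_zero E x p (phi : 'rV[R]_d -> R) : closed E -> continuous phi ->
  (\forall y \near p, E y <-> phi y <= 0) -> fc_boundary E p -> phi p = 0.
Proof.
move=> cE cphi nE [clE niE].
have Ep : E p by rewrite ((closure_id E).1 cE).
have phip : phi p <= 0 by apply/(nbhs_singleton nE).
apply/eqP; rewrite eq_le phip /= leNgt; apply/negP => pn; apply: niE.
have : \forall y \near p, phi y < 0.
  have o0 : open [set r : R | r < 0] by exact: open_lt.
  exact: (cphi p _ (open_nbhs_nbhs (conj o0 pn))).
move=> nn; apply: filterS2 nE nn => y yE y0; apply/yE; exact: ltW.
Qed.

Lemma boundary_diffeo (F G : 'rV[R]_d -> 'rV[R]_d) E x : continuous G ->
  cancel F G -> cancel G F -> closed E -> closed (F @` E) ->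
  fc_boundary (F @` E) x -> fc_boundary E (G x).
Proof.
move=> cG FK GK cE cFE [clx nix].
have FE y : (F @` E) y <-> E (G y).
  by split => [[z Ez <-]|Ey]; [rewrite FK|exists (G y)].
split.
  by apply: subset_closure; apply/FE; rewrite ((closure_id _).1 cFE).
move=> iE; apply: nix.
have : nbhs x (G @^-1` E) by exact: (cG x E iE).
by apply: filterS => y /FE.
Qed.

(* [psi = phi \o Phi_n^-1 (x + _)]. Writing [h] for the displacement of the preimage
   [p] of [x] and [G] for the Jacobian of [Phi_n - id] at [p], one has [z = h + h G^T + O(|h|^2)],
   so the gradient of [psi] solves [nu + nu G = grad phi p]; the inverse
   diffeomorphism is never differentiated. *)
Lemma diffeo_expansion E (En : nat -> set 'rV[R]_d) (Phi : nat -> 'rV[R]_d -> 'rV[R]_d) x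
    (phi : 'rV[R]_d -> R) (eps : R) :
  closed E -> (forall n, closed (En n)) ->
  (forall n, fc_C2diffeo (Phi n)) -> fc_C2_to_id Phi -> (forall n, Phi n @` E = En n) ->
  (forall n, fc_boundary (En n) x) -> fc_local_defining E x phi -> 0 < eps ->
  exists2 delta : R, 0 < delta & \forall n \near \oo,
    exists nu : 'rV[R]_d, exists psi : 'rV[R]_d -> R,
      (forall j, `|nu ord0 j - fc_grad phi x ord0 j| <= eps) /\
      forall z : 'rV[R]_d, fc_enorm z <= delta ->
        `|psi z - (\sum_i nu ord0 i * z ord0 i +
           qform (\matrix_(i, j) fc_pd (fc_pd phi i) j x) z / 2)| <= eps * fc_enorm z ^+ 2 /\
        (En n (x + z) <-> psi z <= 0).
Proof.
move=> cE cEn diff toid imE bdn [phi2 nE] eps0.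
have [[cphi [dphi cpphi]] C1p] := phi2.
set A := \matrix_(i, j) fc_pd (fc_pd phi i) j x.
pose D : R := d%:R; have D0 : 0 <= D by [].
(* kap is the variation allowed to the derivatives of phi; the denominator makes both 4 kap D^2 and
   kap at most eps / 2. *)
pose kap := eps / (8 * D ^+ 2 + 2).
have den0 : 0 < 8 * D ^+ 2 + 2 by rewrite ltr_wpDl// mulr_ge0// exprn_ge0.
have kap0 : 0 < kap by rewrite divr_gt0.
have kapE : kap * (8 * D ^+ 2 + 2) = eps by rewrite /kap divfK// gt_eqF.
have kap2 : kap <= eps / 2.
  by rewrite /kap ler_wpM2l ?(ltW eps0)// lef_pV2 ?posrE// lerDr mulr_ge0// exprn_ge0.
have kapD : 4 * kap * D ^+ 2 <= eps / 2.
  rewrite -kapE (_ : _ / 2 = 4 * kap * D ^+ 2 + kap); last by field.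
  by rewrite lerDl ltW.
have [rho rho0 box] : exists2 rho : R, 0 < rho & forall y : 'rV[R]_d,
    (forall j, `|y ord0 j - x ord0 j| < rho) ->
    [/\ E y <-> phi y <= 0, forall i, `|fc_pd phi i y - fc_pd phi i x| <= kap &
     forall i j, `|fc_pd (fc_pd phi i) j y - A i j| <= kap].
  apply: near_box.
  have n1 i : \forall y \near x, `|fc_pd phi i y - fc_pd phi i x| <= kap.
    by have /cvgrPdist_le/(_ _ kap0) := cpphi i x; apply: filterS => z; rewrite distrC.
  have n2 i j : \forall y \near x, `|fc_pd (fc_pd phi i) j y - A i j| <= kap.
    have [_ [_ c2]] := C1p i.
    have /cvgrPdist_le/(_ _ kap0) := c2 j x; apply: filterS => z.
    by rewrite distrC mxE.
  have n2' i := filter_forall (nbhs_filter x) (n2 i).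
  have nx := nbhs_filter x.
  have n3 := @filterI _ _ nx _ _ nE (@filterI _ _ nx _ _ (filter_forall nx n1)
    (filter_forall nx n2')).
  by apply: filterS n3 => y [[yE _] [y1 y2]]; split.
pose Gr := l1norm (fc_grad phi x) + D * kap.
pose KA := \sum_i \sum_j `|A i j|.
have Gr0 : 0 <= Gr by rewrite addr_ge0 ?l1norm_ge0// mulr_ge0// ltW.
have KA0 : 0 <= KA by apply: sumr_ge0 => i _; exact: sumr_ge0.
pose Q := (8 * Gr + 3 * KA) * D ^+ 2.
have Q0 : 0 <= Q by rewrite mulr_ge0 ?exprn_ge0// addr_ge0// mulr_ge0.
(* eta = 1 / M is the C^2 distance to the identity required of Phi_n; the summands of M give the
   four bounds [eD], [erho], [eQ] and [eG]. *)
pose M := 1 + 2 * D + 4 / rho + 2 * Q / eps + 4 * Gr / eps.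
have a1 : 0 <= 4 / rho by rewrite divr_ge0// ltW.
have a2 : 0 <= 2 * Q / eps by rewrite divr_ge0 ?(ltW eps0)// mulr_ge0.
have a3 : 0 <= 4 * Gr / eps by rewrite divr_ge0 ?(ltW eps0)// mulr_ge0.
have M0 : 0 < M by rewrite /M; lra.
have M1 : 1 <= M by rewrite /M; lra.
have MD : 2 * D <= M by rewrite /M; lra.
have Mrho : 4 / rho <= M by rewrite /M; lra.
have MQ : 2 * Q / eps <= M by rewrite /M; lra.
have MG : 4 * Gr / eps <= M by rewrite /M; lra.
pose eta := M^-1.
have eta0 : 0 < eta by rewrite invr_gt0.
have etaM c : 0 <= c -> c <= M -> c * eta <= 1.
  by move=> c0 cM; rewrite /eta ler_pdivrMr// mul1r.
have eD : D * eta <= 2^-1 by have := etaM _ (mulr_ge0 (ler0n _ 2) D0) MD; lra.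
have erho : eta <= rho / 4.
  have := etaM _ a1 Mrho; rewrite mulrAC ler_pdivrMr// mul1r; lra.
have eQ : Q * eta <= eps / 2.
  have := etaM _ a2 MQ; rewrite mulrAC ler_pdivrMr// mul1r; lra.
have eG : 2 * eta * Gr <= eps / 2.
  have := etaM _ a3 MG; rewrite mulrAC ler_pdivrMr// mul1r; lra.
clearbody eta => {M a1 a2 a3 M0 M1 MD Mrho MQ MG etaM}.
(* For |z| <= delta the l1 norm of z is at most rho / 8 and that of h at most rho / 4. As p is
   within rho / 2 of x, all points used stay in the box of size rho. This radius is fixed before
   n. *)
pose delta := rho / (8 * (D + 1)).
have D1 : 0 < D + 1 by rewrite ltr_wpDl.
have delta0 : 0 < delta by rewrite divr_gt0// mulr_gt0.
exists delta => //.
have := toid _ eta0; apply: filterS => n gn.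
have [PC2 [Psi [PsiC2 [PK PsiK]]]] := diff n.
pose p := Psi x.
pose g (j : 'I_d) (y : 'rV[R]_d) := Phi n y ord0 j - y ord0 j.
have gC j := @C2_sub_coord R d (fc_comp (Phi n) j) j (PC2 j).
have g0 j y : `|g j y| <= eta.
  by have [i|] := pickP 'I_d; [have [] := gn j j j y|move/(_ j)].
have g1 j i y : `|fc_pd (g j) i y| <= eta by have [_ []] := gn j i i y.
have g2 j i k y : `|fc_pd (fc_pd (g j) i) k y| <= eta by have [_ []] := gn j i k y.
have gE y j : Phi n y ord0 j = y ord0 j + g j y by rewrite /g addrC subrK.
have Ep : fc_boundary E p.
  apply: (@boundary_diffeo (Phi n) Psi) => //; first exact: C2map_continuous.
    by rewrite imE.
  by rewrite imE.
have px j : `|p ord0 j - x ord0 j| <= eta.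
  rewrite -(PsiK x) gE -/p opprD addrA subrr sub0r normrN; exact: g0.
have pbox j : `|p ord0 j - x ord0 j| < rho / 2.
  by rewrite (le_lt_trans (px j))// (le_lt_trans erho)// ltr_pM2l// ltf_pV2 ?posrE// ltr_nat.
have pbox' j : `|p ord0 j - x ord0 j| < rho.
  by rewrite (lt_le_trans (pbox j))// ler_pdivrMr// ler_peMr ?ler1n// ltW.
have phip : phi p = 0.
  apply: (@defining_zero E p) => //.
  have r2 : 0 < rho / 2 by rewrite divr_gt0.
  have yp0 j : \forall y \near p, `|(y : 'rV[R]_d) ord0 j - p ord0 j| < rho / 2.
    have /cvgrPdist_lt/(_ _ r2) := @coord_continuous_rV R d j p.
    by apply: filterS => y; rewrite distrC.
  apply: filterS (filter_forall (nbhs_filter p) yp0) => y yp; have [] := box y => // j.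
  rewrite (splitr rho) (le_lt_trans (ler_distD (p ord0 j) _ _))//.
  by rewrite ltrD.
have [_ pgrad _] := box p pbox'.
have sumD (F : 'I_d -> R) c : \sum_i F i + D * c = \sum_i (F i + c).
  by rewrite big_split/= sumr_const card_ord mulr_natl.
pose b := fc_grad phi p.
have bG : l1norm b <= Gr.
  rewrite /Gr sumD.
  apply: ler_sum => i _; rewrite !mxE.
  by have := pgrad i; have := ler_normD (fc_pd phi i p - fc_pd phi i x) (fc_pd phi i x);
    rewrite subrK; lra.
pose G := \matrix_(i, j) fc_pd (g i) j p.
have Geta i j : `|G i j| <= eta by rewrite mxE.
have [nu [nuE nu1 nuj]] := @perturbation_solve R d G b eta Geta eD.
exists nu, (fun z => phi (Psi (x + z))); split.
  move=> j; rewrite (splitr eps).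
  have e1 : 2 * eta * l1norm b <= eps / 2.
    by rewrite (le_trans _ eG)// ler_wpM2l// mulr_ge0// ltW.
  have e3 : `|nu ord0 j - b ord0 j| <= eps / 2 by rewrite (le_trans (nuj j)).
  have e4 : `|b ord0 j - fc_grad phi x ord0 j| <= eps / 2.
    by rewrite /b !mxE (le_trans (pgrad j)).
  by rewrite (le_trans (ler_distD (b ord0 j) _ _))// lerD.
move=> z zd.
set q := Psi (x + z); pose h := q - p.
have qE : q = p + h by rewrite /h addrC subrK.
(* Subtract x = p + g(p) from x + z = q + g(q). *)
have zE j : z ord0 j = h ord0 j + (g j q - g j p).
  have := congr1 (fun v : 'rV[R]_d => v ord0 j) (PsiK (x + z)).
  have := congr1 (fun v : 'rV[R]_d => v ord0 j) (PsiK x).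
  rewrite /= !gE -/p -/q !mxE => e1 e2.
  have -> : z ord0 j = (x ord0 j + z ord0 j) - x ord0 j by rewrite addrC addKr.
  by rewrite -e2 -[in X in _ - X]e1; ring.
have gqp j : `|g j q - g j p| <= eta * l1norm h.
  have := @coord_mean_value R d (g j) p h 0 eta.
  have [[_ [dg _]] _] := gC j; move=> /(_ dg).
  have bx i (y : 'rV[R]_d) : (forall j, `|y ord0 j - p ord0 j| <= `|h ord0 j|) ->
      `|fc_pd (g j) i y - (0 : 'rV[R]_d) ord0 i| <= eta by move=> _; rewrite mxE subr0.
  move=> /(_ bx); rewrite -qE.
  by rewrite [X in _ - _ - X]big1 ?subr0// => i _; rewrite mxE mul0r.
have hz j : `|h ord0 j - z ord0 j| <= eta * l1norm h.
  by rewrite zE opprD addrA subrr sub0r normrN.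
(* The inequality |h| <= |z| + D eta |h| in l1 norm is solved for |h|, using D eta <= 1/2. *)
have sl : l1norm h <= 2 * l1norm z.
  have : l1norm h <= l1norm z + D * eta * l1norm h.
    rewrite -mulrA sumD.
    apply: ler_sum => j _; have := hz j.
    by have := ler_normD (h ord0 j - z ord0 j) (z ord0 j); rewrite subrK; lra.
  have : D * eta * l1norm h <= 2^-1 * l1norm h by rewrite ler_wpM2r// l1norm_ge0.
  lra.
have lz : l1norm z <= D * fc_enorm z by exact: l1norm_le_enorm.
have srho : l1norm h < rho / 2.
  have Dd : D * fc_enorm z <= rho / 8.
    apply: (@le_trans _ _ ((D + 1) * delta)).
      by apply: ler_pM => //; [exact: enorm_ge0|rewrite lerDl].
    by rewrite /delta le_eqVlt; apply/orP; left; apply/eqP; field; rewrite gt_eqF.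
  lra.
have hbox (y : 'rV[R]_d) : (forall k, `|y ord0 k - p ord0 k| <= `|h ord0 k|) ->
    forall j, `|y ord0 j - x ord0 j| < rho.
  move=> yp j; rewrite (splitr rho) (le_lt_trans (ler_distD (p ord0 j) _ _))//.
  by rewrite ltrD// (le_lt_trans (yp j))// (le_lt_trans (l1norm_coord h j)).
split; last first.
  have [<- _ _] : [/\ E q <-> phi q <= 0, forall i, `|fc_pd phi i q - fc_pd phi i x| <= kap &
     forall i j, `|fc_pd (fc_pd phi i) j q - A i j| <= kap].
    by apply: box; apply: hbox => k; rewrite /h !mxE.
  rewrite -imE; split => [[y Ey yq]|Eq]; first by rewrite /q -yq PK.
  by exists q => //; rewrite /q PsiK.
have T := @taylor2 R d phi p h (fun i j => A i j) kap (ltW kap0) (conj cphi (conj dphi cpphi)).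
have ddphi i j y : derivable (fc_pd phi i) y (fc_evec R j) by have [_ [+ _]] := C1p i; exact.
have := T ddphi (fun i j y yp => let: And3 _ _ e := box y (hbox y yp) in e i j).
rewrite -qE phip subr0 -/(l1norm h) => {}T.
pose r := \row_j (g j q - g j p - (h *m G^T) ord0 j) : 'rV[R]_d.
have rj j : `|r ord0 j| <= eta * l1norm h ^+ 2.
  have [C1g ddg] := gC j.
  have := @taylor2 R d (g j) p h (fun _ _ => 0) eta (ltW eta0) C1g ddg.
  have bx i k (y : 'rV[R]_d) : (forall j, `|y ord0 j - p ord0 j| <= `|h ord0 j|) ->
      `|fc_pd (fc_pd (g j) i) k y - 0| <= eta by move=> _; rewrite subr0.
  move=> /(_ bx); rewrite -qE [X in _ - X / 2]big1 => [|i _]; last first.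
    by rewrite big1// => k _; rewrite mul0r.
  rewrite mul0r subr0 mxE; congr (`|_ - _| <= _).
  by rewrite mxE; apply: eq_bigr => i _; rewrite !mxE mulrC.
(* With z = h + h G^T + r and grad phi(p) = nu + nu G, the product of grad phi(p) with h is that of
   nu with z - r. *)
have lin : \sum_i fc_pd phi i p * h ord0 i =
    \sum_i nu ord0 i * z ord0 i - \sum_i nu ord0 i * r ord0 i.
  have bh : \sum_i fc_pd phi i p * h ord0 i = (h *m b^T) ord0 ord0.
    by rewrite mxE; apply: eq_bigr => i _; rewrite !mxE mulrC.
  rewrite bh -nuE linearD/= trmx_mul mulmxDr mulmxA -sumrB mxE.
  rewrite [X in X + _]mxE [X in _ + X]mxE -big_split/=; apply: eq_bigr => i _.
  rewrite zE [r ord0 i]mxE [nu^T _ _]mxE; ring.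
have nur : `|\sum_i nu ord0 i * r ord0 i| <= 2 * Gr * (eta * l1norm h ^+ 2).
  apply: (@le_trans _ _ (l1norm nu * (eta * l1norm h ^+ 2))).
    rewrite mulr_suml; apply: (le_trans (ler_norm_sum _ _ _)); apply: ler_sum => i _.
    by rewrite normrM ler_wpM2l.
  rewrite ler_wpM2r//; first by rewrite mulr_ge0 ?exprn_ge0 ?l1norm_ge0// ltW.
  by rewrite (le_trans nu1)// ler_pM2l.
have eh0 : 0 <= eta * l1norm h by rewrite mulr_ge0 ?l1norm_ge0// ltW.
have qd := @qform_diff_le R d A h z KA _ eh0 (lexx _) hz.
have -> : phi q - (\sum_i nu ord0 i * z ord0 i + qform A z / 2) =
   (phi q - \sum_i fc_pd phi i p * h ord0 i - qform A h / 2) -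
   \sum_i nu ord0 i * r ord0 i + (qform A h - qform A z) / 2 by rewrite lin; ring.
set l := l1norm z in lz sl qd *; set s := l1norm h in sl srho T nur qd *.
have s0 : 0 <= s by exact: l1norm_ge0.
have l0 : 0 <= l by exact: l1norm_ge0.
have s2 : s ^+ 2 <= 4 * l ^+ 2.
  by rewrite (_ : 4 * l ^+ 2 = (2 * l) ^+ 2) ?lerXn2r ?nnegrE ?mulr_ge0//; ring.
have ssl : s * (s + l) <= 6 * l ^+ 2.
  rewrite (_ : 6 * l ^+ 2 = (2 * l) * (2 * l + l)); last by ring.
  by rewrite ler_pM ?addr_ge0// lerD2r.
have l2 : l ^+ 2 <= D ^+ 2 * fc_enorm z ^+ 2.
  by rewrite -exprMn lerXn2r ?nnegrE ?mulr_ge0 ?enorm_ge0.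
apply: (@le_trans _ _ (kap * (4 * l ^+ 2) + 2 * Gr * (eta * (4 * l ^+ 2)) +
    KA * (eta * (6 * l ^+ 2)) / 2)).
  apply: (le_trans (ler_normD _ _)); apply: lerD.
    apply: (le_trans (ler_normB _ _)); apply: lerD.
      by rewrite (le_trans T)// ler_wpM2l// ltW.
    rewrite (le_trans nur)// ler_wpM2l ?mulr_ge0// ler_wpM2l// ltW//.
  rewrite normrM (ger0_norm (x := 2^-1))// ler_wpM2r// (le_trans qd)// ler_wpM2l//.
  by rewrite -mulrA ler_wpM2l// ltW.
rewrite (_ : _ + _ = (4 * kap + (8 * Gr + 3 * KA) * eta) * l ^+ 2); last by field.
have c0 : 0 <= 4 * kap + (8 * Gr + 3 * KA) * eta.
  by rewrite addr_ge0 ?(mulr_ge0 _ (ltW kap0))// mulr_ge0 ?(ltW eta0)// addr_ge0// mulr_ge0.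
apply: (@le_trans _ _ ((4 * kap + (8 * Gr + 3 * KA) * eta) * (D ^+ 2 * fc_enorm z ^+ 2))).
  by rewrite ler_wpM2l.
rewrite mulrA ler_wpM2r ?sqr_ge0//.
rewrite (_ : _ * D ^+ 2 = 4 * kap * D ^+ 2 + Q * eta); last by rewrite /Q; ring.
by rewrite (splitr eps) lerD.
Qed.
End Expansion.

(** * Mean curvature as a trace *)

Section Curvature.
Variables (R : realType) (d : nat).

Lemma derive_line (F : 'rV[R]_d -> R) (x v : 'rV[R]_d) :
  'D_v F x = 'D_(1 : R) (fun t : R => F (x + t *: v)) 0.
Proof.
have E : (fun h : R => h^-1 *: ((F \o shift x) (h *: v) - F x)) = (fun h : R =>
    h^-1 *: (((fun t : R => F (x + t *: v)) \o shift 0) (h *: (1 : R)) - F (x + 0 *: v))).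
  apply/funext => h /=; rewrite scale0r; congr (_ *: (F _ - F _)); last by rewrite addr0.
  by rewrite [h *: (1 : R)]mulr1 addr0 addrC.
by rewrite /derive E.
Qed.

Lemma is_derive_big_sum n (f df : 'I_n -> R -> R) (t : R) :
  (forall k, is_derive t (1 : R) (f k) (df k t)) ->
  is_derive t (1 : R) (fun t => \sum_k f k t) (\sum_k df k t).
Proof.
move=> fd; have := @is_derive_sum R R R n f t 1 (fun k => df k t) fd.
by rewrite (_ : \sum_(i < n) f i = (fun t => \sum_k f k t))//; apply/funext => u; rewrite fct_sumE.
Qed.

(** Along the i-th axis through x, one-variable rules give the summand A_ii / N - nu_i (sum over k
    of nu_k A_ki) / N^3 with N the norm of nu. Summing over i leaves the trace over N minus the form
    A at nu over N^3. *)
Lemma mean_curvE (phi : 'rV[R]_d -> R) (x : 'rV[R]_d) : fc_C2 phi -> fc_grad_ne0 phi x ->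
  fc_mean_curv_via phi x =
    tilted_trace (fc_grad phi x) (\matrix_(i, j) fc_pd (fc_pd phi i) j x).
Proof.
move=> [C1phi C1p] gne0.
set nu := fc_grad phi x; set A := \matrix_(i, j) _.
pose N := fc_enorm nu.
have N2 : N ^+ 2 = \sum_k fc_pd phi k x ^+ 2.
  by rewrite sqr_enorm; apply: eq_bigr => k _; rewrite mxE.
have N20 : 0 < N ^+ 2.
  have [i i0] := gne0; rewrite N2 (bigD1 i)//= ltr_wpDr ?sumr_ge0//.
    by move=> k _; exact: sqr_ge0.
  by rewrite lt0r sqrf_eq0 i0 sqr_ge0.
have N0 : 0 < N by rewrite lt0r enorm_ge0 andbT; apply: contraTN N20 => /eqP->; rewrite expr0n ltxx.
have term i : fc_pd (fun y => fc_pd phi i y / fc_enorm (fc_grad phi y)) i x =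
    A i i / N - nu ord0 i * (\sum_k nu ord0 k * A k i) / N ^+ 3.
  rewrite /fc_pd derive_line.
  pose a k (t : R) := fc_pd phi k (x + t *: fc_evec R i).
  have a0 k : a k 0 = nu ord0 k by rewrite /a scale0r addr0 mxE.
  have da k : is_derive (0 : R) (1 : R) (a k) (A k i).
    have [_ [dk _]] := C1p k.
    have := @is_derive_line R d (fc_pd phi k) x (fc_evec R i) 0 (dk i _).
    by rewrite /A mxE scale0r addr0.
  pose q (t : R) := \sum_k a k t ^+ 2.
  have q0 : q 0 = N ^+ 2 by rewrite N2; apply: eq_bigr => k _; rewrite a0 mxE.
  have dq : is_derive (0 : R) (1 : R) q (2 * \sum_k nu ord0 k * A k i).
    rewrite mulr_sumr.
    apply: (@is_derive_big_sum _ (fun k t => a k t ^+ 2) (fun k t => 2 * (nu ord0 k * A k i))) => k.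
    have := @is_deriveX R R (a k) 2 0 1 _ (da k).
    by rewrite /GRing.scale/= a0 expr1 mulrA.
  have ds : is_derive (0 : R) (1 : R) (fun t => Num.sqrt (q t)) ((\sum_k nu ord0 k * A k i) / N).
    have q00 : 0 < q 0 by rewrite q0.
    have dsq := is_derive1_sqrt q00.
    have := @is_derive1_comp R (@Num.sqrt R) q 0 _ _ dsq dq.
    have sq0 : Num.sqrt (q 0) = N by rewrite q0 sqrtr_sqr gtr0_norm.
    rewrite sq0 (_ : _ / _ = (2 * N)^-1 * (2 * \sum_k nu ord0 k * A k i)); last first.
      by field; rewrite gt_eqF.
    exact.
  have sq0 : Num.sqrt (q 0) = N by rewrite q0 sqrtr_sqr gtr0_norm.
  have E : (fun t : R => fc_pd phi i (x + t *: fc_evec R i) /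
      fc_enorm (fc_grad phi (x + t *: fc_evec R i))) = (fun t => a i t * (Num.sqrt (q t))^-1).
    apply/funext => t; rewrite /a /fc_enorm; congr (_ / Num.sqrt _).
    by apply: eq_bigr => k _; rewrite mxE.
  rewrite E.
  have sn0 : Num.sqrt (q 0) != 0 by rewrite sq0 gt_eqF.
  have dV := @is_deriveV R (fun t => Num.sqrt (q t)) 0 _ _ sn0 ds.
  have dM := @is_deriveM R R (a i) (fun t => (Num.sqrt (q t))^-1) 0 1 _ _ (da i) dV.
  rewrite [LHS](@derive_val _ _ _ _ _ _ _ dM) sq0 a0 /GRing.scale/=.
  by field; rewrite gt_eqF.
rewrite /fc_mean_curv_via (eq_bigr _ (fun i _ => term i)) sumrB -mulr_suml.
rewrite -mulr_suml /tilted_trace -/N /mxtrace mulrBl; congr (_ - _).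
have -> : \sum_i nu ord0 i * (\sum_k nu ord0 k * A k i) = qform A nu.
  rewrite /qform exchange_big/=; apply: eq_bigr => i _; rewrite mulr_sumr.
  by apply: eq_bigr => k _; ring.
by rewrite exprSr invfM mulrA.
Qed.

Lemma continuous_sumr n (f : 'I_n -> 'rV[R]_d -> R) :
  (forall i, continuous (f i)) -> continuous (fun v => \sum_i f i v).
Proof.
by move=> fc; apply: continuous_big => //; exact: add_continuous.
Qed.

Lemma enorm_continuous : continuous (@fc_enorm R d).
Proof.
move=> x; apply: (@continuous_comp _ _ _ (fun v : 'rV[R]_d => \sum_i v ord0 i ^+ 2) (@Num.sqrt R)); last exact: sqrt_continuous.
apply: continuous_sumr => i v.
exact: (continuousM (@coord_continuous_rV R d i v) (@coord_continuous_rV R d i v)).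
Qed.

Lemma qform_continuous (A : 'M[R]_d) : continuous (fun v : 'rV[R]_d => qform A v).
Proof.
apply: continuous_sumr => i; apply: continuous_sumr => j v.
exact: (continuousM (@cst_continuous 'rV[R]_d R (A i j) v)
  (continuousM (@coord_continuous_rV R d i v) (@coord_continuous_rV R d j v))).
Qed.

Lemma tilted_trace_near (A : 'M[R]_d) (nu : 'rV[R]_d) (eps : R) : 0 < fc_enorm nu -> 0 < eps ->
  exists2 r, 0 < r & forall mu : 'rV[R]_d, (forall j, `|mu ord0 j - nu ord0 j| < r) ->
    fc_enorm nu / 2 <= fc_enorm mu /\ `|tilted_trace mu A - tilted_trace nu A| <= eps.
Proof.
move=> nu0 eps0; apply: near_box.
have ne := lt0r_neq0 nu0.
have Tc : {for nu, continuous (fun v : 'rV[R]_d => tilted_trace v A)}.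
  have ec := @enorm_continuous nu.
  have ne2 : fc_enorm nu * fc_enorm nu != 0 by rewrite mulf_neq0.
  have c1 : {for nu, continuous (fun v : 'rV[R]_d => (fc_enorm v * fc_enorm v)^-1)} :=
    @continuousV R _ (fun v : 'rV[R]_d => fc_enorm v * fc_enorm v) nu ne2 (continuousM ec ec).
  have c2 : {for nu, continuous (fun v : 'rV[R]_d => qform A v * (fc_enorm v * fc_enorm v)^-1)} :=
    continuousM (@qform_continuous A nu) c1.
  have c3 : {for nu, continuous (fun v : 'rV[R]_d => \tr A - qform A v * (fc_enorm v * fc_enorm v)^-1)} :=
    continuousB (@cst_continuous 'rV[R]_d R (\tr A) nu) c2.
  exact: (continuousM c3 (@continuousV R _ (@fc_enorm R d) nu ne ec)).
apply: (@filterS2 _ _ (nbhs_filter nu) _ _ _ _ ((cvgrPdist_le _ _).1 Tc _ eps0)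
  ((cvgrPdist_le _ _).1 (@enorm_continuous nu) _ (divr_gt0 nu0 (ltr0n _ 2)))) => mu T1 T2.
split; last by rewrite distrC.
by move: T2; rewrite ler_norml => /andP[_]; lra.
Qed.

End Curvature.

(** * The limit *)

Section Translate.
Variables (R : realType) (n : nat).

Lemma integrable_lam_translate (b : 'rV[R]_n) (f : 'rV[R]_n -> \bar R) :
  (lam R n).-integrable setT f -> (lam R n).-integrable setT (fun v => f (v + b)).
Proof.
move=> /integrableP[mf foo]; apply/integrableP; split.
  exact: (measurableT_comp mf (measurable_addr_mx b)).
rewrite -(@ge0_integral_lam_translate R n b (fun v => `|f v|%E))//.
exact: measurableT_comp.
Qed.

Lemma integral_lam_translate (b : 'rV[R]_n) (f : 'rV[R]_n -> \bar R) : measurable_fun setT f ->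
  (\int[lam R n]_v f v = \int[lam R n]_v f (v + b)%R)%E.
Proof.
move=> mf; rewrite [LHS]integralE [RHS]integralE.
rewrite (ge0_integral_lam_translate b (measurable_funepos mf))//.
rewrite (ge0_integral_lam_translate b (measurable_funeneg mf))//.
by congr (_ - _)%E; apply: eq_integral => v _; rewrite ?funeposE ?funenegE.
Qed.

(** The sign in the integrand of [fc_Kfrac], recentred at x. *)
Definition phase (E : set 'rV[R]_n) (x z : 'rV[R]_n) : R := \1_(~` E) (x + z) - \1_E (x + z).

Lemma phaseE E (x z : 'rV[R]_n) (p : R) : (E (x + z) <-> p <= 0) -> phase E x z = sgn1 p.
Proof.
move=> Ep; rewrite /phase !indicE in_setC /sgn1; case: ifPn => [/Ep Exz|p0].
  by rewrite mem_set// sub0r.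
by rewrite memNset ?subr0// => /Ep; exact/negP.
Qed.

Lemma normr_phase E (x z : 'rV[R]_n) : `|phase E x z| <= 1.
Proof.
rewrite /phase !indicE in_setC; case: (_ \in E) => /=.
  by rewrite sub0r normrN normr1.
by rewrite subr0 normr1.
Qed.

Lemma measurable_phase E (x : 'rV[R]_n) : closed E -> measurable_fun setT (phase E x).
Proof.
move=> cE; have mE := closed_measurable_mx cE.
rewrite (_ : phase E x = (fun v : 'rV[R]_n => \1_(~` E) v - \1_E v) \o (fun z => z + x)).
  apply: measurableT_comp; last exact: measurable_addr_mx.
  apply: measurable_funB; last exact: measurable_indic.
  by apply: measurable_indic; exact: measurableC.
by apply/funext => z /=; rewrite /phase (addrC x).
Qed.

Lemma fc_KfracE s r (x : 'rV[R]_n) E :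
  (lam R n).-integrable setT (EFin \o (fun z => phase E x z * fc_kker n r s (fc_enorm z))) ->
  fc_Kfrac s r x E = (\int[lam R n]_z (phase E x z * fc_kker n r s (fc_enorm z)))%:E.
Proof.
set f := EFin \o _ => fi.
have fE y : ((\1_(~` E) y - \1_E y) * fc_kker n r s (fc_enorm (x - y)))%:E = f (y + - x).
  by rewrite /f /= /phase [x + (y - x)]addrC subrK -(enormN (x - y)) opprB.
rewrite /fc_Kfrac; under [X in fc_iint X]eq_fun do rewrite fE.
rewrite fc_iintE; last exact: integrable_lam_translate.
rewrite -integral_lam_translate; last exact: (measurable_int _ fi).
by rewrite /Rintegral fineK//; exact: integrable_fin_num.
Qed.

End Translate.

Section Asymptotics.
Variables (R : realType) (m : nat).

(** The gradient [nu] changes with n. Half of eps pays for cutting by the ball with that gradient,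
    the other half for replacing it by the gradient of phi at x, by continuity of the tilted trace.
    The bound delta <= 1 is what [kernel_estimate] asks for. *)
Lemma phase_ball_asymptotics (E : set 'rV[R]_m.+1) (En : nat -> set 'rV[R]_m.+1)
    (x : 'rV[R]_m.+1) (H eps : R) :
  closed E -> (forall n, closed (En n)) -> fc_convC En E -> (forall n, fc_boundary (En n) x) ->
  fc_is_mean_curvature E x H -> 0 < eps ->
  exists2 delta : R, 0 < delta <= 1 & \forall n \near \oo, forall u, 0 < u < delta ->
    `|\int[lam R m.+1]_z (phase (En n) x z * \1_(eball u) z) -
      H * vball R m / m.+2%:R * u ^+ m.+2| <= eps * u ^+ m.+2.
Proof.
move=> cE cEn [Phi [diff [toid img]]] bd [phi [phiE ->]] eps0.
have C2phi := phiE.1.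
have gne0 : fc_grad_ne0 phi x.
  have [_ nphi] := phiE; by have /nbhs_singleton[] := nphi.
rewrite mean_curvE//.
set g := fc_grad phi x; set A := \matrix_(i, j) _.
have g0 : 0 < fc_enorm g.
  have [i i0] := gne0; apply: lt_le_trans (enorm_coord g i); first by rewrite normr_gt0 mxE.
pose W := vball R m / m.+2%:R.
have W0 : 0 < W by rewrite divr_gt0// vball_gt0.
pose K := \sum_i \sum_j `|A i j|.
have K0 : 0 <= K by apply: sumr_ge0 => i _; apply: sumr_ge0.
have AK i j : `|A i j| <= K.
  rewrite /K (bigD1 i)//= (bigD1 j)//= -addrA lerDl addr_ge0// ?sumr_ge0// => k _.
  exact: sumr_ge0.
have e20 : 0 < eps / 2 by rewrite divr_gt0.
have g20 : 0 < fc_enorm g / 2 by rewrite divr_gt0.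
have [eta eta0 tilted] := @tilted_integral R m K _ _ K0 g20 e20.
have [r r0 near_g] := tilted_trace_near A g0 (divr_gt0 e20 W0).
(* The halves turn the bounds of the expansion into the strict ones e1 < eta and |nu_j - g_j| <
   r. *)
pose e1 := Num.min (eta / 2) (r / 2).
have e10 : 0 < e1 by rewrite lt_min !divr_gt0.
have [delta delta0 expansion] := diffeo_expansion cE cEn diff toid img bd phiE e10.
exists (Num.min 1 (Num.min eta delta)).
  by rewrite ge_min lexx !lt_min ltr01 eta0 delta0.
apply: filterS expansion => n [nu [psi [nug psiE]]] u /andP[u0].
rewrite !lt_min => /and3P[u1 ueta udelta].
have [cnu Tnu] : fc_enorm g / 2 <= fc_enorm nu /\
    `|tilted_trace nu A - tilted_trace g A| <= eps / 2 / W.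
  apply: near_g => j; apply: le_lt_trans (nug j) _.
  by rewrite gt_min; apply/orP; right; rewrite ltr_pdivrMr// mulrDr mulr1 ltrDl.
have := tilted u e1 nu A psi (phase (En n) x).
rewrite u0 ueta (ltW e10)/= => /(_ isT); rewrite gt_min ltr_pdivrMr// mulrDr mulr1 ltrDl eta0/=.
move=> /(_ isT AK cnu (measurable_phase x (cEn n))) main.
have {}main := main (fun z zu => (psiE z (le_trans zu (ltW udelta))).1).
have {}main := main (fun z zu => phaseE (psiE z (le_trans zu (ltW udelta))).2).
set M := \int[_]_z _ in main *.
have um : 0 < u ^+ m.+2 by rewrite exprn_gt0.
rewrite [X in _ <= X * _]splitr mulrDl; rewrite (le_trans _ (lerD main (lexx _)))//.
have -> : M - tilted_trace g A * vball R m / m.+2%:R * u ^+ m.+2 =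
  (M - tilted_trace nu A * (vball R m * u ^+ m.+2 / m.+2%:R)) +
  (tilted_trace nu A - tilted_trace g A) * (W * u ^+ m.+2).
  by rewrite /W; ring.
rewrite (le_trans (ler_normD _ _))// lerD2l normrM (gtr0_norm (mulr_gt0 W0 um)).
by rewrite mulrA ler_pM2r// -ler_pdivlMr.
Qed.

End Asymptotics.

Section Limit.
Variable R : realType.

(** This is exp y >= 1 + y at y = (1 - s) ln r. The bound is uniform in s > 1, so beta tends to
    infinity whatever the relative speeds of r_n and s_n. *)
Lemma fc_A_ge (r s : R) : 0 < r < 1 -> 1 < s -> - ln r <= fc_A r s.
Proof.
move=> /andP[r0 r1] s1; have s10 : 0 < s - 1 by rewrite subr_gt0.
rewrite /fc_A ler_pdivlMr// /powR gt_eqF//.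
have := expR_ge1Dx ((1 - s) * ln r); lra.
Qed.

Lemma fc_beta_ge d (r s : R) : 0 < r < 1 -> 1 < s -> - ln r <= fc_beta d r s.
Proof.
move=> r01 s1; have A0 := fc_A_ge r01 s1; have /andP[r0 r1] := r01.
have lr : 0 <= - ln r by rewrite oppr_ge0 ln_le0// ltW.
have d1 : 0 < d%:R + 1 :> R by rewrite ltr_wpDl.
apply: le_trans A0 _; rewrite /fc_beta -/(fc_A r s) -mulrAC -mulrDl ler_pdivlMr//.
have := le_trans lr (fc_A_ge r01 s1); move: (fc_A r s) => a a0.
have : 0 <= (s - 1) * a by rewrite mulr_ge0// subr_ge0 ltW.
lra.
Qed.

Lemma near_fc_beta_ge d (r s : nat -> R) (B : R) : (forall n, 0 < r n < 1) ->
  (forall n, 1 < s n) -> r @ \oo --> (0 : R) -> \forall n \near \oo, B <= fc_beta d (r n) (s n).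
Proof.
move=> r01 s1 r0.
have nr := (cvgrPdist_lt _ _).1 r0 _ (expR_gt0 (- B)).
apply: (filterS _ (nr _)) => n; have /andP[rn0 rn1] := r01 n.
rewrite sub0r normrN (gtr0_norm rn0) => rB.
apply: le_trans (fc_beta_ge d (r01 n) (s1 n)).
by rewrite lerNr -ler_expR lnK ?ltW.
Qed.

(** The main term is c0 ((d + 1) beta - 1), so dividing by beta leaves c0 (d + 1) and a bounded
    quantity over beta. The constant C may depend on eps, since beta tends to infinity
    afterwards. *)
Lemma cvg_ratio (d : nat) (I : nat -> R) (r s : nat -> R) (c0 : R) :
  (forall n, 0 < r n < 1) -> (forall n, 1 < s n) -> r @ \oo --> (0 : R) ->
  (forall eps, 0 < eps -> exists C, \forall n \near \oo,
     `|I n - c0 * ((d%:R + s n) * fc_A (r n) (s n))| <=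
       eps * ((d%:R + s n) * fc_A (r n) (s n)) + C) ->
  (fun n => I n / fc_beta d (r n) (s n)) @ \oo --> c0 * d.+1%:R.
Proof.
move=> r01 s1 r0 est; apply/cvgrPdist_le => e e0.
have d1 : 0 < d.+1%:R :> R by [].
pose eps := e / (2 * d.+1%:R).
have eps0 : 0 < eps by rewrite divr_gt0// mulr_gt0.
have [C nC] := est _ eps0.
(* The second lower bound on beta makes C + |c0| at most half of e times beta; the first makes beta
   positive. *)
have nb := near_fc_beta_ge d (Num.max 1 (2 * (C + `|c0|) / e)) r01 s1 r0.
apply: (@filterS2 _ _ eventually_filter _ _ _ _ nC nb) => n.
set a := _ * fc_A _ _; set b := fc_beta _ _ _ => hC.
rewrite ge_max => /andP[b1 bC].
have b0 : 0 < b := lt_le_trans ltr01 b1.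
have aE : a = d.+1%:R * b - 1.
  rewrite /a /b /fc_beta -/(fc_A _ _) -natr1; move: (fc_A _ _) => A.
  by field; rewrite natr1 gt_eqF.
rewrite -(@ler_pM2r _ b)// -{2}(gtr0_norm b0) -normrM mulrBl divfK ?gt_eqF//.
have -> : c0 * d.+1%:R * b - I n = - (I n - c0 * a) + c0 by rewrite aE; ring.
rewrite (le_trans (ler_normD _ _))// normrN (le_trans (lerD hC (lexx _)))//.
move: bC; rewrite ler_pdivrMr// => bC.
have : eps * a <= e / 2 * b.
  rewrite aE /eps (_ : e / 2 * b = e / (2 * d.+1%:R) * (d.+1%:R * b)); last first.
    by field; rewrite gt_eqF.
  by rewrite ler_pM2l// lerBlDr lerDl.
clear -bC; lra.
Qed.

End Limit.

Section Main.
Variables (R : realType) (m : nat) (r s : nat -> R).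
Variables (E : set 'rV[R]_m.+1) (En : nat -> set 'rV[R]_m.+1) (x : 'rV[R]_m.+1) (H : R).
Hypotheses (r01 : forall n, 0 < r n < 1) (s1 : forall n, 1 < s n).
Hypotheses (r0 : r @ \oo --> (0 : R)) (scvg : s @ \oo --> (1 : R)).
Hypotheses (CEn : forall n, fc_classC (En n)) (CE : fc_classC E) (cvE : fc_convC En E).
Hypotheses (bdEn : forall n, fc_boundary (En n) x) (HE : fc_is_mean_curvature E x H).

Let I n := \int[lam R m.+1]_z (phase (En n) x z * fc_kker m.+1 (r n) (s n) (fc_enorm z)).
Let c0 := H * vball R m / m.+2%:R.

Let estimate (eps : R) : 0 < eps -> exists C, \forall n \near \oo,
  fc_Kfrac (s n) (r n) x (En n) = (I n)%:E /\
  `|I n - c0 * ((m.+1%:R + s n) * fc_A (r n) (s n))| <=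
       eps * ((m.+1%:R + s n) * fc_A (r n) (s n)) + C.
Proof.
move=> eps0.
have cEn n := closed_classC (CEn n).
have [delta delta01 nd] := phase_ball_asymptotics (closed_classC CE) cEn cvE bdEn HE eps0.
have /andP[delta0 delta1] := delta01.
(* With d = m + 1 and 1 < s <= 2, (d + s) / s is at most d + 1, and delta^(-s) is at most delta^(-2)
   because delta <= 1. *)
exists ((`|c0| + vball R m.+1) * m.+2%:R * delta `^ (- 2)).
have ns : \forall n \near \oo, s n <= 2.
  have nr := (cvgrPdist_le _ _).1 scvg 1 ltr01; apply: (filterS _ (nr _)) => n.
  by rewrite ler_norml => /andP[]; lra.
apply: (@filterS2 _ _ eventually_filter _ _ _ _ nd ns) => n Mn sn2.
have [Ii Ibd] := @kernel_estimate R m.+1 (phase (En n) x) (r n) (s n) c0 eps delta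
  (measurable_phase x (cEn n)) (normr_phase (En n) x) (r01 n) (s1 n) (ltW eps0) delta01 Mn.
split; first exact: fc_KfracE.
apply: le_trans Ibd _; rewrite lerD2l.
have s0 : 0 < s n by apply: lt_trans (s1 n).
apply: ler_pM.
- by rewrite mulr_ge0 ?addr_ge0 ?(ltW (vball_gt0 _ _))// divr_ge0// ?addr_ge0// ltW.
- exact: powR_ge0.
- rewrite ler_wpM2l ?addr_ge0 ?(ltW (vball_gt0 _ _))// ler_pdivrMr//.
  rewrite -[m.+2%:R]natr1 mulrDl mul1r lerD2r ler_peMr// ltW//; exact: s1.
- by rewrite ger_powR ?delta0// lerN2.
Qed.

Lemma frac_curvature_cvg :
  (fun n => (fc_Kfrac (s n) (r n) x (En n) * ((fc_beta m.+1 (r n) (s n))^-1)%:E)%E)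
    @ \oo --> (fc_omega R m * H%:E)%E.
Proof.
have [C nK] := estimate ltr01.
(* The factor d + 1 coming from beta cancels the division by d + 1 in the coefficient [c0]. *)
rewrite fc_omegaE -EFinM (_ : vball R m * H = c0 * m.+2%:R); last first.
  by rewrite /c0 divfK// mulrC.
have cI := @cvg_ratio R m.+1 I r s c0 r01 s1 r0.
have {}cI : (fun n => I n / fc_beta m.+1 (r n) (s n)) @ \oo --> c0 * m.+2%:R.
  apply: cI => eps eps0; have [C' nC'] := estimate eps0; exists C'.
  by apply: filterS nC' => n [].
apply/fine_cvgP; split; first by apply: (@filterS _ _ eventually_filter _ _ _ nK) => n [-> _].
apply: cvg_trans cI; apply: near_eq_cvg.
by apply: (@filterS _ _ eventually_filter _ _ _ nK) => n /= [-> _].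
Qed.

End Main.

Theorem theorem5p7 (R : realType) (d : nat) (rn sn : nat -> R)
    (En : nat -> set 'rV[R]_d) (E : set 'rV[R]_d) (x : 'rV[R]_d) (H : R) :
  (2 <= d)%N ->
  (forall n, 0 < rn n < 1) -> (forall n, 1 < sn n) ->
  rn @ \oo --> (0 : R) -> sn @ \oo --> (1 : R) ->
  (forall n, fc_classC (En n)) -> fc_classC E -> fc_convC En E ->
  fc_boundary E x -> (forall n, fc_boundary (En n) x) ->
  fc_is_mean_curvature E x H ->
  (fun n => (fc_Kfrac (sn n) (rn n) x (En n) * ((fc_beta d (rn n) (sn n))^-1)%:E)%E)
    @ \oo --> (fc_omega R d.-1 * H%:E)%E.
Proof.
case: d En E x => [|m] En E x // _ r01 s1 r0 scvg CEn CE cvE _ bdEn HE.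
exact: (frac_curvature_cvg r01 s1 r0 scvg CEn CE cvE bdEn HE).
Qed.
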